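(* Let $n\ge2$, let $(M,g)$ be a real analytic oriented Lorentzian $(n+1)$-manifold, let $U\subset\mathbb{R}^n$ be a domain, and let $F:U\to M$ be a real analytic immersion with a light-like point $o\in U$ whose mean curvature function $H_F$ (defined on $U\setminus\Sigma_F$) can be extended real analytically to the whole of $U$. If $\log|H_F|$ is bounded on $U$ (where $H_F$ also denotes the extension), then the image of $F$ contains a light-like geodesic segment of $M$ passing through $F(o)$.
   Context: The signature of $g$ is $(-,+,\dots,+)$; $D$ is the Levi-Civita connection and $\Omega$ the Lorentzian volume form. Let $(u_1,\dots,u_n)$ be the coordinates on $U$ and $F_{u_i}=dF(\partial/\partial u_i)$. $S_F=(s_{i,j})_{i,j=1}^n$ with $s_{i,j}=g(F_{u_i},F_{u_j})$, $B_F=\det S_F$, and $\Sigma_F=\{p\in U:B_F(p)=0\}$ is the set of light-like points. The normal field $\tilde\nu$ along $F$ is defined by $g(\tilde\nu,w)=\Omega(F_{u_1},\dots,F_{u_n},w)$ for all $w$; it satisfies $g(\tilde\nu,\tilde\nu)=-B_F$. Let $\tilde h_{i,j}=g(D_{\partial/\partial u_i}F_{u_j},\tilde\nu)$, let $(\tilde s^{i,j})$ be the cofactor matrix of $S_F$, $A_F=\sum_{i,j}\tilde s^{i,j}\tilde h_{i,j}$, and on $U\setminus\Sigma_F$ let $H_F=\dfrac{A_F}{n|B_F|^{3/2}}$ (the mean curvature function). A light-like geodesic segment passing through a point is the image of a geodesic $\sigma$, defined on an open interval containing $0$, with $\sigma'\ne0$, $g(\sigma',\sigma')=0$, and $\sigma(0)$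 equal to that point. *)

(* Defs.v *)
(* MathComp / MathComp-Analysis.

   Vectors of R^m are row vectors, and a bilinear form with Gram matrix G acts
   by (v, w) |-> v G w^T. Accordingly [jacobian f x] has the partial derivative
   of f along the i-th coordinate as its i-th row, and f pushes a tangent vector
   v at x forward to v *m jacobian f x. *)
From HB Require Import structures.
From mathcomp Require Import all_boot all_order all_algebra.
From mathcomp Require Import all_classical all_reals all_analysis.

Set Implicit Arguments.
Unset Strict Implicit.
Unset Printing Implicit Defensive.

Import Order.TTheory GRing.Theory Num.Theory.
Import numFieldNormedType.Exports.

Local Open Scope classical_set_scope.
Local Open Scope ring_scope.

Section Analytic.
Context {R : realType} {n : nat}.

Definition monomial_at (a : 'I_n -> nat) (x : 'rV[R]_n) : R :=
  \prod_i x 0 i ^+ a i.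

(* Partial sum of a family indexed by multi-indices, over the box [0, N[ ^ n. *)
Definition box_sum (t : ('I_n -> nat) -> R) (N : nat) : R :=
  \sum_(a : {ffun 'I_n -> 'I_N}) t (fun i => nat_of_ord (a i)).

(* Near p, f is the sum of an absolutely convergent power series in the n
   variables x - p. *)
Definition analytic_at (f : 'rV[R]_n -> R) (p : 'rV[R]_n) : Prop :=
  exists c : ('I_n -> nat) -> R, \forall x \near p,
    cvgn (box_sum (fun a => `|c a * monomial_at a (x - p)|)) /\
    (box_sum (fun a => c a * monomial_at a (x - p)) @ \oo --> f x).

Definition analytic_on (A : set 'rV[R]_n) (f : 'rV[R]_n -> R) : Prop :=
  forall x, A x -> analytic_at f x.

Definition vec_analytic_at {m : nat} (f : 'rV[R]_n -> 'rV[R]_m) p : Prop :=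
  forall j, analytic_at (fun x => f x 0 j) p.

Definition partial (i : 'I_n) (f : 'rV[R]_n -> R) (x : 'rV[R]_n) : R :=
  'D_(delta_mx 0 i) f x.

End Analytic.

Record chart (R : realType) (T : topologicalType) (m : nat) := Chart {
  chart_dom : set T;
  chart_map :> T -> 'rV[R]_m;
  chart_inv : 'rV[R]_m -> T;
  chart_dom_open : open chart_dom;
  chart_cod_open : open (chart_map @` chart_dom);
  chart_mapK : forall p, chart_dom p -> chart_inv (chart_map p) = p;
  chart_map_continuous : forall p, chart_dom p -> {for p, continuous chart_map};
  chart_inv_continuous : forall x, (chart_map @` chart_dom) x ->
    {for x, continuous chart_inv}
}.

Definition transition {R : realType} {T : topologicalType} {m : nat}
  (c d : chart R T m) : 'rV[R]_m -> 'rV[R]_m := d \o chart_inv c.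

(* Real analytic oriented m-manifold: the atlas consists of positively oriented
   charts only; it need not be maximal. *)
Record orientedManifold (R : realType) (m : nat) := OrientedManifold {
  mfd_space :> topologicalType;
  mfd_hausdorff : hausdorff_space mfd_space;
  mfd_second_countable : @second_countable mfd_space;
  atlas : set (chart R mfd_space m);
  atlas_cover : forall p, exists2 c, atlas c & chart_dom c p;
  atlas_analytic : forall c d p, atlas c -> atlas d ->
    chart_dom c p -> chart_dom d p -> vec_analytic_at (transition c d) (c p);
  atlas_oriented : forall c d p, atlas c -> atlas d ->
    chart_dom c p -> chart_dom d p ->
    0 < \det (jacobian (transition c d) (c p))
}.

(* A chosen chart around p; pointwise quantities that do not depend on the chart
   are evaluated in it. *)
Definition chart_at {R : realType} {m : nat} (M : orientedManifold R m) (p : M) :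
  chart R M m := s2val (cid2 (atlas_cover p)).

(* Symmetric, of signature (-, +, ..., +). *)
Definition lorentzian {R : realType} {n : nat} (G : 'M[R]_n.+1) : Prop :=
  G^T = G /\
  exists2 P : 'M[R]_n.+1, P \in unitmx &
    P *m G *m P^T = diag_mx (\row_i (if i == ord0 then - 1 else 1)).

(* [gram g c x] is the matrix of components of g in the chart c, at the point
   with coordinates x; it is meaningful for c in the atlas and x in the image
   of c only. *)
Record lorentzMetric (R : realType) (n : nat) (M : orientedManifold R n.+1) :=
  LorentzMetric {
  gram :> chart R M n.+1 -> 'rV[R]_n.+1 -> 'M[R]_n.+1;
  gram_analytic : forall c, atlas c -> forall i j,
    analytic_on (c @` chart_dom c) (fun x => gram c x i j);
  gram_lorentzian : forall c, atlas c -> forall p, chart_dom c p ->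
    lorentzian (gram c (c p));
  gram_transition : forall c d p, atlas c -> atlas d ->
    chart_dom c p -> chart_dom d p ->
    let J := jacobian (transition c d) (c p) in
    gram c (c p) = J *m gram d (d p) *m J^T
}.

Section LocalGeometry.
Context {R : realType} {n : nat} {M : orientedManifold R n.+1}.
Variables (g : lorentzMetric M) (c : chart R M n.+1).
Implicit Types x v w : 'rV[R]_n.+1.

Definition gdot x v w : R := (v *m g c x *m w^T) 0 0.

Definition christoffel x (i j : 'I_n.+1) : 'rV[R]_n.+1 :=
  \row_k (2^-1 * \sum_l invmx (g c x) k l *
    (partial i (fun y => g c y j l) x + partial j (fun y => g c y i l) x
     - partial l (fun y => g c y i j) x)).

(* Sum over i, j of v^i w^j Gamma_ij: the zeroth-order part of the Levi-Civita
   connection. *)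
Definition christoffel_form x v w : 'rV[R]_n.+1 :=
  \sum_i \sum_j (v 0 i * w 0 j) *: christoffel x i j.

(* The Lorentzian volume form; it is 1 on positively oriented orthonormal
   frames. *)
Definition volume_form x (v : 'I_n.+1 -> 'rV[R]_n.+1) : R :=
  Num.sqrt `|\det (g c x)| * \det (\matrix_k v k).

End LocalGeometry.

Section Hypersurface.
Context {R : realType} {n : nat} {M : orientedManifold R n.+1}.
Variables (g : lorentzMetric M) (F : 'rV[R]_n -> M).

Definition analytic_immersion (U : set 'rV[R]_n) : Prop :=
  forall u, U u -> {for u, continuous F} /\
    forall c, atlas c -> chart_dom c (F u) ->
      vec_analytic_at (c \o F) u /\ \rank (jacobian (c \o F) u) = n.

Section InChart.
Variable c : chart R M n.+1.

(* Components of F_{u_i} = dF(d/du_i) in the chart c. *)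
Definition tangent (i : 'I_n) (u : 'rV[R]_n) : 'rV[R]_n.+1 :=
  'd (c \o F) u (delta_mx 0 i).

Definition first_form (u : 'rV[R]_n) : 'M[R]_n :=
  \matrix_(i, j) gdot g c (c (F u)) (tangent i u) (tangent j u).

(* D_{d/du_i} F_{u_j}. *)
Definition cov_derivative (i j : 'I_n) (u : 'rV[R]_n) : 'rV[R]_n.+1 :=
  'D_(delta_mx 0 i) (tangent j) u
  + christoffel_form g c (c (F u)) (tangent i u) (tangent j u).

(* The frame (F_{u_1}, ..., F_{u_n}, w). *)
Definition tangent_frame (u : 'rV[R]_n) (w : 'rV[R]_n.+1) (k : 'I_n.+1) :
    'rV[R]_n.+1 :=
  if unlift ord_max k is Some i then tangent i u else w.

(* g being nondegenerate, exactly one vector satisfies the condition. *)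
Definition normal (u : 'rV[R]_n) : 'rV[R]_n.+1 :=
  get [set v | forall w, gdot g c (c (F u)) v w =
    volume_form g c (c (F u)) (tangent_frame u w)].

Definition second_form (u : 'rV[R]_n) : 'M[R]_n :=
  \matrix_(i, j) gdot g c (c (F u)) (cov_derivative i j u) (normal u).

End InChart.

Definition BF (u : 'rV[R]_n) : R := \det (first_form (chart_at (F u)) u).

Definition AF (u : 'rV[R]_n) : R :=
  let c := chart_at (F u) in
  \sum_i \sum_j cofactor (first_form c u) i j * second_form c u i j.

(* Meaningful where BF u != 0 only. *)
Definition HF (u : 'rV[R]_n) : R := AF u / (n%:R * `|BF u| `^ (3 / 2)).

Definition light_like_points (U : set 'rV[R]_n) : set 'rV[R]_n :=
  [set u | U u /\ BF u = 0].

End Hypersurface.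

Section Geodesics.
Context {R : realType} {n : nat} {M : orientedManifold R n.+1}.
Variable g : lorentzMetric M.

Definition velocity (c : chart R M n.+1) (s : R -> M) : R -> 'rV[R]_n.+1 :=
  derive1 (c \o s).

Definition geodesic (I : set R) (s : R -> M) : Prop :=
  forall t, I t -> {for t, continuous s} /\
    forall c, atlas c -> chart_dom c (s t) ->
      [/\ \forall r \near t, derivable (c \o s) r 1,
          derivable (velocity c s) t 1 &
          derive1 (velocity c s) t + christoffel_form g c (c (s t))
            (velocity c s t) (velocity c s t) = 0].

(* [P] is the image of a geodesic s, defined on an open interval containing 0,
   with s' != 0, g(s', s') = 0 and s 0 = p. *)
Definition light_like_geodesic_segment (P : set M) (p : M) : Prop :=
  exists (I : set R) (s : R -> M),
    [/\ open I, is_interval I & I 0] /\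
    [/\ geodesic I s,
        forall t, I t -> forall c, atlas c -> chart_dom c (s t) ->
          velocity c s t != 0 /\
          gdot g c (c (s t)) (velocity c s t) (velocity c s t) = 0,
        s 0 = p & P = s @` I].

End Geodesics.

(* [lne] is the logarithm with lne 0 = -oo, so that boundedness of log|H|
   entails that H has no zero on U. *)
Definition log_abs_bounded {R : realType} {n : nat} (U : set 'rV[R]_n)
  (H : 'rV[R]_n -> R) : Prop :=
  exists K : R, forall u, U u -> (`|lne `|H u|%:E| <= K%:E)%E.

(* Main.v *)
From HB Require Import structures.
Require Import Defs.
From mathcomp Require Import all_boot all_order all_algebra.
From mathcomp Require Import all_classical all_reals all_analysis.
From mathcomp Require Import ring lra.

Set Implicit Arguments.
Unset Strict Implicit.
Unset Printing Implicit Defensive.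

Import Order.TTheory GRing.Theory Num.Theory.
Import numFieldNormedType.Exports.

Local Open Scope classical_set_scope.
Local Open Scope ring_scope.

(** Light-like points of a hypersurface whose mean curvature extends and stays
    bounded away from zero lie on light-like geodesics of the ambient manifold.

    Work in a chart around F o and choose a constant vector e transversal to the
    hypersurface at o. Let nu be the normal with g(nu, e) = 1 and decompose it as
    nu = dF(xi) - beta e. Then g(nu, nu) = - beta, so beta is B up to a factor that
    does not vanish ([det_first_form]), and both xi and beta are smooth through the
    light-like points. The cofactor matrix of the first fundamental form is, up to
    such a factor, the matrix xi^T xi + beta Q with Q smooth ([adjugate_like]);
    contracting it with the second fundamental form relative to nu gives a smooth
    function m, proportional to A where B is not zero, and the hypothesis becomes
    m^2 = (n H)^2 |beta|^3 there ([mean_trace_sqr]), with H^2 between two positive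
    constants.

    Three consequences follow. A function with two derivatives cannot vanish to
    order exactly 3/2, so beta vanishes to second order at every light-like point
    ([no_order_three_halves], [dbeta0]). Differentiating g(nu, nu) = - beta along xi
    gives xi(beta) = 2 m - beta * (smooth) ([derive_beta_xi]), and |m| <= C |beta|
    near o, so xi(beta) is bounded by a multiple of beta: by a Gronwall argument beta
    vanishes along the integral curve of xi through o. On that curve dF(xi) = nu is a
    null vector orthogonal to the whole tangent space, and since beta and its
    derivative vanish, differentiating g(dF(xi), dF(v)) and g(dF(xi), dF(xi)) shows
    that the acceleration of the image curve is again orthogonal to the tangent
    space, hence a multiple of nu ([accel_nu]). The curve is thus a geodesic up to
    its parameter, which is corrected by adding to the flow of xi a scalar equation
    for the speed ([null_flow], [null_geodesic]).

    Only finitely many derivatives are used. They come from a termwise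
    differentiation of power series ([analytic_derivatives]), which also yields the
    symmetry of second derivatives; integral curves come from successive
    approximations ([picard]). Since the quantities A and B are evaluated in charts
    that vary with the point, and the geodesic equation is required in every chart,
    the transformation law of the Christoffel symbols is needed
    ([christoffel_transition]). *)

(** * Differentials of scalar and matrix-valued maps *)

Lemma is_diff_littleo {K : numFieldType} {V W : normedModType K} (f : V -> W)
    (L : {linear V -> W}) (x : V) : continuous L ->
  (forall e : K, 0 < e ->
    \forall h \near 0, `|f (h + x) - f x - L h| <= e * `|h|) ->
  differentiable f x /\ 'd f x = L :> (V -> W).
Proof.
move=> cL fL.
have E : f \o shift x = cst (f x) + L +o_ 0 id.
  apply/eqaddoP => e e0; move: (fL e e0); apply: filterS => h /=.
  by rewrite opprD addrA.
have dE := diff_unique cL E.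
split=> //; apply/diff_locallyP; split; first by rewrite dE.
by rewrite dE.
Qed.

Lemma near_eq_diff {K : numFieldType} {V W : normedModType K} (f g : V -> W)
    (x : V) : (\forall y \near x, f y = g y) -> differentiable f x ->
  differentiable g x /\ 'd g x = 'd f x :> (V -> W).
Proof.
move=> fg df; apply: is_diff_littleo; first exact: diff_continuous.
move=> e e0.
have := diff_locally df; move/eqaddoP => /(_ e e0) H.
have fg' : \forall h \near 0, f (h + x) = g (h + x).
  by move: fg; rewrite (near_shift 0 x); apply: filterS => h /=; rewrite subr0.
apply: filterS2 fg' H => h fgh /=.
by rewrite -(nbhs_singleton fg) -fgh opprD addrA.
Qed.

Section MatrixCalculus.
Context {R : realType} {V : normedModType R}.

Lemma differentiable_mxP m n (A : V -> 'M[R]_(m, n)) x :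
  differentiable A x <-> forall i j, differentiable (fun u => A u i j) x.
Proof.
split=> [dA i j|dA].
  exact: (differentiable_comp dA (differentiable_coord _ i j)).
have -> : A = \sum_i \sum_j (fun u => A u i j *: delta_mx i j).
  apply/funext => u; rewrite [LHS]matrix_sum_delta fct_sumE; apply: eq_bigr => i _.
  by rewrite fct_sumE.
by apply: differentiable_sum => i; apply: differentiable_sum => j;
  apply: differentiableZl.
Qed.

Lemma derive_entry m n (A : V -> 'M[R]_(m, n)) x v i j : differentiable A x ->
  ('D_v A x) i j = 'D_v (fun u => A u i j) x.
Proof. by move=> dA; rewrite derive_mx ?mxE//; exact: diff_derivable. Qed.

Lemma differentiable_sumf {W : normedModType R} (I : Type) (r : seq I)
    (P : pred I) (f : I -> V -> W) x :
  (forall i, P i -> differentiable (f i) x) ->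
  differentiable (fun u => \sum_(i <- r | P i) f i u) x.
Proof.
move=> df.
have -> : (fun u => \sum_(i <- r | P i) f i u) = \sum_(i <- r | P i) f i.
  by apply/funext => u; rewrite fct_sumE.
by elim/big_ind : _ => // ? ? ? ?; exact: differentiableD.
Qed.

Lemma derive_sumf {W : normedModType R} (I : Type) (r : seq I)
    (P : pred I) (f : I -> V -> W) x v :
  (forall i, P i -> differentiable (f i) x) ->
  'D_v (fun u => \sum_(i <- r | P i) f i u) x = \sum_(i <- r | P i) 'D_v (f i) x.
Proof.
move=> df.
have -> : (fun u => \sum_(i <- r | P i) f i u) = \sum_(i <- r | P i) f i.
  by apply/funext => u; rewrite fct_sumE.
suff [] : differentiable (\sum_(i <- r | P i) f i) x /\
  'D_v (\sum_(i <- r | P i) f i) x = \sum_(i <- r | P i) 'D_v (f i) x by [].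
elim/big_rec2 : _ => [|i y1 y2 Pi [dy <-]].
  by split; [exact: differentiable_cst|exact: derive_cst].
split; first exact: differentiableD (df i Pi) dy.
by rewrite deriveD//; apply: diff_derivable => //; exact: df.
Qed.

Lemma differentiable_mulmx m n p (A : V -> 'M[R]_(m, n)) (B : V -> 'M[R]_(n, p))
    x : differentiable A x -> differentiable B x ->
  differentiable (fun u => A u *m B u) x.
Proof.
move=> /differentiable_mxP dA /differentiable_mxP dB.
apply/differentiable_mxP => i k.
under eq_fun do rewrite mxE.
by apply: differentiable_sumf => j _; apply: differentiableM.
Qed.

Lemma derive_mulmx m n p (A : V -> 'M[R]_(m, n)) (B : V -> 'M[R]_(n, p)) x v :
  differentiable A x -> differentiable B x ->
  'D_v (fun u => A u *m B u) x = 'D_v A x *m B x + A x *m 'D_v B x.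
Proof.
move=> dA dB; have dAB := differentiable_mulmx dA dB.
apply/matrixP => i k; rewrite derive_entry// !mxE.
under eq_fun do rewrite mxE.
have dA' := (differentiable_mxP _ _).1 dA.
have dB' := (differentiable_mxP _ _).1 dB.
rewrite derive_sumf => [|j _]; last exact: differentiableM.
rewrite -big_split/=; apply: eq_bigr => j _.
rewrite deriveM; [|exact: diff_derivable..].
by rewrite !derive_entry// addrC; congr (_ + _); exact: mulrC.
Qed.

Lemma differentiable_trmx m n (A : V -> 'M[R]_(m, n)) x :
  differentiable A x -> differentiable (fun u => (A u)^T) x.
Proof.
move=> /differentiable_mxP dA; apply/differentiable_mxP => i k.
by under eq_fun do rewrite mxE.
Qed.

Lemma derive_trmx m n (A : V -> 'M[R]_(m, n)) x v : differentiable A x ->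
  'D_v (fun u => (A u)^T) x = ('D_v A x)^T.
Proof.
move=> dA; have dA' := differentiable_trmx dA.
apply/matrixP => i k; rewrite derive_entry// !mxE derive_entry//.
by under eq_fun do rewrite mxE.
Qed.

Lemma derive_scalemx m n (f : V -> R) (A : V -> 'M[R]_(m, n)) x v :
  differentiable f x -> differentiable A x ->
  'D_v (fun u => f u *: A u) x = 'D_v f x *: A x + f x *: 'D_v A x.
Proof.
move=> df dA.
have dA' := (differentiable_mxP _ _).1 dA.
have dfA : differentiable (fun u => f u *: A u) x.
  apply/differentiable_mxP => i j; under eq_fun do rewrite mxE.
  exact: differentiableM.
apply/matrixP => i j; rewrite derive_entry// !mxE.
under eq_fun do rewrite mxE.
rewrite deriveM; [|exact: diff_derivable..].
by rewrite derive_entry// addrC; congr (_ + _); exact: mulrC.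
Qed.

Lemma differentiable_scalemx m n (f : V -> R) (A : V -> 'M[R]_(m, n)) x :
  differentiable f x -> differentiable A x ->
  differentiable (fun u => f u *: A u) x.
Proof.
move=> df /differentiable_mxP dA.
apply/differentiable_mxP => i j; under eq_fun do rewrite mxE.
exact: differentiableM.
Qed.

End MatrixCalculus.

Lemma derive_dirE {R : realType} {n : nat} {W : normedModType R}
    (f : 'rV[R]_n -> W) x v : differentiable f x ->
  'D_v f x = \sum_i v 0 i *: 'D_(delta_mx 0 i) f x.
Proof.
move=> df; rewrite deriveE// {1}(row_sum_delta v) linear_sum/=.
by apply: eq_bigr => i _; rewrite linearZ/= deriveE.
Qed.

Lemma derive_comp {R : realType} {U V W : normedModType R} (f : U -> V)
    (g : V -> W) x v : differentiable f x -> differentiable g (f x) ->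
  'D_v (g \o f) x = 'D_('D_v f x) g (f x).
Proof.
move=> df dg; rewrite [LHS]deriveE; last exact: differentiable_comp.
by rewrite diff_comp//= -!deriveE.
Qed.
(** * Functions with continuous derivatives up to a given order *)

Section Ck.
Context {R : realType} {n : nat}.
Implicit Types (W : set 'rV[R]_n) (f g : 'rV[R]_n -> R).

(** All partial derivatives of order less than k are Frechet differentiable.
    Asking for differentiability only, and not for the continuity of the
    derivatives of top order, makes the induction over k uniform. *)
Fixpoint Ck (k : nat) W f : Prop :=
  if k is k'.+1 then
    (forall u, W u -> differentiable f u) /\ forall i, Ck k' W (partial i f)
  else True.

Lemma CkP k W f : Ck k.+1 W f ->
  (forall u, W u -> differentiable f u) /\ forall i, Ck k W (partial i f).
Proof. by []. Qed.

Lemma Ck_diff k W f u : Ck k.+1 W f -> W u -> differentiable f u.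
Proof. by move=> [df _]; exact: df. Qed.

Lemma Ck_partial k W f i : Ck k.+1 W f -> Ck k W (partial i f).
Proof. by move=> [_ pf]; exact: pf. Qed.

Lemma CkS k W f : Ck k.+1 W f -> Ck k W f.
Proof.
elim: k f => // k IH f /CkP[df pf]; split=> // i.
by apply: IH; exact: pf.
Qed.

Lemma Ck_le k l W f : (k <= l)%N -> Ck l W f -> Ck k W f.
Proof.
move=> kl; rewrite -(subnK kl); elim: (l - k)%N => // m IH Cf; apply: IH.
by apply: CkS; rewrite -addSn.
Qed.

Lemma Ck_subset k W W' f : W' `<=` W -> Ck k W f -> Ck k W' f.
Proof.
move=> WW'; elim: k f => // k IH f /CkP[df pf]; split=> [u /WW'|i]; first exact: df.
exact/IH/pf.
Qed.

Lemma near_open W f g u : open W -> (forall x, W x -> f x = g x) -> W u ->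
  \forall x \near u, f x = g x.
Proof.
move=> oW fg Wu; have : nbhs u W by exact: open_nbhs_nbhs.
exact: filterS.
Qed.

Lemma Ck_eq k W f g : open W -> (forall u, W u -> f u = g u) ->
  Ck k W f -> Ck k W g.
Proof.
move=> oW; elim: k f g => // k IH f g fg /CkP[df pf]; split=> [u Wu|i].
  by have [] := near_eq_diff (near_open oW fg Wu) (df u Wu).
apply: (IH (partial i f)); last exact: pf.
by move=> u Wu; exact: near_eq_derive (near_open oW fg Wu).
Qed.

Lemma Ck_cst k W (c : R) : Ck k W (fun=> c).
Proof.
elim: k c => // k IH c; split=> [u _|i]; first exact: differentiable_cst.
rewrite (_ : partial i _ = fun=> 0)//.
by apply/funext => u; rewrite /partial; exact: derive_cst.
Qed.

Lemma Ck_add k W f g : open W -> Ck k W f -> Ck k W g ->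
  Ck k W (fun u => f u + g u).
Proof.
move=> oW; elim: k f g => // k IH f g /CkP[df pf] /CkP[dg pg]; split=> [u Wu|i].
  by apply: differentiableD; [exact: df|exact: dg].
apply: (Ck_eq oW _ (IH _ _ (pf i) (pg i))) => u Wu.
by rewrite /partial deriveD//; apply: diff_derivable; [apply: df|apply: dg].
Qed.

Lemma Ck_mul k W f g : open W -> Ck k W f -> Ck k W g ->
  Ck k W (fun u => f u * g u).
Proof.
move=> oW; elim: k f g => // k IH f g Cf Cg.
have [df pf] := CkP Cf; have [dg pg] := CkP Cg; split=> [u Wu|i].
  by apply: differentiableM; [exact: df|exact: dg].
apply: (Ck_eq (f := fun u => f u * partial i g u + g u * partial i f u)) => //.
  move=> u Wu; rewrite /partial deriveM//; apply: diff_derivable.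
    exact: df.
  exact: dg.
have Cf' := CkS Cf; have Cg' := CkS Cg.
by apply: Ck_add => //; apply: IH.
Qed.

Lemma Ck_opp k W f : open W -> Ck k W f -> Ck k W (fun u => - f u).
Proof.
move=> oW Cf; apply: (Ck_eq (f := fun u => -1 * f u)) => //.
  by move=> u _; rewrite mulN1r.
by apply: Ck_mul => //; exact: Ck_cst.
Qed.

Lemma Ck_sum k W (I : Type) (r : seq I) (P : pred I) (f : I -> 'rV[R]_n -> R) :
  open W -> (forall i, P i -> Ck k W (f i)) ->
  Ck k W (fun u => \sum_(i <- r | P i) f i u).
Proof.
move=> oW Cf.
have -> : (fun u => \sum_(i <- r | P i) f i u) = \sum_(i <- r | P i) f i.
  by apply/funext => u; rewrite fct_sumE.
elim/big_ind : _ => //; first exact: (Ck_cst k W 0).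
by move=> ? ? ? ?; exact: Ck_add.
Qed.

Lemma Ck_prod k W (I : Type) (r : seq I) (P : pred I) (f : I -> 'rV[R]_n -> R) :
  open W -> (forall i, P i -> Ck k W (f i)) ->
  Ck k W (fun u => \prod_(i <- r | P i) f i u).
Proof.
move=> oW Cf; elim: r => [|i r IH].
  by apply: (Ck_eq (f := fun=> 1)) => // [u _|]; [rewrite big_nil|exact: Ck_cst].
case Pi: (P i); last first.
  by apply: (Ck_eq _ _ IH) => // u _; rewrite big_cons Pi.
apply: (Ck_eq _ _ (Ck_mul oW (Cf i Pi) IH)) => // u _.
by rewrite big_cons Pi.
Qed.

Lemma Ck_inv k W f : open W -> (forall u, W u -> f u != 0) -> Ck k W f ->
  Ck k W (fun u => (f u)^-1).
Proof.
move=> oW f0; elim: k => // k IH /CkP[df pf]; split=> [u Wu|i].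
  by apply: differentiableV; [exact: df|exact: f0].
have CI : Ck k W (fun u => (f u)^-1) by apply: IH; exact: CkS.
apply: (Ck_eq (f := fun u => - ((f u)^-1 * (f u)^-1) * partial i f u)) => //.
  move=> u Wu; rewrite /partial deriveV//; last exact/diff_derivable/df.
    by rewrite expr2 invfM.
  exact: f0.
by apply: Ck_mul => //; apply: Ck_opp => //; apply: Ck_mul.
Qed.

Definition Ckmx k W p q (A : 'rV[R]_n -> 'M[R]_(p, q)) : Prop :=
  forall i j, Ck k W (fun u => A u i j).

Lemma Ckmx_diff k W p q (A : 'rV[R]_n -> 'M[R]_(p, q)) u :
  Ckmx k.+1 W A -> W u -> differentiable A u.
Proof.
move=> CA Wu; apply/differentiable_mxP => i j; exact: Ck_diff (CA i j) Wu.
Qed.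

Lemma Ckmx_le k l W p q (A : 'rV[R]_n -> 'M[R]_(p, q)) :
  (k <= l)%N -> Ckmx l W A -> Ckmx k W A.
Proof. by move=> kl CA i j; exact: Ck_le (CA i j). Qed.

Lemma Ckmx_subset k W W' p q (A : 'rV[R]_n -> 'M[R]_(p, q)) :
  W' `<=` W -> Ckmx k W A -> Ckmx k W' A.
Proof. by move=> WW CA i j; exact: Ck_subset (CA i j). Qed.

Lemma Ckmx_eq k W p q (A B : 'rV[R]_n -> 'M[R]_(p, q)) : open W ->
  (forall u, W u -> A u = B u) -> Ckmx k W A -> Ckmx k W B.
Proof. by move=> oW AB CA i j; apply: (Ck_eq oW _ (CA i j)) => u /AB ->. Qed.

Lemma Ckmx_cst k W p q (A : 'M[R]_(p, q)) : Ckmx k W (fun=> A).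
Proof. by move=> i j; exact: Ck_cst. Qed.

Lemma Ckmx_add k W p q (A B : 'rV[R]_n -> 'M[R]_(p, q)) : open W ->
  Ckmx k W A -> Ckmx k W B -> Ckmx k W (fun u => A u + B u).
Proof.
move=> oW CA CB i j.
by apply: (Ck_eq oW _ (Ck_add oW (CA i j) (CB i j))) => u _; rewrite mxE.
Qed.

Lemma Ckmx_scale k W p q f (A : 'rV[R]_n -> 'M[R]_(p, q)) : open W ->
  Ck k W f -> Ckmx k W A -> Ckmx k W (fun u => f u *: A u).
Proof.
move=> oW Cf CA i j.
by apply: (Ck_eq oW _ (Ck_mul oW Cf (CA i j))) => u _; rewrite mxE.
Qed.

Lemma Ckmx_tr k W p q (A : 'rV[R]_n -> 'M[R]_(p, q)) : open W ->
  Ckmx k W A -> Ckmx k W (fun u => (A u)^T).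
Proof. by move=> oW CA i j; apply: (Ck_eq oW _ (CA j i)) => u _; rewrite mxE. Qed.

Lemma Ckmx_mul k W p q r (A : 'rV[R]_n -> 'M[R]_(p, q))
    (B : 'rV[R]_n -> 'M[R]_(q, r)) : open W ->
  Ckmx k W A -> Ckmx k W B -> Ckmx k W (fun u => A u *m B u).
Proof.
move=> oW CA CB i l.
apply: (Ck_eq (f := fun u => \sum_j A u i j * B u j l)) => //.
  by move=> u _; rewrite mxE.
by apply: Ck_sum => // j _; apply: Ck_mul.
Qed.

Lemma Ck_det k W p (A : 'rV[R]_n -> 'M[R]_p) : open W ->
  Ckmx k W A -> Ck k W (fun u => \det (A u)).
Proof.
move=> oW CA; apply: Ck_sum => // s _; apply: Ck_mul => //; first exact: Ck_cst.
by apply: Ck_prod => // i _; exact: CA.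
Qed.

Lemma Ckmx_inv k W p (A : 'rV[R]_n -> 'M[R]_p) : open W ->
  (forall u, W u -> A u \in unitmx) -> Ckmx k W A ->
  Ckmx k W (fun u => invmx (A u)).
Proof.
move=> oW uA CA.
apply: (Ckmx_eq (A := fun u => (\det (A u))^-1 *: \adj (A u))) => //.
  by move=> u Wu; rewrite /invmx uA.
apply: Ckmx_scale => //.
  apply: Ck_inv => //; last exact: Ck_det.
  by move=> u /uA; rewrite unitmxE unitfE.
move=> i j.
apply: (Ck_eq (f := fun u => (-1) ^+ (j + i) * \det (row' j (col' i (A u))))) => //.
  by move=> u _; rewrite [in RHS]mxE.
apply: Ck_mul => //; first exact: Ck_cst.
apply: Ck_det => // a b.
apply: (Ck_eq (f := fun u => A u (lift j a) (lift i b))) => //.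
  by move=> u _; rewrite !mxE.
Qed.

Lemma Ckmx_derive k W p q (A : 'rV[R]_n -> 'M[R]_(p, q)) i : open W ->
  Ckmx k.+1 W A -> Ckmx k W (fun u => 'D_(delta_mx 0 i) A u).
Proof.
move=> oW CA a b.
apply: (Ck_eq oW _ (Ck_partial i (CA a b))) => u Wu.
by rewrite derive_entry//; exact: Ckmx_diff CA Wu.
Qed.

End Ck.

Lemma Ck_comp {R : realType} {m n : nat} k (W : set 'rV[R]_n) (Z : set 'rV[R]_m)
    (f : 'rV[R]_m -> R) (phi : 'rV[R]_n -> 'rV[R]_m) : open W ->
  (forall u, W u -> Z (phi u)) -> Ck k Z f -> Ckmx k W phi ->
  Ck k W (fun u => f (phi u)).
Proof.
move=> oW WZ; elim: k f => // k IH f /CkP[df pf] Cphi.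
have dphi u : W u -> differentiable phi u by move=> Wu; exact: Ckmx_diff Cphi Wu.
split=> [u Wu|i].
  by apply: (differentiable_comp (dphi u Wu)); exact/df/WZ.
apply: (Ck_eq
  (f := fun u => \sum_j partial i (fun u => phi u 0 j) u * partial j f (phi u))) => //.
  move=> u Wu; rewrite /partial (derive_comp _ (dphi u Wu) (df _ (WZ _ Wu))).
  rewrite derive_dirE; last exact/df/WZ.
  by apply: eq_bigr => j _; rewrite derive_entry//; exact: dphi.
apply: Ck_sum => // j _; apply: Ck_mul => //.
  by have [_] := CkP (Cphi 0 j).
apply: IH; first exact: pf.
by apply: Ckmx_le Cphi.
Qed.
(** * Sums of power series are infinitely differentiable *)

Section ProductRemainder.
Context {R : realType} {I : eqType}.
Variables (u v D A : I -> R) (e : R).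
Hypotheses (e0 : 0 <= e) (A0 : forall i, 0 <= A i).
Hypotheses (uA : forall i, `|u i| <= A i) (vA : forall i, `|v i| <= A i).
Hypotheses (uvA : forall i, `|u i - v i| <= A i * e).
Hypotheses (uvDA : forall i, `|u i - v i - D i| <= A i * e ^+ 2).

Let prodA0 s : 0 <= \prod_(i <- s) A i.
Proof. by apply: prodr_ge0. Qed.

Lemma prod_norm_le (w : I -> R) s : (forall i, `|w i| <= A i) ->
  `|\prod_(i <- s) w i| <= \prod_(i <- s) A i.
Proof. by move=> wA; rewrite normr_prod; apply: ler_prod => i _; rewrite normr_ge0 wA. Qed.

(** Telescoping: one factor is changed at a time, the others being bounded by
    the A i on both sides. *)
Lemma prod_increment s :
  `|\prod_(i <- s) u i - \prod_(i <- s) v i| <=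
  (size s)%:R * e * \prod_(i <- s) A i.
Proof.
elim: s => [|x s IH]; first by rewrite !big_nil subrr normr0 mul0r mul0r.
rewrite !big_cons /=.
set U := \prod_(i <- s) u i; set V := \prod_(i <- s) v i.
have -> : u x * U - v x * V = u x * (U - V) + (u x - v x) * V by ring.
apply: (le_trans (ler_normD _ _)); rewrite !normrM.
apply: (le_trans (lerD (ler_pM _ _ (uA x) IH)
  (ler_pM _ _ (uvA x) (prod_norm_le s vA)))) => //.
by rewrite -natr1 le_eqVlt; apply/orP; left; apply/eqP; ring.
Qed.

(** The same telescoping for the first-order expansion; the square of the number
    of factors counts the pairs of factors that vary simultaneously. *)
Lemma prod_remainder s : uniq s ->
  `|\prod_(i <- s) u i - \prod_(i <- s) v i
    - \sum_(i <- s) \prod_(j <- s) (if j == i then D j else v j)| <=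
  (size s)%:R ^+ 2 * e ^+ 2 * \prod_(i <- s) A i.
Proof.
elim: s => [_|x s IH /= /andP[xs us]].
  by rewrite !big_nil subrr subr0 normr0 expr2 !mul0r.
rewrite !big_cons eqxx.
have -> : \prod_(j <- s) (if j == x then D j else v j) = \prod_(j <- s) v j.
  rewrite !big_seq; apply: eq_bigr => j js.
  by case: eqP => // jx; rewrite -jx js in xs.
have -> : \sum_(i <- s) \prod_(j <- x :: s) (if j == i then D j else v j) =
    v x * \sum_(i <- s) \prod_(j <- s) (if j == i then D j else v j).
  rewrite mulr_sumr !big_seq; apply: eq_bigr => i si; rewrite big_cons.
  by case: eqP => // xi; rewrite xi si in xs.
have {}IH := IH us; have IH1 := prod_increment s; move: IH IH1.
set U := \prod_(i <- s) u i; set V := \prod_(i <- s) v i.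
set S := \sum_(i <- s) _; set P := \prod_(i <- s) A i => IH IH1.
have -> : u x * U - v x * V - (D x * V + v x * S) =
   v x * (U - V - S) + (u x - v x - D x) * V + (u x - v x) * (U - V) by ring.
have P0 : 0 <= P by exact: prodA0.
apply: (le_trans (ler_normD _ _)).
apply: (le_trans (lerD (ler_normD _ _) (lexx _))); rewrite !normrM.
apply: (le_trans (lerD (lerD (ler_pM _ _ (vA x) IH)
  (ler_pM _ _ (uvDA x) (prod_norm_le s vA))) (ler_pM _ _ (uvA x) IH1))) => //.
rewrite -/P -natr1.
have k0 : 0 <= (size s)%:R :> R by [].
have AP : 0 <= A x * P * e ^+ 2 * (size s)%:R.
  by rewrite !mulr_ge0// ?sqr_ge0.
rewrite -subr_ge0; set k := (size s)%:R in k0 AP *.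
have -> : (k + 1) ^+ 2 * e ^+ 2 * (A x * P) -
  (A x * (k ^+ 2 * e ^+ 2 * P) + A x * e ^+ 2 * P + A x * e * (k * e * P)) =
  A x * P * e ^+ 2 * k by ring.
exact: AP.
Qed.

End ProductRemainder.

Section PowerDerivatives.
Context {R : realType}.
Implicit Types (k b : nat) (t s r q : R).

(** The b-th derivative of t ^+ k. *)
Definition dpow k b t : R := (k ^_ b)%:R * t ^+ (k - b).

Lemma is_derive_dpow k b t : is_derive t 1 (dpow k b) (dpow k b.+1 t).
Proof.
rewrite (_ : dpow k b = cst (k ^_ b)%:R * id ^+ (k - b)); last first.
  by apply/funext => x; rewrite fctE exprfctE.
apply: is_derive_eq.
rewrite scaler0 addr0 /GRing.scale/= mulr1 /dpow.
rewrite ffactnSr natrM subnS; have [kb|kb] := leqP k b.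
  by move: (kb); rewrite -subn_eq0 => /eqP ->; rewrite mulr0n !(mul0r,mulr0).
by rewrite -mulr_natl; ring.
Qed.

Lemma dpow_le k b t q r : 0 < r -> k%:R <= q * r -> `|t| <= r ->
  `|dpow k b t| <= q ^+ b * r ^+ k.
Proof.
move=> r0 kq tr; have q0 : 0 <= q.
  by rewrite -(pmulr_lge0 _ r0) (le_trans _ kq).
rewrite /dpow; have [kb|bk] := ltnP k b.
  by rewrite ffact_small// mul0r normr0 mulr_ge0// exprn_ge0// ltW.
rewrite normrM normrX ger0_norm//.
have -> : q ^+ b * r ^+ k = (q * r) ^+ b * r ^+ (k - b).
  by rewrite exprMn -mulrA -exprD subnKC.
apply: ler_pM => //; last by apply: lerXn2r => //; rewrite nnegrE// ltW.
apply: (@le_trans _ _ (k%:R ^+ b)); last first.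
  by apply: lerXn2r; rewrite ?nnegrE// mulr_ge0// ltW.
rewrite -natrX ler_nat; elim: b {bk} => // b IH.
by rewrite ffactnSr expnSr leq_mul// leq_subr.
Qed.

Lemma segment_norm_le t s x r : `|t| <= r -> `|t + s| <= r ->
  x \in `[t, t + s] \/ x \in `[t + s, t] -> `|x| <= r /\ `|x - t| <= `|s|.
Proof.
rewrite !in_itv/= !ler_norml => /andP[? ?] /andP[? ?] [] /andP[? ?].
  split; first by apply/andP; split; lra.
  by rewrite !ger0_norm; lra.
split; first by apply/andP; split; lra.
by rewrite !ler0_norm; lra.
Qed.

Lemma MVT_increment (f df : R -> R) t s : (forall x : R, is_derive x 1 f (df x)) ->
  exists2 x, x \in `[t, t + s] \/ x \in `[t + s, t] &
    f (t + s) - f t = s * df x.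
Proof.
move=> fdf; have cf (x : R) : {for x, continuous f}.
  by apply/differentiable_continuous/derivable1_diffP; exact: ex_derive.
have cw (a b : R) : {within `[a, b], continuous f}.
  by apply: continuous_subspaceT => x; exact: cf.
have [s0|s0] := leP 0 s.
  have [|x xI e] := @MVT_segment _ f df t (t + s) _ (fun x _ => fdf x) (cw _ _).
    by rewrite lerDl.
  by exists x; [left|rewrite e mulrC; congr (_ * _); lra].
have [|x xI e] := @MVT_segment _ f df (t + s) t _ (fun x _ => fdf x) (cw _ _).
  by lra.
exists x; first by right.
by rewrite -opprB e; ring.
Qed.

Lemma dpow_increment k b t s q r : 0 < r -> k%:R <= q * r -> `|t| <= r ->
  `|t + s| <= r ->
  `|dpow k b (t + s) - dpow k b t| <= `|s| * (q ^+ b.+1 * r ^+ k).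
Proof.
move=> r0 kq tr tsr.
have [x xI ->] := MVT_increment t s (is_derive_dpow k b).
have [xr _] := segment_norm_le tr tsr xI.
by rewrite normrM ler_wpM2l// dpow_le.
Qed.

Lemma dpow_remainder k b t s q r : 0 < r -> k%:R <= q * r -> `|t| <= r ->
  `|t + s| <= r ->
  `|dpow k b (t + s) - dpow k b t - s * dpow k b.+1 t| <=
  `|s| ^+ 2 * (q ^+ b.+2 * r ^+ k).
Proof.
move=> r0 kq tr tsr.
have [x xI ->] := MVT_increment t s (is_derive_dpow k b).
have [xr xts] := segment_norm_le tr tsr xI.
rewrite -mulrBr normrM expr2 -mulrA ler_wpM2l//.
have xE : x = t + (x - t) by lra.
have q0 : 0 <= q by rewrite -(pmulr_lge0 _ r0) (le_trans _ kq).
rewrite {1}xE; apply: (le_trans (dpow_increment _ r0 kq tr _)).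
  by rewrite -xE.
by rewrite ler_wpM2r// mulr_ge0// exprn_ge0// ltW.
Qed.

Lemma bernoulli_le t d : 0 <= t -> d%:R * t <= (1 + t) ^+ d.
Proof.
move=> t0; suff: 1 + d%:R * t <= (1 + t) ^+ d by apply: le_trans; lra.
elim: d => [|d IH]; first by rewrite mul0r addr0 expr0.
rewrite exprS -natr1; apply: (@le_trans _ _ ((1 + t) * (1 + d%:R * t))).
  rewrite -subr_ge0.
  have -> : (1 + t) * (1 + d%:R * t) - (1 + (d%:R + 1) * t) = d%:R * (t * t) by ring.
  by rewrite !mulr_ge0.
by rewrite ler_wpM2l// addr_ge0.
Qed.

(** By induction on B, splitting s ^+ d between two square roots of s: one absorbs
    d ^+ B and Bernoulli's inequality for the other absorbs d. *)
Lemma pow_le_exp B s : 1 < s ->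
  exists2 C, 0 <= C & forall d : nat, d%:R ^+ B <= C * s ^+ d.
Proof.
elim: B s => [|B IH] s s1.
  by exists 1 => // d; rewrite expr0 mul1r exprn_ege1// ltW.
pose z := Num.sqrt s.
have z1 : 1 < z by rewrite -sqrtr1 ltr_sqrt// (lt_trans _ s1).
have zs : z * z = s by rewrite -expr2 sqr_sqrtr// ltW// (lt_trans _ s1).
have [C C0 HC] := IH z z1.
have zz : 0 < z - 1 by rewrite subr_gt0.
exists (C * (z - 1)^-1); first by rewrite mulr_ge0// invr_ge0 ltW.
move=> d; rewrite exprSr -zs exprMn.
have -> : C * (z - 1)^-1 * (z ^+ d * z ^+ d) = C * z ^+ d * ((z - 1)^-1 * z ^+ d) by ring.
apply: ler_pM => //.
have := bernoulli_le d (ltW zz).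
rewrite (_ : 1 + (z - 1) = z); last by ring.
by rewrite -ler_pdivlMr// mulrC.
Qed.

End PowerDerivatives.
Section BoxSums.
Context {R : realType} {n : nat}.
Implicit Types (t c : ('I_n -> nat) -> R) (N : nat).

(** A box of indices embeds into every larger one. *)
Lemma box_sum_nondecreasing t : (forall a, 0 <= t a) ->
  nondecreasing_seq (box_sum t).
Proof.
move=> t0 N M NM; rewrite /box_sum.
pose h (a : {ffun 'I_n -> 'I_N}) : {ffun 'I_n -> 'I_M} :=
  [ffun i => widen_ord NM (a i)].
have h_inj : injective h.
  move=> a b /ffunP hab; apply/ffunP => i; have := hab i; rewrite !ffunE => /(congr1 val).
  by move=> /= ab; exact: val_inj.
have -> : \sum_(a : {ffun 'I_n -> 'I_N}) t (fun i => nat_of_ord (a i)) =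
    \sum_(b in h @: predT) t (fun i => nat_of_ord (b i)).
  rewrite big_imset/=; last by move=> a b _ _; exact: h_inj.
  apply: eq_bigr => a _.
  by congr t; apply/funext => i; rewrite ffunE.
rewrite [leLHS]big_mkcond/=; apply: ler_sum => b _.
by case: ifP.
Qed.

Lemma box_sumD s t N : box_sum (fun a => s a + t a) N = box_sum s N + box_sum t N.
Proof. exact: big_split. Qed.

Lemma box_sumN t N : box_sum (fun a => - t a) N = - box_sum t N.
Proof. exact: sumrN. Qed.

Lemma box_sumZ k t N : box_sum (fun a => k * t a) N = k * box_sum t N.
Proof. by rewrite /box_sum mulr_sumr. Qed.

Lemma box_sum_norm t N : `|box_sum t N| <= box_sum (fun a => `|t a|) N.
Proof. exact: ler_norm_sum. Qed.

Lemma box_sum_le s t N : (forall a, s a <= t a) -> box_sum s N <= box_sum t N.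
Proof. by move=> st; apply: ler_sum => a _; exact: st. Qed.

Lemma box_sum_ge0_cvg t K : (forall a, 0 <= t a) ->
  (forall N, box_sum t N <= K) -> cvgn (box_sum t).
Proof.
move=> t0 tK; apply: nondecreasing_is_cvgn; first exact: box_sum_nondecreasing.
by exists K => _ [N _ <-].
Qed.

(** t is the difference of t + |t| and |t|, whose sums are monotone and bounded. *)
Lemma box_sum_abs_cvg t K : (forall N, box_sum (fun a => `|t a|) N <= K) ->
  cvgn (box_sum t).
Proof.
move=> tK.
have -> : box_sum t = box_sum (fun a => t a + `|t a|) - box_sum (fun a => `|t a|).
  by apply/funext => N; rewrite fctE box_sumD addrK.
apply: is_cvgB; last exact: box_sum_ge0_cvg tK.
apply: (@box_sum_ge0_cvg _ (K + K)) => [a|N].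
  by have := ler_norm (- t a); rewrite normrN; lra.
rewrite box_sumD lerD// (le_trans _ (tK N))//; apply: box_sum_le => a.
exact: ler_norm.
Qed.

Definition mdeg (a : 'I_n -> nat) : nat := (\sum_i a i)%N.

Definition mincr (b : 'I_n -> nat) (i : 'I_n) : 'I_n -> nat :=
  fun j => (b j + (j == i))%N.

(** The derivative of multi-order b of the monomial x ^ a. *)
Definition dmonomial (b a : 'I_n -> nat) (x : 'rV[R]_n) : R :=
  \prod_j dpow (a j) (b j) (x 0 j).

Lemma dmonomial0 a x : dmonomial (fun=> 0%N) a x = monomial_at a x.
Proof.
by apply: eq_bigr => j _; rewrite /dpow ffactn0 mul1r subn0.
Qed.

Lemma row_norm_le (x : 'rV[R]_n) r : 0 <= r -> `|x| <= r <->
  forall j, `|x 0 j| <= r.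
Proof.
move=> r0; rewrite [`|x|]/Num.Def.normr/= mx_normrE; split => [xr j|xr].
  by apply: le_trans xr; exact: (le_bigmax _ (fun ij => `|x ij.1 ij.2|) (0, j)).
by apply: bigmax_le => //= -[i j] _ /=; rewrite ord1.
Qed.

Lemma entry_norm_le (x : 'rV[R]_n) j : `|x 0 j| <= `|x|.
Proof. by apply: (row_norm_le x (normr_ge0 x)).1. Qed.

Lemma deg_le a j : (a j <= mdeg a)%N.
Proof. by rewrite /mdeg (bigD1 j)//= leq_addr. Qed.

Lemma prod_expr_deg (q : R) (a : 'I_n -> nat) : \prod_j q ^+ a j = q ^+ mdeg a.
Proof. by rewrite -expr_sum. Qed.

Section Bounds.
Variables (r : R) (r0 : 0 < r) (a b : 'I_n -> nat).
Let q := (mdeg a)%:R / r.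

Let aq j : (a j)%:R <= q * r.
Proof. by rewrite /q divfK ?gt_eqF// ler_nat deg_le. Qed.

Let q0 : 0 <= q.
Proof. by rewrite /q divr_ge0// ltW. Qed.

Lemma dmonomial_le (x : 'rV[R]_n) : `|x| <= r ->
  `|dmonomial b a x| <= q ^+ mdeg b * r ^+ mdeg a.
Proof.
move=> /(row_norm_le _ (ltW r0)) xr.
rewrite -!prod_expr_deg -big_split/= normr_prod.
apply: ler_prod => j _; rewrite normr_ge0/=.
exact: dpow_le.
Qed.

(** Taylor's formula of order one for the derivatives of monomials, with a
    remainder whose dependence on the degree of the monomial is polynomial up
    to the factor r ^+ mdeg a. *)
Lemma dmonomial_remainder (x h : 'rV[R]_n) : `|x| <= r -> `|h + x| <= r ->
  `|dmonomial b a (h + x) - dmonomial b a x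
    - \sum_i h 0 i * dmonomial (mincr b i) a x| <=
  n%:R ^+ 2 * `|h| ^+ 2 * (q ^+ (mdeg b).+2 * r ^+ mdeg a).
Proof.
move=> xr hxr.
have xr' := (row_norm_le _ (ltW r0)).1 xr.
have hxr' := (row_norm_le _ (ltW r0)).1 hxr.
have hE j : (h + x) 0 j = x 0 j + h 0 j by rewrite mxE addrC.
have -> : \sum_i h 0 i * dmonomial (mincr b i) a x =
    \sum_i \prod_j (if j == i then h 0 j * dpow (a j) (b j).+1 (x 0 j)
                    else dpow (a j) (b j) (x 0 j)).
  apply: eq_bigr => i _; rewrite /dmonomial (bigD1 i)//= [RHS](bigD1 i)//= eqxx.
  rewrite /mincr eqxx addn1 mulrA; congr (_ * _); apply: eq_bigr => j ji.
  by rewrite (negPf ji) addn0.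
pose u j := dpow (a j) (b j) ((h + x) 0 j).
pose v j := dpow (a j) (b j) (x 0 j).
pose D j := h 0 j * dpow (a j) (b j).+1 (x 0 j).
pose A j := q ^+ b j * r ^+ a j.
have h0 := normr_ge0 h.
have A0 j : 0 <= A j by rewrite mulr_ge0 ?exprn_ge0// ltW.
have qr m j : 0 <= q ^+ m * r ^+ a j by rewrite mulr_ge0 ?exprn_ge0// ltW.
have := @prod_remainder R _ u v D A (`|h| * q) _ A0 _ _ _ _ (index_enum 'I_n)
  (index_enum_uniq _).
rewrite /index_enum -enumT size_enum_ord.
have -> : n%:R ^+ 2 * (`|h| * q) ^+ 2 * \prod_(i <- enum 'I_n) A i =
    n%:R ^+ 2 * `|h| ^+ 2 * (q ^+ (mdeg b).+2 * r ^+ mdeg a).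
  rewrite big_split/= !big_enum/= !prod_expr_deg !exprS; ring.
rewrite enumT; apply.
- by rewrite mulr_ge0.
- by move=> j; apply: dpow_le.
- by move=> j; apply: dpow_le.
- move=> j; rewrite /u hE; apply: (le_trans (dpow_increment _ r0 (aq j) _ _)) => //.
    by rewrite -hE.
  have -> : A j * (`|h| * q) = `|h| * (q ^+ (b j).+1 * r ^+ a j).
    by rewrite /A exprS; ring.
  by rewrite ler_wpM2r//; exact: entry_norm_le.
- move=> j; rewrite /u hE; apply: (le_trans (dpow_remainder _ r0 (aq j) _ _)) => //.
    by rewrite -hE.
  have -> : A j * (`|h| * q) ^+ 2 = `|h| ^+ 2 * (q ^+ (b j).+2 * r ^+ a j).
    by rewrite /A !exprS; ring.
  rewrite ler_wpM2r//; apply: lerXn2r; rewrite ?nnegrE//.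
  exact: entry_norm_le.
Qed.

End Bounds.
End BoxSums.
Section AnalyticDerivatives.
Context {R : realType} {n : nat}.

Lemma cvg_sumf (I : Type) (s : seq I) (u : I -> nat -> R) (l : I -> R) :
  (forall i, u i @ \oo --> l i) ->
  (fun N => \sum_(i <- s) u i N) @ \oo --> \sum_(i <- s) l i.
Proof.
move=> ul; elim: s => [|i s IH].
  rewrite big_nil (_ : (fun N => _) = fun=> 0); first exact: cvg_cst.
  by apply/funext => N; rewrite big_nil.
rewrite big_cons (_ : (fun N => _) = u i + (fun N => \sum_(i <- s) u i N)).
  exact: cvgD.
by apply/funext => N; rewrite big_cons.
Qed.

Section Series.
Variables (c : ('I_n -> nat) -> R) (r K : R) (r0 : 0 < r).
Hypothesis cK : forall N, box_sum (fun a => `|c a| * (r * 2) ^+ mdeg a) N <= K.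

(** On the polydisc of half the radius, a polynomial factor in the degree is
    absorbed by the geometric gain. *)
Lemma box_sum_weight B : exists2 C, 0 <= C & forall N,
  box_sum (fun a => `|c a| * (((mdeg a)%:R / r) ^+ B * r ^+ mdeg a)) N <= C.
Proof.
have [|C C0 HC] := @pow_le_exp R B 2; first by lra.
have K0 : 0 <= K.
  apply: le_trans (cK 0); apply: sumr_ge0 => a _.
  by rewrite mulr_ge0// exprn_ge0// mulr_ge0// ltW.
exists (C / r ^+ B * K) => [|N]; first by rewrite !mulr_ge0// invr_ge0 exprn_ge0// ltW.
apply: (@le_trans _ _ (C / r ^+ B * box_sum (fun a => `|c a| * (r * 2) ^+ mdeg a) N)).
  rewrite -box_sumZ; apply: box_sum_le => a.
  rewrite [leRHS]mulrCA ler_wpM2l//.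
  rewrite expr_div_n exprMn.
  have -> : C / r ^+ B * (r ^+ mdeg a * 2 ^+ mdeg a) =
    C * 2 ^+ mdeg a / r ^+ B * r ^+ mdeg a by ring.
  apply: ler_wpM2r; first by rewrite exprn_ge0// ltW.
  by apply: ler_wpM2r; first by rewrite invr_ge0 exprn_ge0// ltW.
by rewrite ler_wpM2l// mulr_ge0// invr_ge0 exprn_ge0// ltW.
Qed.

Definition series_sum b (x : 'rV[R]_n) : R :=
  limn (box_sum (fun a => c a * dmonomial b a x)).

Lemma series_sum_cvg b (x : 'rV[R]_n) : `|x| <= r ->
  box_sum (fun a => c a * dmonomial b a x) @ \oo --> series_sum b x.
Proof.
move=> xr; have [C C0 HC] := box_sum_weight (mdeg b).
apply: (@box_sum_abs_cvg _ _ _ C) => N.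
apply: le_trans (HC N); apply: box_sum_le => a.
by rewrite normrM ler_wpM2l// dmonomial_le.
Qed.

(** The remainder estimate for monomials, summed; it passes to the limit of the
    partial sums because it is uniform in them. *)
Lemma series_sum_remainder b : exists2 C, 0 <= C &
  forall x h : 'rV[R]_n, `|x| <= r -> `|h + x| <= r ->
  `|series_sum b (h + x) - series_sum b x
    - \sum_i h 0 i * series_sum (mincr b i) x| <= C * `|h| ^+ 2.
Proof.
have [C C0 HC] := box_sum_weight (mdeg b).+2.
exists (n%:R ^+ 2 * C) => [|x h xr hxr]; first by rewrite mulr_ge0// exprn_ge0.
pose t a := dmonomial b a (h + x) - dmonomial b a x
  - \sum_i h 0 i * dmonomial (mincr b i) a x.
pose s := box_sum (fun a => c a * t a).
have sl : s @ \oo --> series_sum b (h + x) - series_sum b x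
    - \sum_i h 0 i * series_sum (mincr b i) x.
  have -> : s = box_sum (fun a => c a * dmonomial b a (h + x))
    - box_sum (fun a => c a * dmonomial b a x)
    - (fun N => \sum_i h 0 i * box_sum (fun a => c a * dmonomial (mincr b i) a x) N).
    apply/funext => N; rewrite !fctE /s.
    under [in RHS]eq_bigr do rewrite -box_sumZ.
    rewrite -box_sumN -box_sumD /box_sum exchange_big/= -sumrB; apply: eq_bigr => a _.
    rewrite /t !mulrBr; congr (_ - _); rewrite mulr_sumr; apply: eq_bigr => i _.
    by rewrite mulrCA.
  apply: cvgB; first by apply: cvgB; exact: series_sum_cvg.
  by apply: cvg_sumf => i; apply: cvgMl_tmp; exact: series_sum_cvg.
apply: (cvgr_to_le (cvg_norm sl)); apply: nearW => N.
rewrite /s (le_trans (box_sum_norm _ _))//.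
have -> : n%:R ^+ 2 * C * `|h| ^+ 2 = n%:R ^+ 2 * `|h| ^+ 2 * C by ring.
apply: (@le_trans _ _ (n%:R ^+ 2 * `|h| ^+ 2 *
  box_sum (fun a => `|c a| * (((mdeg a)%:R / r) ^+ (mdeg b).+2 * r ^+ mdeg a)) N)).
  rewrite -box_sumZ; apply: box_sum_le => a.
  by rewrite normrM [leRHS]mulrCA ler_wpM2l// dmonomial_remainder.
by rewrite ler_wpM2l// mulr_ge0// ?exprn_ge0// ltW.
Qed.

Lemma series_sum_diff b (x : 'rV[R]_n) : `|x| < r ->
  differentiable (series_sum b) x /\
  forall i, partial i (series_sum b) x = series_sum (mincr b i) x.
Proof.
move=> xr; have [C C0 HC] := series_sum_remainder b.
pose L (h : 'rV[R]_n) : R := \sum_i h 0 i * series_sum (mincr b i) x.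
have Llin : linear L.
  move=> k u v; rewrite /L scaler_sumr -big_split/=; apply: eq_bigr => i _.
  by rewrite !mxE mulrDl -[RHS]/(_ * _ + _) mulrA.
pose Lin : {linear 'rV[R]_n -> R} :=
  HB.pack L (GRing.isLinear.Build _ _ _ _ L Llin).
have Lc : continuous Lin.
  move=> u; apply: differentiable_continuous; apply: differentiable_sumf => i _.
  by apply: differentiableM; [exact: differentiable_coord|exact: differentiable_cst].
have [||df dfE] := @is_diff_littleo R _ _ (series_sum b) Lin x.
- exact: Lc.
- move=> e e0; have C1 : 0 < C + 1 by lra.
  have rx : 0 < r - `|x| by rewrite subr_gt0.
  have eC : 0 < e / (C + 1) by rewrite divr_gt0.
  apply: filterS2 (nbhs0_le (V := 'rV[R]_n) rx)
    (nbhs0_le (V := 'rV[R]_n) eC) => h hr he.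
  have hxr : `|h + x| <= r by rewrite (le_trans (ler_normD _ _))// -lerBrDr.
  apply: (le_trans (HC _ _ (ltW xr) hxr)).
  rewrite expr2 mulrA ler_wpM2r//.
  move: he; rewrite ler_pdivlMr// mulrDr mulr1 mulrC => /(le_trans _); apply.
  by rewrite lerDl.
split=> // i.
rewrite /partial deriveE// dfE /= /L (bigD1 i)//= big1 => [|j ji].
  by rewrite mxE !eqxx mul1r addr0.
by rewrite mxE (negPf ji) andbF mul0r.
Qed.

End Series.

(** D b is the sum of the series of the b-th derivatives of the terms. Keeping the
    coefficients and differentiating the monomials, instead of shifting the
    coefficients, leaves the index boxes unchanged; and since b is a multi-index,
    the order of differentiation does not enter. *)
Lemma analytic_derivatives (f : 'rV[R]_n -> R) p : analytic_at f p ->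
  exists2 e, 0 < e & exists D : ('I_n -> nat) -> 'rV[R]_n -> R,
    (forall x, ball p e x -> f x = D (fun=> 0%N) x) /\
    forall b x, ball p e x -> differentiable (D b) x /\
      forall i, partial i (D b) x = D (mincr b i) x.
Proof.
move=> [c /nbhs_ballP[e0 /= e00 Hc]].
pose r := e0 / 4; have r0 : 0 < r by rewrite divr_gt0.
have r2 : r * 2 = e0 / 2 by rewrite /r; field.
have r20 : 0 <= r * 2 by rewrite r2 divr_ge0// ltW.
have [K HK] : exists K, forall N,
    box_sum (fun a => `|c a| * (r * 2) ^+ mdeg a) N <= K.
  have [|cc _] := Hc (p + const_mx (r * 2)).
    rewrite -ball_normE/= opprD addNKr normrN; apply: (@le_lt_trans _ _ (r * 2)).
      by apply/row_norm_le => // j; rewrite mxE ger0_norm.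
    by rewrite r2 ltr_pdivrMr// ltr_pMr// ltr1n.
  exists (limn (box_sum (fun a => `|c a * monomial_at a (const_mx (r * 2))|))) => N.
  move: cc; rewrite addrAC subrr add0r => cc.
  apply: le_trans (nondecreasing_cvgn_le _ cc N).
    apply: box_sum_le => a; rewrite normrM ler_wpM2l//.
    rewrite /monomial_at normr_prod -prod_expr_deg.
    apply: ler_prod => j _; rewrite exprn_ge0//=.
    by rewrite mxE normrX ger0_norm.
  by apply: box_sum_nondecreasing.
have rball x : ball p r x -> `|x - p| < r.
  by rewrite -ball_normE/= distrC.
exists r => //; exists (fun b x => series_sum c b (x - p)); split=> [x xr|b x xr].
  have xe : ball p e0 x.
    by apply: le_ball xr; rewrite /r ler_pdivrMr// ler_pMr// ler1n.
  have [_ fx] := Hc x xe; apply/esym/cvg_lim => //.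
  apply: cvg_trans fx.
  by rewrite (_ : (fun a => c a * dmonomial _ a (x - p)) =
    fun a => c a * monomial_at a (x - p)) => [//|]; apply/funext => a;
    rewrite dmonomial0.
have [ds dE] := series_sum_diff r0 HK b (rball x xr).
have dshift : differentiable (fun y : 'rV[R]_n => y - p) x.
  exact: (@differentiableB _ _ _ id (cst p)).
split; first exact: (differentiable_comp dshift ds).
move=> i; rewrite -dE /partial (derive_comp _ dshift ds); congr ('D_ _ _ _).
by rewrite deriveB//= derive_id derive_cst subr0.
Qed.

Lemma Ck_derivatives (W : set 'rV[R]_n) (D : ('I_n -> nat) -> 'rV[R]_n -> R) :
  open W -> (forall b x, W x -> differentiable (D b) x /\
      forall i, partial i (D b) x = D (mincr b i) x) ->
  forall k b, Ck k W (D b).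
Proof.
move=> oW HD; elim=> // k IH b; split=> [u Wu|i].
  by have [] := HD b u Wu.
apply: (Ck_eq (f := D (mincr b i)) (g := partial i (D b))) => // u Wu.
by rewrite (HD b u Wu).2.
Qed.

Lemma analytic_Ck (f : 'rV[R]_n -> R) p : analytic_at f p ->
  exists2 e, 0 < e & forall k, Ck k (ball p e) f.
Proof.
move=> /analytic_derivatives[e e0 [D [fD HD]]]; exists e => // k.
apply: (Ck_eq (f := D (fun=> 0%N))); [exact: ball_open|by move=> u /fD|].
by apply: Ck_derivatives => //; exact: ball_open.
Qed.

(** Both sides are the derivative of f for the same multi-index. *)
Lemma analytic_partialC (f : 'rV[R]_n -> R) p i j : analytic_at f p ->
  \forall x \near p, partial i (partial j f) x = partial j (partial i f) x.
Proof.
move=> /analytic_derivatives[e e0 [D [fD HD]]].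
have oB : open (ball p e) by exact: ball_open.
have pf k x : ball p e x -> partial k f x = D (mincr (fun=> 0%N) k) x.
  move=> xe; rewrite -(HD _ _ xe).2; apply: near_eq_derive.
  exact: near_open oB fD xe.
have ppf k l x : ball p e x ->
    partial l (partial k f) x = D (mincr (mincr (fun=> 0%N) k) l) x.
  move=> xe; rewrite -(HD _ _ xe).2; apply: near_eq_derive.
  exact: near_open oB (pf k) xe.
have Dc : mincr (mincr (fun=> 0%N) j) i = mincr (mincr (fun=> 0%N) i) j.
  by apply/funext => l; rewrite /mincr addnAC.
apply/nbhs_ballP; exists e; first exact: e0.
by move=> x xe; rewrite (ppf j i x xe) (ppf i j x xe) Dc.
Qed.

End AnalyticDerivatives.
(** * Local existence for ordinary differential equations *)

Section Picard.
Context {R : realType}.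

Lemma lipschitz_cvg (f : R -> R) C : (forall s t, `|f s - f t| <= C * `|s - t|) ->
  continuous f.
Proof.
move=> fC t; apply/cvgrPdist_le => /= e e0.
have C1 : 0 < `|C| + 1 by rewrite ltr_wpDl.
near=> s.
apply: (le_trans (fC t s)).
have : `|t - s| <= e / (`|C| + 1).
  near: s; apply: cvgr_dist_le; last by rewrite divr_gt0.
  exact: cvg_id.
rewrite ler_pdivlMr// mulrC => /(le_trans _); apply.
by rewrite ler_wpM2r// (le_trans (ler_norm _))// lerDl.
Unshelve. all: by end_near. Qed.

Lemma antiderivative (f : R -> R) : continuous f ->
  exists F : R -> R, F 0 = 0 /\ forall t : R, `|t| < 1 -> is_derive t 1 F (f t).
Proof.
move=> cf; pose mu := @lebesgue_measure R.
pose F x := (\int[mu]_(t in `[-1, x]) f t)%R.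
exists (fun x => F x - F 0); split=> [|t]; first by rewrite subrr.
rewrite ltr_norml => /andP[t1 t2].
have [|dF FE] := @continuous_FTC1_closed R f (-1) t 1 t2 _ t1 (cf t).
  apply: continuous_compact_integrable; first exact: segment_compact.
  by apply: continuous_subspaceT => x; exact: cf.
have {}FE : is_derive t 1 F (f t).
  by apply: DeriveDef; [exact: dF|rewrite -FE derive1E].
rewrite -[f t]subr0.
exact: (@is_deriveB _ _ _ F (cst (F 0))).
Qed.

Lemma mean_value_le (f df : R -> R) (d r C : R) : d < r ->
  (forall t : R, `|t| < r -> is_derive t 1 f (df t)) ->
  (forall t, `|t| <= d -> `|df t| <= C) ->
  forall s t : R, `|s| <= d -> `|t| <= d -> `|f s - f t| <= C * `|s - t|.
Proof.
move=> dr fdf dfC.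
suff H s t : `|s| <= d -> `|t| <= d -> s <= t -> `|f s - f t| <= C * `|s - t|.
  move=> s t sd td; have [st|/ltW ts] := leP s t; first exact: H.
  by rewrite [`|f s - f t|]distrC [`|s - t|]distrC; exact: H.
rewrite [`|s| <= _]ler_norml [`|t| <= _]ler_norml => /andP[s1 s2] /andP[t1 t2] st.
have Hd x : x \in `[s, t] -> `|x| <= d.
  by rewrite in_itv/= ler_norml => /andP[? ?]; apply/andP; split; lra.
have cf : {within `[s, t], continuous f}.
  apply: derivable_within_continuous => x xI.
  have /fdf[] // : `|x| < r by rewrite (le_lt_trans (Hd x xI)).
have fd' x : x \in `]s, t[ -> is_derive x 1 f (df x).
  move=> xI; apply: fdf; rewrite (le_lt_trans (Hd x _))//.
  by move: xI; rewrite !in_itv/= => /andP[/ltW -> /ltW ->].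
have [x xI fE] := MVT_segment st fd' cf.
rewrite [`|f s - f t|]distrC fE normrM [`|s - t|]distrC ler_wpM2r//.
exact/dfC/Hd.
Qed.

(** With r k = 2 C / 2 ^ k, the sequence u - r increases, u + r decreases, and the
    supremum of the former lies between them. *)
Lemma geometric_limit (u : nat -> R) (C : R) :
  (forall k, `|u k.+1 - u k| <= C / 2 ^+ k) ->
  exists l, forall k, `|u k - l| <= 2 * C / 2 ^+ k.
Proof.
move=> uC.
have C0 : 0 <= C by have := uC 0%N; rewrite expr0 divr1; apply: le_trans.
pose r k := 2 * C / 2 ^+ k.
have rS k : r k = 2 * r k.+1 by rewrite /r exprS; field; rewrite expf_neq0.
have r0 k : 0 <= r k by rewrite /r divr_ge0// ?mulr_ge0// exprn_ge0.
have step k : `|u k.+1 - u k| <= r k.+1.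
  rewrite (le_trans (uC k))// /r exprS le_eqVlt; apply/orP; left; apply/eqP.
  by field; rewrite expf_neq0.
have lo k j : u k - r k <= u (k + j)%N - r (k + j)%N.
  elim: j => [|j IH]; first by rewrite addn0.
  rewrite (le_trans IH)// addnS.
  by have := step (k + j)%N; rewrite (rS (k + j)%N) ler_norml => /andP[]; lra.
have hi k j : u (k + j)%N + r (k + j)%N <= u k + r k.
  elim: j => [|j IH]; first by rewrite addn0.
  rewrite (le_trans _ IH)// addnS.
  by have := step (k + j)%N; rewrite (rS (k + j)%N) ler_norml => /andP[]; lra.
have lohi k j : u k - r k <= u j + r j.
  have h1 := lo k j; have h2 := hi j k; move: h1 h2; rewrite (addnC j k) => h1 h2.
  by have := r0 (k + j)%N; lra.
pose A := range (fun k => u k - r k).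
have A0 : A !=set0 by exists (u 0%N - r 0%N), 0%N.
exists (sup A) => k; rewrite -/(r k) ler_norml.
have h1 : sup A <= u k + r k by apply: ge_sup => // _ [j _ <-].
have h2 : u k - r k <= sup A.
  apply: ub_le_sup; last by exists k.
  by exists (u 0%N + r 0%N) => _ [j _ <-].
by apply/andP; split; lra.
Qed.

Context {m : nat}.

Lemma row_dist_le (x : 'rV[R]_m) (C : R) : 0 <= C -> (forall i, `|x 0 i| <= C) -> `|x| <= C.
Proof. by move=> C0 xC; apply/row_norm_le. Qed.

Definition clamp (a b t : R) : R := Num.max a (Num.min t b).

Lemma clampP a b t : a <= b -> a <= clamp a b t <= b.
Proof.
by move=> ab; rewrite /clamp le_max lexx/= ge_max ab/= ge_min lexx orbT.
Qed.

Lemma clamp_id a b t : a <= t <= b -> clamp a b t = t.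
Proof. by move=> /andP[at_ tb]; rewrite /clamp min_l// max_r. Qed.

Lemma clamp_lip a b s t : a <= b -> `|clamp a b s - clamp a b t| <= `|s - t|.
Proof.
move=> ab; have C (x : R) : [\/ x <= a /\ clamp a b x = a, a <= x <= b /\ clamp a b x = x
    | b <= x /\ clamp a b x = b].
  have [ax|xa] := leP a x; last first.
    by apply: Or31; rewrite /clamp ltW// min_l ?max_l// ltW// (lt_le_trans xa).
  have [xb|bx] := leP x b; first by apply: Or32; rewrite clamp_id// ax.
  by apply: Or33; rewrite /clamp min_r ?max_r// ltW.
have S : - `|s - t| <= s - t <= `|s - t| by rewrite -ler_norml.
have N := normr_ge0 (s - t).
rewrite ler_norml.
by have [[? ->]|[/andP[? ?] ->]|[? ->]] := C s;
  have [[? ->]|[/andP[? ?] ->]|[? ->]] := C t;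
  move/andP: S => [? ?]; apply/andP; split; lra.
Qed.

Section Iteration.
Variables (w : 'rV[R]_m -> 'rV[R]_m) (x0 : 'rV[R]_m) (L M d : R).
Hypotheses (L0 : 0 <= L) (M0 : 0 <= M) (d0 : 0 < d) (d1 : d < 1)
  (dL : d * L <= 1 / 2).
Hypotheses (wL : forall x y, `|w x - w y| <= L * `|x - y|)
  (wM : forall x, `|w x| <= M).

Let good (y : R -> 'rV[R]_m) := forall s t, `|s| <= d -> `|t| <= d ->
  `|y s - y t| <= M * `|s - t|.

Let cl (t : R) := clamp (- d) d t.

Let cld t : `|cl t| <= d.
Proof.
rewrite ler_norml; apply: clampP.
by rewrite (le_trans _ (ltW d0))// oppr_le0 ltW.
Qed.

Let clid t : `|t| <= d -> cl t = t.
Proof. by rewrite ler_norml; exact: clamp_id. Qed.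

Let step (y z : R -> 'rV[R]_m) := z 0 = x0 /\ forall i (t : R), `|t| < 1 ->
  is_derive t 1 (fun s => z s 0 i) (w (y (cl t)) 0 i).

Let step_ex y : exists z, good y -> step y z.
Proof.
have [gy|?] := pselect (good y); last by exists y.
have cf i : continuous (fun s => w (y (cl s)) 0 i).
  apply: (@lipschitz_cvg _ (L * M)) => s t.
  have -> : w (y (cl s)) 0 i - w (y (cl t)) 0 i = (w (y (cl s)) - w (y (cl t))) 0 i.
    by rewrite !mxE.
  apply: (le_trans (entry_norm_le _ i)); apply: (le_trans (wL _ _)).
  rewrite -mulrA ler_wpM2l// (le_trans (gy _ _ _ _))// ler_wpM2l//.
  by apply: clamp_lip; rewrite (le_trans _ (ltW d0))// oppr_le0 ltW.
have [F HF] := choice (fun i => antiderivative (cf i)).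
exists (fun t => x0 + \row_i F i t) => _; split.
  by apply/rowP => i; rewrite !mxE (HF i).1 addr0.
move=> i t t1; have := (HF i).2 t t1 => FE.
rewrite (_ : (fun s => _) = cst (x0 0 i) + F i); last first.
  by apply/funext => s; rewrite fctE !mxE.
by rewrite -[w _ _ _]add0r; exact: is_deriveD.
Qed.

Let step_good y z : step y z -> good z.
Proof.
move=> [_ zy] s t sd td; apply: row_dist_le; first by rewrite mulr_ge0.
move=> i; rewrite !mxE.
apply: (mean_value_le (f := fun t => z t 0 i)
  (df := fun t => w (y (cl t)) 0 i) d1 _ _ sd td).
by move=> r rd; apply: le_trans (wM (y (cl r))); exact: entry_norm_le.
Qed.

(** Successive approximations contract the distance by a factor of two. *)
Let step_contract y y' z z' C : 0 <= C -> step y z -> step y' z' ->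
  (forall t, `|t| <= d -> `|y t - y' t| <= C) ->
  forall t, `|t| <= d -> `|z t - z' t| <= C / 2.
Proof.
move=> C0 [z0 zy] [z0' zy'] yC t td.
apply: row_dist_le; first by rewrite divr_ge0.
move=> i; rewrite !mxE.
pose df s := w (y (cl s)) 0 i - w (y' (cl s)) 0 i.
have Dd (s : R) : `|s| < 1 -> is_derive s 1 ((fun s => z s 0 i) - (fun s => z' s 0 i)) (df s).
  by move=> s1; apply: is_deriveB; [exact: zy|exact: zy'].
have dfC s : `|s| <= d -> `|df s| <= L * C.
  move=> sd; have -> : df s = (w (y (cl s)) - w (y' (cl s))) 0 i by rewrite !mxE.
  apply: (le_trans (entry_norm_le _ i)); apply: (le_trans (wL _ _)).
  by rewrite ler_wpM2l// yC// clid.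
have d00 : `|0 : R| <= d by rewrite normr0 ltW.
have := mean_value_le d1 Dd dfC td d00.
rewrite !fctE z0 z0' subrr !subr0 => /le_trans; apply.
apply: (@le_trans _ _ (L * C * d)); first by rewrite ler_wpM2l// mulr_ge0.
have -> : L * C * d = (d * L) * C by ring.
by rewrite mulrC ler_wpM2l// -[2^-1]mul1r.
Qed.

Lemma picard_global : exists z : R -> 'rV[R]_m,
  [/\ z 0 = x0, forall t, `|t| <= d -> `|z t - x0| <= M * d
    & forall i (t : R), `|t| < d -> is_derive t 1 (fun s => z s 0 i) (w (z t) 0 i)].
Proof.
have [T HT] := choice step_ex.
pose u k := iter k T (fun=> x0).
have gu k : good (u k).
  elim: k => [s t _ _|k IH]; first by rewrite subrr normr0 mulr_ge0.
  exact: step_good (HT _ IH).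
have Hu k : step (u k) (u k.+1) by exact: HT.
have uM k t : `|t| <= d -> `|u k.+1 t - u k t| <= M / 2 ^+ k.
  elim: k t => [|k IH] t td.
    have d00 : `|0 : R| <= d by rewrite normr0 ltW.
    have := gu 1%N t 0 td d00; rewrite (Hu 0%N).1 subr0 expr0 divr1 => /le_trans; apply.
    by rewrite ler_piMr// (le_trans td)// ltW.
  rewrite exprSr invfM mulrA.
  by apply: (step_contract _ (Hu k.+1) (Hu k)) => //; rewrite divr_ge0// exprn_ge0.
have ex t : exists yt, `|t| <= d -> forall k, `|u k t - yt| <= 2 * M / 2 ^+ k.
  have [td|/negP td] := boolP (`|t| <= d); last by exists 0.
  have Hi i : exists l, forall k, `|u k t 0 i - l| <= 2 * M / 2 ^+ k.
    apply: geometric_limit => k.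
    have -> : u k.+1 t 0 i - u k t 0 i = (u k.+1 t - u k t) 0 i by rewrite !mxE.
    by apply: (le_trans (entry_norm_le _ i)); exact: uM.
  have [l Hl] := choice Hi.
  exists (\row_i l i) => _ k; apply: row_dist_le.
    by rewrite divr_ge0 ?mulr_ge0// exprn_ge0.
  by move=> i; rewrite !mxE.
have [y Hy] := choice ex.
have small (a b C : R) : 0 <= C -> (forall k, a <= b + C / 2 ^+ k) -> a <= b.
  move=> C0 ab; apply/ler_addgt0Pl => e e0.
  have [k Ck] : exists k : nat, C / e <= 2 ^+ k.
    have /archi_boundP Ce : 0 <= C / e by rewrite divr_ge0// ltW.
    exists (Num.bound (C / e)); rewrite (le_trans (ltW Ce))//.
    by rewrite -natrX ler_nat ltnW// ltn_expl.
  apply: (le_trans (ab k)); rewrite addrC lerD2r.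
  by rewrite ler_pdivrMr ?exprn_gt0// mulrC -ler_pdivrMr.
have gy : good y.
  move=> s t sd td; apply: (@small _ _ (4 * M)) => [|k]; first by rewrite mulr_ge0.
  have h1 := Hy s sd k; have h2 := Hy t td k; have h3 := gu k s t sd td.
  have -> : y s - y t = (u k s - u k t) - (u k s - y s) + (u k t - y t).
    by rewrite !opprB addrACA; apply/rowP => i; rewrite !mxE; ring.
  rewrite (le_trans (ler_normD _ _))//.
  apply: (@le_trans _ _ (M * `|s - t| + 2 * M / 2 ^+ k + 2 * M / 2 ^+ k)).
    by rewrite lerD// (le_trans (ler_normB _ _))// lerD.
  by rewrite le_eqVlt; apply/orP; left; apply/eqP; field; rewrite expf_neq0.
have Hz := HT y gy; set z := T y in Hz.
have zy t : `|t| <= d -> z t = y t.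
  move=> td; apply/eqP; rewrite -subr_eq0 -normr_le0.
  apply: (@small _ _ (4 * M)) => [|k]; first by rewrite mulr_ge0.
  have h1 : `|u k.+1 t - z t| <= (2 * M / 2 ^+ k) / 2.
    apply: (step_contract _ (Hu k) Hz) => //; last by move=> s sd; exact: Hy.
    by rewrite divr_ge0 ?mulr_ge0// exprn_ge0.
  have h2 := Hy t td k.+1; rewrite add0r.
  have -> : z t - y t = (u k.+1 t - y t) - (u k.+1 t - z t).
    by apply/rowP => i; rewrite !mxE; ring.
  rewrite (le_trans (ler_normB _ _))// (le_trans (lerD h2 h1))//.
  have -> : 2 * M / 2 ^+ k.+1 + 2 * M / 2 ^+ k / 2 = 2 * M / 2 ^+ k.
    by rewrite exprS; field; rewrite expf_neq0.
  by rewrite ler_wpM2r// ?invr_ge0 ?exprn_ge0// ler_wpM2r//; lra.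
exists z; split=> [|t td|i t td]; first exact: Hz.1.
  have d00 : `|0 : R| <= d by rewrite normr0 ltW.
  have := step_good Hz td d00; rewrite Hz.1 subr0 => /le_trans; apply.
  by rewrite ler_wpM2l.
have td' := ltW td.
by have := Hz.2 i t (lt_trans td d1); rewrite clid// -zy.
Qed.

End Iteration.

(** The Picard-Lindeloef theorem, for an autonomous field. *)
Theorem picard (v : 'rV[R]_m -> 'rV[R]_m) (x0 : 'rV[R]_m) (e L M : R) :
  0 < e -> 0 <= L -> 0 <= M ->
  (forall x y, `|x - x0| <= e -> `|y - x0| <= e -> `|v x - v y| <= L * `|x - y|) ->
  (forall x, `|x - x0| <= e -> `|v x| <= M) ->
  exists2 d, 0 < d & exists z : R -> 'rV[R]_m,
  [/\ z 0 = x0, forall t, `|t| < d -> `|z t - x0| <= e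
    & forall i (t : R), `|t| < d -> is_derive t 1 (fun s => z s 0 i) (v (z t) 0 i)].
Proof.
move=> e0 L0 M0 vL vM.
(* Retracting onto the ball makes the field globally Lipschitz and bounded. *)
pose c (x : 'rV[R]_m) : 'rV[R]_m := \row_i clamp (x0 0 i - e) (x0 0 i + e) (x 0 i).
have ce (x : 'rV[R]_m) : `|c x - x0| <= e.
  apply: row_dist_le; first exact: ltW.
  move=> i; rewrite !mxE ler_norml.
  have : x0 0 i - e <= x0 0 i + e by lra.
  by move=> /(clampP (x 0 i)) /andP[? ?]; apply/andP; split; lra.
have cid (x : 'rV[R]_m) : `|x - x0| <= e -> c x = x.
  move=> /(row_norm_le _ (ltW e0)) xe; apply/rowP => i; rewrite mxE clamp_id//.
  by have := xe i; rewrite !mxE ler_norml => /andP[? ?]; apply/andP; split; lra.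
have cL (x y : 'rV[R]_m) : `|c x - c y| <= `|x - y|.
  apply: row_dist_le => // i; rewrite !mxE.
  apply: (@le_trans _ _ `|(x - y) 0 i|); last exact: entry_norm_le.
  by rewrite !mxE; apply: clamp_lip; lra.
pose d := Num.min (1 / 2) (Num.min (1 / (2 * (L + 1))) (e / (M + 1))).
have L1 : 0 < L + 1 by lra.
have M1 : 0 < M + 1 by lra.
have d0 : 0 < d.
  rewrite /d !lt_min; apply/andP; split; first lra.
  by rewrite !divr_gt0// mulr_gt0.
have d1 : d < 1 by rewrite /d gt_min; apply/orP; left; lra.
have dL : d * L <= 1 / 2.
  apply: (@le_trans _ _ (1 / (2 * (L + 1)) * L)).
    by rewrite ler_wpM2r// /d ge_min ge_min lexx orbT.
  have -> : 1 / (2 * (L + 1)) * L = (L / (L + 1)) / 2 by field; rewrite gt_eqF.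
  by rewrite ler_wpM2r// ler_pdivrMr// mul1r; lra.
have dM : M * d <= e.
  apply: (@le_trans _ _ (M * (e / (M + 1)))).
    by rewrite ler_wpM2l// /d !ge_min lexx !orbT.
  have -> : M * (e / (M + 1)) = e * (M / (M + 1)) by ring.
  by rewrite ler_piMr ?ltW// ltr_pdivrMr// mul1r; lra.
have [z [z0 ze zd]] := @picard_global (v \o c) x0 L M d L0 M0 d0 d1 dL
  (fun x y => le_trans (vL _ _ (ce x) (ce y)) (ler_wpM2l L0 (cL x y)))
  (fun x => vM _ (ce x)).
have {}ze (t : R) : `|t| < d -> `|z t - x0| <= e.
  by move=> td; rewrite (le_trans (ze t (ltW td))).
exists d => //; exists z; split=> // i t td.
by have := zd i t td; rewrite /= cid//; exact: ze.
Qed.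

End Picard.
(** * Consequences for smooth vector fields and functions of one variable *)

Section LocalBounds.
Context {R : realType} {m : nat}.
Implicit Types (x y v : 'rV[R]_m).

Lemma near_bounded (f : 'rV[R]_m -> R) x : {for x, continuous f} ->
  \forall y \near x, `|f y| <= `|f x| + 1.
Proof.
move=> /cvgr_dist_le /(_ 1 ltr01); apply: filterS => y fy.
have -> : f y = f x - (f x - f y) by ring.
by apply: (le_trans (ler_normB _ _)); rewrite lerD2l.
Qed.

Lemma near_closed_ball (P : set 'rV[R]_m) x : (\forall y \near x, P y) ->
  exists2 e, 0 < e & forall y, `|y - x| <= e -> P y.
Proof.
move=> /nbhs_ballP[e /= e0 eP]; exists (e / 2); first by rewrite divr_gt0.
move=> y ye; apply: eP; rewrite -ball_normE/= distrC (le_lt_trans ye)//.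
by rewrite ltr_pdivrMr// ltr_pMr// ltr1n.
Qed.

Lemma near_forall (I : finType) (P : I -> set 'rV[R]_m) x :
  (forall i, \forall y \near x, P i y) -> \forall y \near x, forall i, P i y.
Proof. exact: (@filter_forall _ I P (nbhs x) _). Qed.

Lemma segment_derive (f : 'rV[R]_m -> R) y v (t : R) :
  differentiable f (y + t *: v) ->
  is_derive t 1 (fun s : R => f (y + s *: v)) ('D_v f (y + t *: v)).
Proof.
move=> df; pose l (s : R) := y + s *: v.
have dl : is_derive t 1 l v.
  have dd : is_derive t 1 (fun s : R => s *: v) v.
    have dd : differentiable (fun s : R => s *: v) t by apply: differentiableZl.
    apply: DeriveDef; first exact: diff_derivable.
    by rewrite deriveE// diff_val/= scale1r.
  have lE : l = cst y + (fun s : R => s *: v) by apply/funext.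
  by rewrite lE -[X in is_derive _ _ _ X]add0r; apply: is_deriveD.
have dlt : differentiable l t.
  by apply/derivable1_diffP; case: dl.
apply: DeriveDef.
  apply/derivable1_diffP.
  exact: (differentiable_comp dlt).
have -> : (fun s : R => f (y + s *: v)) = f \o l by [].
by rewrite (derive_comp _ dlt df); case: dl => _ ->.
Qed.

Lemma C2_lipschitz (W : set 'rV[R]_m) (f : 'rV[R]_m -> R) x0 : open W -> W x0 ->
  Ck 2 W f -> exists L M, [/\ 0 <= L, 0 <= M &
    \forall e \near 0^'+, forall x, `|x - x0| <= e -> `|f x| <= M /\
      forall y, `|y - x0| <= e -> `|f x - f y| <= L * `|x - y|].
Proof.
move=> oW Wx Cf.
pose C i := `|partial i f x0| + 1.
exists (\sum_i C i), (`|f x0| + 1); split.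
- by apply: sumr_ge0 => i _; rewrite addr_ge0.
- by rewrite addr_ge0.
have cf : {for x0, continuous f}.
  by apply: differentiable_continuous; exact: Ck_diff Cf Wx.
have near_all : \forall y \near x0, [/\ W y, `|f y| <= `|f x0| + 1
    & forall i, `|partial i f y| <= C i].
  have h3 := near_forall (fun i => near_bounded (differentiable_continuous
    (Ck_diff (Ck_partial i Cf) Wx))).
  have h1 : nbhs x0 W by exact: open_nbhs_nbhs.
  by apply: filterS3 h1 (near_bounded cf) h3.
have [e0 e00 H] := near_closed_ball near_all.
have : \forall e \near 0^'+, e <= e0 by exact: nbhs_right_le.
apply: filterS => e ee0 x xe.
have xe0 := le_trans xe ee0.
split=> [|y ye]; first by have [] := H x xe0.
have seg (t : R) : 0 <= t -> t <= 1 -> `|y + t *: (x - y) - x0| <= e0.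
  move=> t0 t1.
  have -> : y + t *: (x - y) - x0 = t *: (x - x0) + (1 - t) *: (y - x0).
    by apply/rowP => i; rewrite !mxE; ring.
  apply: (le_trans (ler_normD _ _)); rewrite !normrZ.
  rewrite ger0_norm// ger0_norm ?subr_ge0//.
  have -> : e0 = t * e0 + (1 - t) * e0 by ring.
  by apply: lerD; apply: ler_wpM2l; rewrite ?subr_ge0// (le_trans _ ee0).
have dseg (t : R) : 0 <= t <= 1 -> is_derive t 1 (fun s : R => f (y + s *: (x - y)))
    ('D_(x - y) f (y + t *: (x - y))).
  move=> /andP[t0 t1]; apply: segment_derive; apply: Ck_diff Cf _.
  by have [] := H _ (seg t t0 t1).
have cseg : {within `[0, 1], continuous (fun s : R => f (y + s *: (x - y)))}.
  apply: derivable_within_continuous => t; rewrite in_itv/= => tI.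
  by have [] := dseg t tI.
have dseg' (t : R) : t \in `]0, 1[ -> is_derive t 1 (fun s : R => f (y + s *: (x - y)))
    ('D_(x - y) f (y + t *: (x - y))).
  rewrite in_itv/= => /andP[t0 t1]; apply: dseg; apply/andP; split; exact: ltW.
have [t] := MVT_segment (@ler01 R) dseg' cseg.
rewrite in_itv/= scale1r scale0r addr0 subr0 mulr1 subrKC => /andP[t0 t1] ->.
have [Wt _ pt] := H _ (seg t t0 t1).
rewrite derive_dirE; last exact: Ck_diff Cf Wt.
apply: (le_trans (ler_norm_sum _ _ _)); rewrite mulr_suml; apply: ler_sum => i _.
rewrite normrZ mulrC; apply: ler_pM => //; first exact: pt.
exact: entry_norm_le.
Qed.

(** The partial derivatives of a C^2 field are continuous, hence bounded near x0,
    which makes the field Lipschitz there. *)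
Theorem C2_flow (W : set 'rV[R]_m) (v : 'rV[R]_m -> 'rV[R]_m) x0 : open W ->
  W x0 -> Ckmx 2 W v -> exists2 d, 0 < d & exists z : R -> 'rV[R]_m, z 0 = x0 /\
    forall t, `|t| < d -> [/\ W (z t), differentiable z t & 'D_1 z t = v (z t)].
Proof.
move=> oW Wx Cv.
have [L HL] := choice (fun i => C2_lipschitz oW Wx (Cv 0 i)).
have [M HM] := choice HL.
have [e e0 [We He]] : exists2 e, 0 < e & (forall x, `|x - x0| <= e -> W x) /\
   forall i x, `|x - x0| <= e -> `|v x 0 i| <= M i /\
      forall y, `|y - x0| <= e -> `|v x 0 i - v y 0 i| <= L i * `|x - y|.
  have [e1 e10 We1] : exists2 e, 0 < e & forall y, `|y - x0| <= e -> W y.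
    by apply: near_closed_ball; exact: open_nbhs_nbhs.
  pose P (e : R) := forall i x, `|x - x0| <= e -> `|v x 0 i| <= M i /\
      forall y, `|y - x0| <= e -> `|v x 0 i - v y 0 i| <= L i * `|x - y|.
  have h1 : \forall e \near (0 : R)^'+, P e.
    apply: (@filter_forall R 'I_m (fun i e => forall x, `|x - x0| <= e ->
      `|v x 0 i| <= M i /\ forall y, `|y - x0| <= e ->
      `|v x 0 i - v y 0 i| <= L i * `|x - y|) (0^'+) _) => i.
    by have [_ _] := HM i.
  have h2 : \forall e \near (0 : R)^'+, e <= e1 by exact: nbhs_right_le.
  have h3 : \forall e \near (0 : R)^'+, 0 < e by exact: nbhs_right_gt.
  have h23 : \forall e \near (0 : R)^'+, e <= e1 /\ 0 < e by apply: filterI.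
  have h123 : \forall e \near (0 : R)^'+, P e /\ (e <= e1 /\ 0 < e) by apply: filterI.
  have [e [Pe [ee1 e0]]] : exists e, P e /\ (e <= e1 /\ 0 < e).
    exact: (@filter_ex _ (0^'+) _ _ h123).
  exists e; first exact: e0.
  by split=> // x xe; apply: We1; exact: le_trans xe ee1.
pose L' := \sum_i L i; pose M' := \sum_i M i.
have L0 i : 0 <= L i by have [] := HM i.
have M0 i : 0 <= M i by have [] := HM i.
have LL i : L i <= L' by rewrite /L' (bigD1 i)//= lerDl sumr_ge0.
have MM i : M i <= M' by rewrite /M' (bigD1 i)//= lerDl sumr_ge0.
have L'0 : 0 <= L' by apply: sumr_ge0.
have M'0 : 0 <= M' by apply: sumr_ge0.
have [||d d0 [z [z0 ze zd]]] := @picard R m v x0 e L' M' e0 L'0 M'0.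
- move=> x y xe ye; apply: row_dist_le; first by rewrite mulr_ge0.
  move=> i; rewrite !mxE; have [_ /(_ y ye)] := He i x xe.
  by move=> /le_trans; apply; rewrite ler_wpM2r.
- move=> x xe; apply: row_dist_le => // i.
  by have [vM _] := He i x xe; rewrite (le_trans vM).
exists d => //; exists z; split=> // t td.
have dz : differentiable z t.
  apply/differentiable_mxP => i j; rewrite (ord1 i).
  by apply/derivable1_diffP; have [] := zd j t td.
split => //; first exact/We/ze.
apply/rowP => j; rewrite derive_entry//.
by have [_ ->] := zd j t td.
Qed.

End LocalBounds.

Section OneVariable.
Context {R : realType}.

(** A linear differential inequality has no solution leaving zero: on a short
    interval the maximum of f is at most half of itself. *)
Lemma gronwall (f df : R -> R) (r C : R) : 0 < r ->
  (forall t : R, `|t| < r -> is_derive t 1 f (df t)) ->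
  (forall t, `|t| < r -> `|df t| <= C * `|f t|) -> f 0 = 0 ->
  exists2 d, 0 < d & forall t, `|t| <= d -> f t = 0.
Proof.
move=> r0 fdf dfC f0.
pose C' := `|C| + 1; have C'0 : 0 < C' by rewrite ltr_wpDl.
pose d := Num.min (r / 2) (1 / (2 * C')).
have d0 : 0 < d by rewrite /d lt_min !divr_gt0// mulr_gt0.
have dr : d < r by rewrite /d gt_min ltr_pdivrMr// ltr_pMr// ltr1n.
have dC : C' * d <= 1 / 2.
  apply: (@le_trans _ _ (C' * (1 / (2 * C')))).
    by apply: ler_wpM2l; [exact: ltW|rewrite /d ge_min lexx orbT].
  by rewrite le_eqVlt; apply/orP; left; apply/eqP; field; rewrite gt_eqF.
exists d => //.
have cf : {within `[- d, d], continuous (f * f)}.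
  apply: derivable_within_continuous => t; rewrite in_itv/= -ler_norml => td.
  have [ft _] := fdf t (le_lt_trans td dr).
  exact: derivableM.
have dd : - d <= d by rewrite (le_trans _ (ltW d0))// oppr_le0 ltW.
have [c cI {}cM] := EVT_max dd cf.
have {}cM t : `|t| <= d -> `|f t| <= `|f c|.
  move=> td; have : f t * f t <= f c * f c.
    by apply: cM; rewrite in_itv/= -ler_norml.
  by rewrite -!expr2 -[f t ^+ 2]real_normK ?num_real// -[f c ^+ 2]real_normK ?num_real//
    ler_sqr ?nnegrE.
have cd : `|c| <= d by move: cI; rewrite in_itv/= ler_norml.
have fc : `|f c| <= `|f c| / 2.
  have dfb t : `|t| <= d -> `|df t| <= C' * `|f c|.
    move=> td; apply: (le_trans (dfC t (le_lt_trans td dr))).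
    apply: (@le_trans _ _ (C' * `|f t|)).
      by rewrite ler_wpM2r// /C' (le_trans (ler_norm _))// lerDl.
    by apply: ler_wpM2l; [exact: ltW|exact: cM].
  have d00 : `|0 : R| <= d by rewrite normr0 ltW.
  have := mean_value_le dr fdf dfb cd d00.
  rewrite f0 !subr0 => /le_trans; apply.
  apply: (@le_trans _ _ (C' * `|f c| * d)).
    by rewrite ler_wpM2l// mulr_ge0// ltW.
  have -> : C' * `|f c| * d = `|f c| * (C' * d) by ring.
  by rewrite ler_wpM2l// -[2^-1]mul1r.
move=> t td; apply/eqP; rewrite -normr_le0.
rewrite (le_trans (cM t td))//; lra.
Qed.

Lemma derive_expansion (f : R -> R) (k e : R) : is_derive (0 : R) 1 f k -> 0 < e ->
  \forall t \near 0, `|f t - f 0 - t * k| <= e * `|t|.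
Proof.
move=> fk e0.
have df : differentiable f 0 by apply/derivable1_diffP; case: fk.
have := diff_locally df; move=> /eqaddoP /(_ e e0); apply: filterS => t /=.
rewrite !fctE addr0 /=.
have -> : 'd f 0 t = t * k.
  rewrite -[t in LHS]mulr1 -[t * 1]/(t *: (1 : R)) linearZ/= -deriveE//.
  by case: fk => _ ->.
by rewrite opprD addrA.
Qed.

Lemma near0_right (P : set R) : (\forall t \near (0 : R), P t) ->
  exists2 d, 0 < d & forall t, 0 <= t <= d -> P t.
Proof.
move=> /nbhs_ballP[e /= e0 eP]; exists (e / 2); first by rewrite divr_gt0.
move=> t /andP[t0 te]; apply: eP; rewrite /ball/= sub0r normrN ger0_norm//.
by rewrite (le_lt_trans te)// ltr_pdivrMr// ltr_pMr// ltr1n.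
Qed.

Lemma le0_linear (x D d : R) : 0 < d -> (forall t, 0 < t -> t <= d -> x <= D * t) ->
  x <= 0.
Proof.
move=> d0 xD; apply/ler_addgt0Pr => e e0; rewrite add0r.
have D0 : 0 < `|D| + 1 by rewrite ltr_wpDl.
pose t := Num.min d (e / (`|D| + 1)).
have t0 : 0 < t by rewrite /t lt_min d0 divr_gt0.
have td : t <= d by rewrite /t ge_min lexx.
have te : t <= e / (`|D| + 1) by rewrite /t ge_min lexx orbT.
apply: (le_trans (xD t t0 td)); move: te; rewrite ler_pdivlMr// mulrC => /(le_trans _); apply.
by rewrite ler_wpM2r ?(ltW t0)// (le_trans (ler_norm D))// lerDl.
Qed.

(** The upper bound forces a and its derivative to vanish at 0, so that a t is
    O(t ^ 2); if k were not 0, b t would be comparable to t and the lower bound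
    would make a t at least of order t ^ (3 / 2). *)
Lemma no_order_three_halves (a da b : R -> R) (dda k c C : R) : 0 < c ->
  (\forall t \near (0 : R), is_derive (t : R) 1 a (da t)) ->
  is_derive (0 : R) 1 da dda -> is_derive (0 : R) 1 b k -> b 0 = 0 ->
  (\forall t \near (0 : R), b t != 0 ->
    c * `|b t| ^+ 3 <= a t ^+ 2 <= C * `|b t| ^+ 3) -> k = 0.
Proof.
move=> c0 ada dadda bk b0 ab; apply: contrapT => /eqP k0.
have k0' : 0 < `|k| by rewrite normr_gt0.
have k2 : 0 < `|k| / 2 by rewrite divr_gt0.
pose c1 := c * (`|k| / 2) ^+ 3; pose C1 := `|C| * (2 * `|k|) ^+ 3.
have c10 : 0 < c1 by rewrite mulr_gt0// exprn_gt0.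
have C10 : 0 <= C1 by rewrite mulr_ge0// exprn_ge0// mulr_ge0.
have [d d0 Hd] := near0_right (filterI (derive_expansion bk k2) ab).
have aB t : 0 < t -> t <= d -> c1 * t ^+ 3 <= a t ^+ 2 <= C1 * t ^+ 3.
  move=> t0 td; have [] := Hd t _; first by rewrite (ltW t0).
  rewrite b0 subr0 (gtr0_norm t0) => h1.
  have lo : `|k| / 2 * t <= `|b t|.
    have := ler_normD (b t - t * k) (- b t).
    rewrite addrAC subrr add0r !normrN normrM (gtr0_norm t0); lra.
  have hi : `|b t| <= 2 * `|k| * t.
    have := ler_normD (b t - t * k) (t * k).
    rewrite subrK normrM (gtr0_norm t0) => h2.
    have : 0 <= `|k| * t by rewrite mulr_ge0// ltW.
    lra.
  have bt0 : b t != 0 by rewrite -normr_gt0 (lt_le_trans _ lo)// mulr_gt0.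
  move=> /(_ bt0) /andP[h2 h3]; apply/andP; split.
    apply: le_trans h2; rewrite /c1 -mulrA -exprMn ler_wpM2l ?(ltW c0)//.
    by apply: lerXn2r => //; rewrite nnegrE// mulr_ge0// ltW.
  apply: (le_trans h3); apply: (@le_trans _ _ (`|C| * `|b t| ^+ 3)).
    by rewrite ler_wpM2r ?exprn_ge0// ler_norm.
  rewrite /C1 -mulrA -exprMn ler_wpM2l//.
  by apply: lerXn2r => //; rewrite nnegrE// !mulr_ge0// ltW.
have a'0 : is_derive (0 : R) 1 a (da 0) by exact: nbhs_singleton ada.
(* Choosing e, the bound a t ^ 2 <= C1 t ^ 3 gives a linear bound on a. *)
have sq t e : 0 < t -> t <= d -> 0 <= e -> C1 * t <= e ^+ 2 -> `|a t| <= e * t.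
  move=> t0 td e0 te; have /andP[_ at2] := aB t t0 td.
  rewrite -ler_sqr ?nnegrE ?mulr_ge0 ?(ltW t0)// real_normK ?num_real//.
  apply: (le_trans at2); rewrite exprMn exprSr mulrA mulrAC.
  by rewrite ler_wpM2r ?exprn_ge0 ?(ltW t0).
have a0 : a 0 = 0.
  have [d' d'0 Hd'] := near0_right (derive_expansion a'0 ltr01).
  pose d1 := Num.min d (Num.min d' 1).
  apply/eqP; rewrite -normr_le0.
  apply: (@le0_linear _ (C1 + 1 + 1 + `|da 0|) d1); first by rewrite /d1 !lt_min d0 d'0/=.
  move=> t t0; rewrite /d1 !le_min => /and3P[td td' t1].
  have h1 : `|a t| <= (C1 + 1) * t.
    apply: sq => //; first by rewrite addr_ge0.
    have : C1 * t <= C1 by rewrite ler_piMr.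
    have : 0 <= C1 ^+ 2 by rewrite exprn_ge0.
    rewrite sqrrD1; lra.
  have := Hd' t; rewrite (ltW t0) td' => /(_ isT); rewrite (gtr0_norm t0) mul1r => h2.
  have -> : a 0 = a t - (a t - a 0 - t * da 0) - t * da 0 by ring.
  have := ler_normB (a t - (a t - a 0 - t * da 0)) (t * da 0).
  have := ler_normB (a t) (a t - a 0 - t * da 0).
  by rewrite [`|t * _|]normrM (gtr0_norm t0); lra.
have a1 : da 0 = 0.
  apply/eqP; rewrite -normr_le0; apply/ler_addgt0Pr => e' e'0; rewrite add0r.
  pose e := e' / 2; have e0 : 0 < e by rewrite divr_gt0.
  have [d' d'0 Hd'] := near0_right (derive_expansion a'0 e0).
  have C11 : 0 < C1 + 1 by rewrite ltr_wpDl.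
  pose t := Num.min d (Num.min d' (e ^+ 2 / (C1 + 1))).
  have t0 : 0 < t by rewrite /t !lt_min d0 d'0 divr_gt0// exprn_gt0.
  have : t <= t by []; rewrite {2}/t !le_min => /and3P[td td' te].
  have h1 : `|a t| <= e * t.
    apply: sq => //; first exact: ltW.
    by move: te; rewrite ler_pdivlMr// mulrDr mulr1 => te; rewrite mulrC; lra.
  have := Hd' t; rewrite (ltW t0) td' a0 subr0 => /(_ isT); rewrite (gtr0_norm t0) => h2.
  have h3 := ler_normB (a t) (a t - t * da 0); rewrite subKr normrM (gtr0_norm t0) in h3.
  rewrite -(ler_pM2l t0); have -> : t * e' = e * t + e * t by rewrite /e; field.
  by lra.
pose E := `|dda| + 1; have E0 : 0 < E by rewrite ltr_wpDl.
have [d' d'0 Hd'] := near0_right (filterI (derive_expansion dadda ltr01) ada).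
have daE t : 0 <= t -> t <= d' -> `|da t| <= E * t.
  move=> t0 td'; have [] := Hd' t _; first by rewrite t0.
  rewrite a1 subr0 (ger0_norm t0) mul1r => h _.
  have := ler_normD (da t - t * dda) (t * dda).
  by rewrite subrK normrM (ger0_norm t0) /E; lra.
have aE t : 0 < t -> t <= d' -> `|a t| <= E * t ^+ 2.
  move=> t0 td'.
  have dat (s : R) : 0 <= s <= t -> is_derive s 1 a (da s).
    by move=> /andP[s0 st]; have [] := Hd' s _; first by rewrite s0 (le_trans st).
  have ca : {within `[0, t], continuous a}.
    apply: derivable_within_continuous => s; rewrite in_itv/= => sI.
    by have [] := dat s sI.
  have da' (s : R) : s \in `]0, t[ -> is_derive s 1 a (da s).
    by rewrite in_itv/= => /andP[/ltW s0 /ltW st]; apply: dat; rewrite s0.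
  have [s] := MVT_segment (ltW t0) da' ca.
  rewrite in_itv/= a0 !subr0 => /andP[s0 st] ->.
  rewrite normrM (gtr0_norm t0) expr2 mulrA ler_wpM2r ?(ltW t0)//.
  rewrite (le_trans (daE s s0 (le_trans st td')))// ler_wpM2l// ltW//.
pose d1 := Num.min d d'.
have : c1 <= 0.
  apply: (@le0_linear _ (E ^+ 2) d1); first by rewrite /d1 lt_min d0.
  move=> t t0; rewrite /d1 le_min => /andP[td td'].
  have /andP[h _] := aB t t0 td.
  rewrite -(ler_pM2r (exprn_gt0 3 t0)) (le_trans h)//.
  have -> : E ^+ 2 * t * t ^+ 3 = (E * t ^+ 2) ^+ 2 by ring.
  rewrite -[a t ^+ 2]real_normK ?num_real// ler_sqr ?nnegrE ?aE//.
  by rewrite mulr_ge0 ?exprn_ge0// ltW.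
by rewrite leNgt c10.
Qed.

End OneVariable.
(** * Frames adapted to a hypersurface *)

Section Frame.
Context {F : fieldType} {n : nat}.
Implicit Types (V : 'M[F]_(n, n.+1)) (e : 'rV[F]_n.+1) (G : 'M[F]_n.+1).

Definition frame V e : 'M[F]_n.+1 :=
  \matrix_k (if unlift ord_max k is Some i then row i V else e).

Lemma frame_lift V e i : row (lift ord_max i) (frame V e) = row i V.
Proof. by rewrite rowK liftK. Qed.

Lemma frame_max V e : row ord_max (frame V e) = e.
Proof. by rewrite rowK unlift_none. Qed.

Lemma mul_frame m (A : 'M[F]_(m, n.+1)) V e :
  A *m frame V e = colsub (lift ord_max) A *m V + col ord_max A *m e.
Proof.
apply/matrixP => i j; rewrite mxE (bigD1_ord ord_max)//= addrC [RHS]mxE; congr (_ + _).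
  rewrite [RHS]mxE; apply: eq_bigr => k _.
  have := congr1 (fun r : 'rV[F]_n.+1 => r 0 j) (frame_lift V e k).
  by rewrite !mxE => ->.
have := congr1 (fun r : 'rV[F]_n.+1 => r 0 j) (frame_max V e).
by rewrite mxE => ->; rewrite mxE big_ord1 !mxE.
Qed.

Lemma mul_frameT_lift m (A : 'M[F]_(m, n.+1)) V e i j :
  (A *m (frame V e)^T) i (lift ord_max j) = (A *m V^T) i j.
Proof.
rewrite !mxE; apply: eq_bigr => k _; rewrite !mxE liftK.
by rewrite mxE.
Qed.

Lemma mul_frameT_max m (A : 'M[F]_(m, n.+1)) V e i :
  (A *m (frame V e)^T) i ord_max = (A *m e^T) i 0.
Proof. by rewrite !mxE; apply: eq_bigr => k _; rewrite !mxE unlift_none. Qed.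

Variables (V : 'M[F]_(n, n.+1)) (e : 'rV[F]_n.+1) (G : 'M[F]_n.+1).

(** Inverse Gram matrix of the frame, and its blocks: the g-dual of the last
    frame vector is [conormal], with components [conormal_tan] along V and
    [- conormal_len] along e. *)
Definition dual_gram : 'M[F]_n.+1 := invmx (frame V e *m G *m (frame V e)^T).

Definition conormal_tan : 'rV[F]_n := \row_i dual_gram ord_max (lift ord_max i).

Definition conormal_len : F := - dual_gram ord_max ord_max.

Definition conormal : 'rV[F]_n.+1 := conormal_tan *m V - conormal_len *: e.

Definition dual_block : 'M[F]_n :=
  \matrix_(i, j) dual_gram (lift ord_max i) (lift ord_max j).

(** [conormal_len] times the inverse of the first fundamental form, in a form
    that makes sense at light-like points too. *)
Definition adjugate_like : 'M[F]_n :=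
  conormal_tan^T *m conormal_tan + conormal_len *: dual_block.

Hypotheses (Gsym : G^T = G) (Gunit : G \in unitmx)
  (Punit : frame V e \in unitmx).

Let P := frame V e.
Let S := V *m G *m V^T.

Lemma gram_frame_unit : P *m G *m P^T \in unitmx.
Proof. by rewrite !unitmx_mul unitmx_tr Gunit /P Punit. Qed.

Lemma dual_gram_sym : dual_gram^T = dual_gram.
Proof. by rewrite /dual_gram trmx_inv !trmx_mul trmxK Gsym mulmxA. Qed.

Lemma dual_gramE : dual_gram *m P *m G *m P^T = 1%:M.
Proof. by rewrite -!mulmxA [P *m (G *m P^T)]mulmxA mulVmx ?gram_frame_unit. Qed.

Lemma conormalE : conormal = row ord_max dual_gram *m P.
Proof.
rewrite mul_frame; congr (_ + _).
  by congr (_ *m _); apply/rowP => i; rewrite !mxE.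
rewrite -scaleNr -mul_scalar_mx; congr (_ *m _).
by apply/matrixP => i j; rewrite !ord1 !mxE eqxx mulr1n opprK.
Qed.

Lemma conormal_orth : conormal *m G *m V^T = 0.
Proof.
apply/rowP => j; rewrite -(mul_frameT_lift _ _ e) conormalE -row_mul -row_mul -row_mul.
by rewrite dual_gramE !mxE (negPf (neq_lift _ _)).
Qed.

Lemma conormal_dual : (conormal *m G *m e^T) 0 0 = 1.
Proof.
rewrite -(mul_frameT_max _ V) conormalE -row_mul -row_mul -row_mul dual_gramE.
by rewrite !mxE eqxx.
Qed.

Lemma conormal_norm : (conormal *m G *m conormal^T) 0 0 = - conormal_len.
Proof.
rewrite {2}/conormal raddfB/= trmx_mul linearZ/= mulmxBr -scalemxAr mulmxA.
rewrite conormal_orth mul0mx sub0r mxE [X in - X]mxE conormal_dual mulr1.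
by [].
Qed.

Lemma conormal_tanS : conormal_tan *m S = conormal_len *: (e *m G *m V^T).
Proof.
have := conormal_orth; rewrite /conormal !mulmxBl => /eqP; rewrite subr_eq0.
by rewrite /S !mulmxA => /eqP ->; rewrite -!scalemxAl.
Qed.

Lemma dual_blockS :
  dual_block *m S + conormal_tan^T *m (e *m G *m V^T) = 1%:M.
Proof.
have h : rowsub (lift ord_max) dual_gram *m P = dual_block *m V + conormal_tan^T *m e.
  rewrite mul_frame; congr (_ + _); congr (_ *m _).
    by apply/matrixP => i j; rewrite !mxE.
  apply/matrixP => i j; rewrite ord1 [LHS]mxE [LHS]mxE.
  by rewrite -[in LHS]dual_gram_sym !mxE.
have : rowsub (lift ord_max) dual_gram *m P *m G *m V^T = 1%:M.
  apply/matrixP => i j; rewrite -(mul_frameT_lift _ _ e).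
  rewrite !mul_rowsub_mx; have -> : forall A : 'M[F]_n.+1, (rowsub (lift ord_max) A) i (lift ord_max j) =
    A (lift ord_max i) (lift ord_max j) by move=> A; rewrite mxE.
  by rewrite dual_gramE !mxE (inj_eq lift_inj).
by rewrite h !mulmxDl /S !mulmxA.
Qed.

Lemma adjugate_likeS : adjugate_like *m S = conormal_len%:M.
Proof.
rewrite /adjugate_like mulmxDl -mulmxA conormal_tanS -scalemxAr -scalemxAl -scalerDr.
by rewrite addrC dual_blockS scalemx1.
Qed.

Lemma adjugate_like_sym : adjugate_like^T = adjugate_like.
Proof.
rewrite /adjugate_like linearD/= trmx_mul trmxK linearZ/=; congr (_ + _ *: _).
apply/matrixP => i j; rewrite !mxE -[in LHS]dual_gram_sym mxE.
by [].
Qed.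

(** Cramer's rule for the last diagonal entry of [dual_gram], whose cofactor is
    the determinant of the first fundamental form. *)
Lemma det_first_form : \det S = - conormal_len * \det (P *m G *m P^T).
Proof.
have u := gram_frame_unit.
have d0 : \det (P *m G *m P^T) != 0 by rewrite -unitfE -unitmxE.
rewrite /conormal_len opprK /dual_gram -/P /invmx u 2!mxE mulrAC mulVf// mul1r.
rewrite /cofactor -signr_odd addnn odd_double mul1r; congr (\det _).
apply/matrixP => i j; rewrite [RHS]mxE [RHS]mxE.
rewrite mul_frameT_lift /S.
rewrite [LHS]mxE [RHS]mxE; apply: eq_bigr => k _; congr (_ * _).
rewrite [LHS]mxE [RHS]mxE; apply: eq_bigr => l _; congr (_ * _).
have := congr1 (fun r : 'rV[F]_n.+1 => r 0 l) (frame_lift V e i).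
by rewrite !mxE => ->.
Qed.

(** S is then invertible, and both sides are multiples of its inverse. *)
Lemma adjugate_first_form : \det S != 0 ->
  \adj S = - \det (P *m G *m P^T) *: adjugate_like.
Proof.
move=> S0; have Su : S \in unitmx by rewrite unitmxE unitfE.
have b0 : conormal_len != 0.
  by move: S0; rewrite det_first_form mulf_eq0 oppr_eq0 negb_or => /andP[].
apply: (can_inj (mulmxK Su)); rewrite mul_adj_mx -scalemxAl adjugate_likeS.
by rewrite det_first_form scale_scalar_mx mulrC mulNr mulrN.
Qed.

End Frame.
(** * Light-like points of a hypersurface, in one chart *)

Section LocalHypersurface.
Context {R : realType} {n : nat}.
Variables (W : set 'rV[R]_n) (V : 'rV[R]_n -> 'M[R]_(n, n.+1))
  (G : 'rV[R]_n -> 'M[R]_n.+1) (Th : 'rV[R]_n -> 'rV[R]_n -> 'M[R]_n.+1)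
  (e : 'rV[R]_n.+1).

Implicit Types (u v w : 'rV[R]_n).

Definition smooth p q (A : 'rV[R]_n -> 'M[R]_(p, q)) := forall k, Ckmx k W A.
Definition smooth_fun (f : 'rV[R]_n -> R) := forall k, Ck k W f.

Hypotheses (oW : open W) (sV : smooth V) (sG : smooth G)
  (sTh : forall i, smooth (Th (delta_mx 0 i))).
Hypothesis ThE : forall v u, Th v u = \sum_i v 0 i *: Th (delta_mx 0 i) u.
Hypotheses (Gsym : forall u, W u -> (G u)^T = G u)
  (Gunit : forall u, W u -> G u \in unitmx)
  (Punit : forall u, W u -> frame (V u) e \in unitmx).

(** Covariant derivative, in the direction v, of vector fields along the
    hypersurface: rows are the components of the vectors, and [Th v] is the
    connection matrix. *)
Definition cov p (v : 'rV[R]_n) (Y : 'rV[R]_n -> 'M[R]_(p, n.+1)) u :=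
  'D_v Y u + Y u *m Th v u.

Hypotheses
  (compat : forall v u, W u -> 'D_v G u = Th v u *m G u + (Th v u *m G u)^T)
  (torsion_free : forall v w u, W u -> w *m cov v V u = v *m cov w V u).

Definition xi u := conormal_tan (V u) e (G u).
Definition beta u := conormal_len (V u) e (G u).
Definition nu u := conormal (V u) e (G u).

Definition sff v w u : R := (w *m cov v V u *m G u *m (nu u)^T) 0 0.

Definition mean_trace u : R := \sum_i \sum_j
  adjugate_like (V u) e (G u) i j * sff (delta_mx 0 i) (delta_mx 0 j) u.

Lemma smooth_diff p q (A : 'rV[R]_n -> 'M[R]_(p, q)) u : smooth A -> W u ->
  differentiable A u.
Proof. by move=> sA; exact: Ckmx_diff (sA 1%N). Qed.

Lemma smooth_fun_diff f u : smooth_fun f -> W u -> differentiable f u.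
Proof. by move=> sf; exact: Ck_diff (sf 1%N). Qed.

Lemma smooth_mul p q r (A : 'rV[R]_n -> 'M[R]_(p, q)) (B : 'rV[R]_n -> 'M[R]_(q, r)) :
  smooth A -> smooth B -> smooth (fun u => A u *m B u).
Proof. by move=> sA sB k; exact: Ckmx_mul. Qed.

Lemma smooth_add p q (A B : 'rV[R]_n -> 'M[R]_(p, q)) :
  smooth A -> smooth B -> smooth (fun u => A u + B u).
Proof. by move=> sA sB k; exact: Ckmx_add. Qed.

Lemma smooth_tr p q (A : 'rV[R]_n -> 'M[R]_(p, q)) :
  smooth A -> smooth (fun u => (A u)^T).
Proof. by move=> sA k; exact: Ckmx_tr. Qed.

Lemma smooth_cst p q (A : 'M[R]_(p, q)) : smooth (fun=> A).
Proof. by move=> k; exact: Ckmx_cst. Qed.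

Lemma smooth_scale p q f (A : 'rV[R]_n -> 'M[R]_(p, q)) :
  smooth_fun f -> smooth A -> smooth (fun u => f u *: A u).
Proof. by move=> sf sA k; apply: Ckmx_scale. Qed.

Lemma smooth_sum p q (I : finType) (A : I -> 'rV[R]_n -> 'M[R]_(p, q)) :
  (forall i, smooth (A i)) -> smooth (fun u => \sum_i A i u).
Proof.
move=> sA k a b; apply: (Ck_eq (f := fun u => \sum_i A i u a b)) => //.
  by move=> u _; rewrite summxE.
by apply: Ck_sum => // i _; exact: sA.
Qed.

Lemma smooth_frame : smooth (fun u => frame (V u) e).
Proof.
move=> k a b; case: (unliftP ord_max a) => [i ->|->].
  by apply: (Ck_eq oW _ (sV k i b)) => u _; rewrite !mxE liftK mxE.
by apply: (Ck_eq oW _ (Ck_cst k W (e 0 b))) => u _; rewrite !mxE unlift_none.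
Qed.

Lemma smooth_dual_gram : smooth (fun u => dual_gram (V u) e (G u)).
Proof.
move=> k; apply: Ckmx_inv => //.
  by move=> u Wu; apply: gram_frame_unit; [exact: Gunit|exact: Punit].
apply: (smooth_mul (smooth_mul smooth_frame sG)).
by apply: smooth_tr; exact: smooth_frame.
Qed.

Lemma smooth_xi : smooth xi.
Proof.
move=> k a b; apply: (Ck_eq oW _ (smooth_dual_gram k ord_max (lift ord_max b))).
by move=> u _; rewrite mxE.
Qed.

Lemma smooth_beta : smooth_fun beta.
Proof. by move=> k; apply: Ck_opp => //; exact: smooth_dual_gram. Qed.

Lemma smooth_xiV : smooth (fun u => xi u *m V u).
Proof. exact: smooth_mul smooth_xi sV. Qed.

Lemma smooth_beta_e : smooth (fun u => beta u *: e).
Proof. by apply: smooth_scale; [exact: smooth_beta|exact: smooth_cst]. Qed.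

Lemma smooth_nu : smooth nu.
Proof.
move=> k a b; apply: (Ck_eq (f := fun u => (xi u *m V u) a b + - (beta u *: e) a b)) => //.
  by move=> u _; rewrite [RHS]mxE [X in _ = _ + X]mxE.
apply: Ck_add => //; first exact: smooth_xiV.
by apply: Ck_opp => //; exact: smooth_beta_e.
Qed.

Lemma nuE : (fun u => xi u *m V u) = (fun u => nu u + beta u *: e).
Proof. by apply/funext => u; rewrite /nu /conormal subrK. Qed.

Lemma smooth_cov p i (Y : 'rV[R]_n -> 'M[R]_(p, n.+1)) :
  smooth Y -> smooth (cov (delta_mx 0 i) Y).
Proof.
move=> sY; apply: smooth_add; first by move=> k; exact: Ckmx_derive.
exact: smooth_mul.
Qed.

Lemma cov_sum p v (Y : 'rV[R]_n -> 'M[R]_(p, n.+1)) u : smooth Y -> W u ->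
  cov v Y u = \sum_i v 0 i *: cov (delta_mx 0 i) Y u.
Proof.
move=> sY Wu; rewrite /cov derive_dirE; last exact: smooth_diff.
rewrite ThE mulmx_sumr -big_split/=; apply: eq_bigr => i _.
by rewrite scalerDr -scalemxAr.
Qed.

Lemma smooth_cov_xi p (Y : 'rV[R]_n -> 'M[R]_(p, n.+1)) :
  smooth Y -> smooth (fun u => cov (xi u) Y u).
Proof.
move=> sY k; apply: (Ckmx_eq (A := fun u => \sum_i xi u 0 i *: cov (delta_mx 0 i) Y u)) => //.
  by move=> u Wu; rewrite cov_sum.
by apply: smooth_sum => i; apply: smooth_scale;
  [move=> l; exact: smooth_xi|exact: smooth_cov].
Qed.

Lemma metric_leibniz p q v u (Y : 'rV[R]_n -> 'M[R]_(p, n.+1))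
    (Z : 'rV[R]_n -> 'M[R]_(q, n.+1)) : W u -> smooth Y -> smooth Z ->
  'D_v (fun y => Y y *m G y *m (Z y)^T) u =
  cov v Y u *m G u *m (Z u)^T + Y u *m G u *m (cov v Z u)^T.
Proof.
move=> Wu sY sZ.
have dY := smooth_diff sY Wu; have dZ := smooth_diff sZ Wu.
have dG := smooth_diff sG Wu.
rewrite derive_mulmx; [|exact: differentiable_mulmx|exact: differentiable_trmx].
rewrite derive_mulmx// derive_trmx// compat// /cov trmx_mul Gsym//.
rewrite !mulmxDl !linearD/= ?mulmxDr ?mulmxDl trmx_mul !mulmxA.
by rewrite !addrA [RHS]addrAC.
Qed.

Lemma cov_mulmx p q v u (A : 'rV[R]_n -> 'M[R]_(p, q)) (Y : 'rV[R]_n -> 'M[R]_(q, n.+1)) :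
  W u -> smooth A -> smooth Y ->
  cov v (fun y => A y *m Y y) u = 'D_v A u *m Y u + A u *m cov v Y u.
Proof.
move=> Wu sA sY; rewrite /cov derive_mulmx ?smooth_diff//; try exact: smooth_diff.
by rewrite mulmxDr addrA mulmxA.
Qed.

Lemma cov_add p v u (Y Z : 'rV[R]_n -> 'M[R]_(p, n.+1)) :
  W u -> smooth Y -> smooth Z ->
  cov v (fun y => Y y + Z y) u = cov v Y u + cov v Z u.
Proof.
move=> Wu sY sZ; rewrite /cov deriveD; [|exact/diff_derivable/smooth_diff..].
by rewrite mulmxDl addrACA.
Qed.

Lemma cov_beta_e v u : W u ->
  cov v (fun y => beta y *: e) u = 'D_v beta u *: e + beta u *: (e *m Th v u).
Proof.
move=> Wu; rewrite /cov derive_scalemx//; last exact: (smooth_fun_diff smooth_beta).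
rewrite (_ : 'D_v (fun=> e) u = 0); last exact: derive_cst.
by rewrite scaler0 addr0 scalemxAl.
Qed.

Lemma nu_orth u : W u -> V u *m G u *m (nu u)^T = 0.
Proof.
move=> Wu; apply: trmx_inj; rewrite trmx_mul trmxK trmx_mul Gsym// mulmxA trmx0.
by apply: conormal_orth => //; [exact: Gunit|exact: Punit].
Qed.

Lemma e_nu u : W u -> (e *m G u *m (nu u)^T) 0 0 = 1.
Proof.
move=> Wu; rewrite -(conormal_dual (Gunit Wu) (Punit Wu)).
have -> : e *m G u *m (nu u)^T = (nu u *m G u *m e^T)^T.
  by rewrite trmx_mul trmxK trmx_mul Gsym// mulmxA.
by rewrite mxE.
Qed.

Lemma dot_sym u (y z : 'rV[R]_n.+1) : W u ->
  (y *m G u *m z^T) 0 0 = (z *m G u *m y^T) 0 0.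
Proof.
move=> Wu; have -> : y *m G u *m z^T = (z *m G u *m y^T)^T.
  by rewrite trmx_mul trmxK trmx_mul Gsym// mulmxA.
by rewrite mxE.
Qed.

Lemma dotDl u (x y z : 'rV[R]_n.+1) : ((x + y) *m G u *m z^T) 0 0 =
  (x *m G u *m z^T) 0 0 + (y *m G u *m z^T) 0 0.
Proof. by rewrite !mulmxDl mxE. Qed.

Lemma dotZl u k (x z : 'rV[R]_n.+1) : ((k *: x) *m G u *m z^T) 0 0 =
  k * (x *m G u *m z^T) 0 0.
Proof. by rewrite -!scalemxAl mxE. Qed.

Lemma derive00 (A : 'rV[R]_n -> 'M[R]_1) v u : smooth A -> W u ->
  ('D_v A u) 0 0 = 'D_v (fun y => A y 0 0) u.
Proof. by move=> sA Wu; rewrite derive_entry//; exact: smooth_diff. Qed.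

Lemma smooth_dot p q (Y : 'rV[R]_n -> 'M[R]_(p, n.+1)) (Z : 'rV[R]_n -> 'M[R]_(q, n.+1)) :
  smooth Y -> smooth Z -> smooth (fun y => Y y *m G y *m (Z y)^T).
Proof. by move=> sY sZ; apply: smooth_mul; [exact: smooth_mul|exact: smooth_tr]. Qed.

Lemma derive_dot v u (Y Z : 'rV[R]_n -> 'rV[R]_n.+1) : W u -> smooth Y -> smooth Z ->
  'D_v (fun y => (Y y *m G y *m (Z y)^T) 0 0) u =
  (cov v Y u *m G u *m (Z u)^T) 0 0 + (cov v Z u *m G u *m (Y u)^T) 0 0.
Proof.
move=> Wu sY sZ; rewrite -derive00//; last exact: smooth_dot.
by rewrite metric_leibniz// mxE; congr (_ + _); rewrite dot_sym.
Qed.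

(** The normal has length [- beta], so its derivative along itself, up to a
    multiple of [beta], is half the derivative of [beta] along [xi]. *)
Lemma sff_xi u : W u -> sff (xi u) (xi u) u =
  2^-1 * 'D_(xi u) beta u +
  beta u * (e *m Th (xi u) u *m G u *m (nu u)^T) 0 0.
Proof.
move=> Wu; rewrite /sff; set v := xi u.
have sN := smooth_nu; have se := smooth_beta_e.
have h1 : cov v (fun y => xi y *m V y) u *m G u *m (nu u)^T =
    v *m cov v V u *m G u *m (nu u)^T.
  rewrite cov_mulmx//; last exact: smooth_xi.
  by rewrite !mulmxDl -3!mulmxA [V u *m (_ *m _)]mulmxA nu_orth// mulmx0 add0r !mulmxA.
rewrite -h1 nuE cov_add// cov_beta_e// dotDl [X in _ + X]dotDl !dotZl e_nu// mulr1.
have : 'D_v (fun y => (nu y *m G y *m (nu y)^T) 0 0) u = - 'D_v beta u.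
  rewrite -deriveN; last exact: diff_derivable (smooth_fun_diff smooth_beta Wu).
  apply: near_eq_derive; apply: (near_open oW _ Wu) => y Wy.
  by rewrite conormal_norm//; [exact: Gunit|exact: Punit].
rewrite derive_dot// => h2.
have -> : (cov v nu u *m G u *m (nu u)^T) 0 0 = - 2^-1 * 'D_v beta u by lra.
by lra.
Qed.

Lemma sff_sum u : W u -> sff (xi u) (xi u) u =
  \sum_i \sum_j xi u 0 i * xi u 0 j * sff (delta_mx 0 i) (delta_mx 0 j) u.
Proof.
move=> Wu; rewrite /sff [X in (_ *m X *m _ *m _) 0 0]cov_sum//.
rewrite mulmx_sumr !mulmx_suml summxE; apply: eq_bigr => i _.
rewrite -scalemxAr -!scalemxAl [LHS]mxE.
rewrite [X in _ * (X *m cov _ _ _ *m _ *m _) _ _]row_sum_delta !mulmx_suml summxE mulr_sumr; apply: eq_bigr => j _.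
by rewrite -!scalemxAl [X in _ * X = _]mxE mulrA.
Qed.

(** The coefficient of the zeroth-order term of the differential equation for
    [beta] below; only its continuity matters. *)
Definition defect u : R := 2 * (e *m Th (xi u) u *m G u *m (nu u)^T) 0 0
  + 2 * \sum_i \sum_j dual_block (V u) e (G u) i j *
        sff (delta_mx 0 i) (delta_mx 0 j) u.

(** A linear differential equation for [beta] along the integral curves of [xi],
    with [mean_trace] as source. The rank one part of [adjugate_like] contributes
    the second fundamental form on [xi], the rest a multiple of [beta]. *)
Lemma derive_beta_xi u : W u ->
  'D_(xi u) beta u = 2 * mean_trace u - beta u * defect u.
Proof.
move=> Wu; have -> : mean_trace u = sff (xi u) (xi u) u +
    beta u * \sum_i \sum_j dual_block (V u) e (G u) i j *
        sff (delta_mx 0 i) (delta_mx 0 j) u.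
  rewrite sff_sum// mulr_sumr -big_split/=; apply: eq_bigr => i _.
  rewrite mulr_sumr -big_split/=; apply: eq_bigr => j _.
  rewrite /adjugate_like [X in X * _ = _]mxE [X in (X + _) * _]mxE big_ord1.
  rewrite [X in (X * _ + _) * _]mxE [X in (_ + X) * _]mxE -/(xi u) -/(beta u).
  by ring.
rewrite sff_xi// /defect; by field.
Qed.

Lemma smooth_sff i j : smooth_fun (sff (delta_mx 0 i) (delta_mx 0 j)).
Proof.
move=> k.
have s : smooth (fun u => (delta_mx 0 j : 'rV_n) *m cov (delta_mx 0 i) V u).
  by apply: smooth_mul; [exact: smooth_cst|exact: smooth_cov].
exact: (smooth_dot s smooth_nu).
Qed.

Lemma smooth_fun_sum2 (f : 'I_n -> 'I_n -> 'rV[R]_n -> R) :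
  (forall i j, smooth_fun (f i j)) -> smooth_fun (fun u => \sum_i \sum_j f i j u).
Proof.
by move=> sf k; apply: Ck_sum => // i _; apply: Ck_sum => // j _; exact: sf.
Qed.

Lemma smooth_fun_mul f g : smooth_fun f -> smooth_fun g ->
  smooth_fun (fun u => f u * g u).
Proof. by move=> sf sg k; apply: Ck_mul. Qed.

Lemma smooth_fun_add f g : smooth_fun f -> smooth_fun g ->
  smooth_fun (fun u => f u + g u).
Proof. by move=> sf sg k; apply: Ck_add. Qed.

Lemma smooth_dual_block i j : smooth_fun (fun u => dual_block (V u) e (G u) i j).
Proof.
move=> k; apply: (Ck_eq oW _ (smooth_dual_gram k (lift ord_max i) (lift ord_max j))).
by move=> u _; rewrite mxE.
Qed.

Lemma smooth_mean_trace : smooth_fun mean_trace.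
Proof.
apply: smooth_fun_sum2 => i j; apply: smooth_fun_mul; last exact: smooth_sff.
move=> k; apply: (Ck_eq (f := fun u =>
  xi u 0 i * xi u 0 j + beta u * dual_block (V u) e (G u) i j)) => //.
  move=> u _; rewrite [RHS]mxE [X in _ = X + _]mxE big_ord1 [X in _ = X * _ + _]mxE.
  by rewrite [X in _ = _ + X]mxE.
by apply: smooth_fun_add; apply: smooth_fun_mul;
  [move=> l; exact: smooth_xi|move=> l; exact: smooth_xi|exact: smooth_beta
  |exact: smooth_dual_block].
Qed.

Lemma smooth_defect : smooth_fun defect.
Proof.
apply: smooth_fun_add; apply: smooth_fun_mul => //; try (by move=> k; exact: Ck_cst).
  have s : smooth (fun u => e *m Th (xi u) u).
    apply: smooth_mul; first exact: smooth_cst.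
    move=> k; apply: (Ckmx_eq (A := fun u => \sum_i xi u 0 i *: Th (delta_mx 0 i) u)) => //.
    by apply: smooth_sum => i; apply: smooth_scale; [move=> l; exact: smooth_xi|].
  by move=> k; exact: (smooth_dot s smooth_nu).
apply: smooth_fun_sum2 => i j; apply: smooth_fun_mul; last exact: smooth_sff.
exact: smooth_dual_block.
Qed.

Definition accel u : 'rV[R]_n.+1 := cov (xi u) (fun y => xi y *m V y) u.

Definition friction u : R := (accel u *m G u *m e^T) 0 0.

Lemma smooth_friction : smooth_fun friction.
Proof.
move=> k; have s : smooth accel by apply: smooth_cov_xi; exact: smooth_xiV.
exact: (smooth_dot s (smooth_cst e)).
Qed.

Lemma derive_beta_mul v u (f : 'rV[R]_n -> R) : W u -> smooth_fun f ->
  beta u = 0 -> 'D_v beta u = 0 -> 'D_v (fun y => beta y * f y) u = 0.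
Proof.
move=> Wu sf b0 db0.
rewrite deriveM; [|exact: diff_derivable (smooth_fun_diff smooth_beta Wu)|
  exact: diff_derivable (smooth_fun_diff sf Wu)].
by rewrite b0 db0 scale0r scaler0 addr0.
Qed.

(** Where [beta] vanishes to second order the field xi V = nu is tangent, null
    and orthogonal to every tangent vector; differentiating these relations
    shows that its acceleration is orthogonal to the tangent space, hence a
    multiple of nu. *)
Lemma accel_nu u : W u -> beta u = 0 -> (forall v, 'D_v beta u = 0) ->
  accel u = friction u *: nu u.
Proof.
move=> Wu b0 db0.
have xiS y : W y -> xi y *m V y *m G y *m (V y)^T = beta y *: (e *m G y *m (V y)^T).
  move=> Wy; rewrite -(conormal_tanS (Gunit Wy) (Punit Wy)).
  by rewrite /xi !mulmxA.
have sxV := smooth_xiV.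
have tan w : (accel u *m G u *m (w *m V u)^T) 0 0 = 0.
  have swV : smooth (fun y => w *m V y) by apply: smooth_mul => //; exact: smooth_cst.
  have dw v (w' : 'rV[R]_n) : cov v (fun y => w' *m V y) u = w' *m cov v V u.
    rewrite cov_mulmx//; last exact: smooth_cst.
    by rewrite (_ : 'D_v (fun=> w') u = 0) ?mul0mx ?add0r//; exact: derive_cst.
  (* g (xi V, w V) is a multiple of beta, and so is its derivative along xi *)
  have h1 : 'D_(xi u) (fun y => (xi y *m V y *m G y *m (w *m V y)^T) 0 0) u = 0.
    transitivity ('D_(xi u) (fun y => beta y * (e *m G y *m (w *m V y)^T) 0 0) u).
      apply: near_eq_derive; apply: (near_open oW _ Wu) => y Wy.
      by rewrite trmx_mul !mulmxA xiS// -scalemxAl mxE.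
    apply: derive_beta_mul => // k.
    exact: (smooth_dot (smooth_cst e) swV).
  (* likewise for g (xi V, xi V), differentiated along w *)
  have h2 : 'D_w (fun y => (xi y *m V y *m G y *m (xi y *m V y)^T) 0 0) u = 0.
    transitivity ('D_w (fun y => beta y * (e *m G y *m (xi y *m V y)^T) 0 0) u).
      apply: near_eq_derive; apply: (near_open oW _ Wu) => y Wy.
      by rewrite trmx_mul !mulmxA xiS// -scalemxAl mxE.
    apply: derive_beta_mul => // k.
    exact: (smooth_dot (smooth_cst e) sxV).
  rewrite derive_dot// -/(accel u) dw in h1.
  rewrite derive_dot// in h2.
  have h3 : (cov w (fun y => xi y *m V y) u *m G u *m (xi u *m V u)^T) 0 0 = 0 by lra.
  rewrite cov_mulmx// in h3; last exact: smooth_xi.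
  rewrite dotDl in h3.
  have h4 : ('D_w xi u *m V u *m G u *m (xi u *m V u)^T) 0 0 = 0.
    rewrite dot_sym// trmx_mul mulmxA xiS// b0 scale0r mul0mx.
    by rewrite mxE.
  rewrite h4 add0r -torsion_free// in h3.
  by rewrite h3 addr0 in h1.
have Pu := Punit Wu; have Gu := Gunit Wu.
set a := accel u - friction u *: nu u; suff : a = 0.
  by move=> /eqP; rewrite subr_eq0 => /eqP.
have aV : a *m G u *m (V u)^T = 0.
  rewrite /a !mulmxBl -!scalemxAl conormal_orth// scaler0 subr0.
  apply/rowP => j; rewrite [RHS]mxE -(tan (delta_mx 0 j)) -rowE.
  by rewrite !mxE; apply: eq_bigr => k _; rewrite !mxE.
have ae : (a *m G u *m e^T) 0 0 = 0.
  by rewrite /a -scaleNr dotDl dotZl conormal_dual// mulr1 subrr.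
have : a *m G u *m (frame (V u) e)^T = 0.
  apply/rowP => k; case: (unliftP ord_max k) => [j ->|->].
    by rewrite mul_frameT_lift aV !mxE.
  by rewrite mul_frameT_max ae mxE.
move=> /(congr1 (mulmx^~ (invmx (frame (V u) e)^T))).
rewrite mulmxK ?unitmx_tr// mul0mx => /(congr1 (mulmx^~ (invmx (G u)))).
by rewrite mulmxK// mul0mx.
Qed.

Section NullFlow.
Variables (o : 'rV[R]_n) (C : R).
Hypotheses (Wo : W o) (beta_o : beta o = 0)
  (dbeta0 : forall u v, W u -> beta u = 0 -> 'D_v beta u = 0)
  (traceC : \forall u \near o, `|mean_trace u| <= C * `|beta u|).

(** The integral curve of [xi] through a light-like point stays light-like. Its
    parameter is corrected by a factor f with f' = - friction f ^ 2, so that the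
    tangential part of the acceleration is cancelled as well. *)
Lemma null_flow : exists2 d, 0 < d & exists (z : R -> 'rV[R]_n) (f : R -> R),
  z 0 = o /\ forall t : R, `|t| < d -> [/\ W (z t) /\ beta (z t) = 0,
    differentiable z t, 'D_1 z t = f t *: xi (z t), f t != 0 &
    is_derive t 1 f (- friction (z t) * f t ^+ 2)].
Proof.
pose l (x : 'rV[R]_(n + 1)) : 'rV[R]_n := lsubmx x.
pose q (x : 'rV[R]_(n + 1)) : R := x 0 (rshift n 0).
have dl x : differentiable l x.
  apply/differentiable_mxP => i j; rewrite (_ : (fun y => _) =
    (fun x : 'rV[R]_(n + 1) => x i (lshift 1 j))); first exact: differentiable_coord.
  by apply/funext => y; rewrite mxE.
have dq x : differentiable q x by exact: differentiable_coord.
pose Z := l @^-1` W.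
have oZ : open Z.
  apply: open_comp => // x _; exact: differentiable_continuous.
pose fv (x : 'rV[R]_(n + 1)) : 'rV[R]_(n + 1) :=
  row_mx (q x *: xi (l x)) (const_mx (- friction (l x) * q x ^+ 2)).
have Ccoord k j : Ck k Z (fun x : 'rV[R]_(n + 1) => x 0 j).
  elim: k => // k _; split=> [x _|i]; first exact: differentiable_coord.
  rewrite (_ : partial i _ = fun=> (delta_mx 0 i : 'rV[R]_(n + 1)) 0 j).
    exact: Ck_cst.
  apply/funext => x; rewrite /partial.
  have di : differentiable (@id 'rV[R]_(n + 1)) x by [].
  have := derive_entry (delta_mx 0 i) (0 : 'I_1) j di.
  by rewrite derive_id => ->.
have Cl k : Ckmx k Z l.
  move=> i j; rewrite (ord1 i); apply: (Ck_eq oZ _ (Ccoord k (lshift 1 j))) => x _.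
  by rewrite mxE.
have Ccomp k (g : 'rV[R]_n -> R) : smooth_fun g -> Ck k Z (fun x => g (l x)).
  by move=> sg; apply: (Ck_comp oZ _ (sg k) (Cl k)).
have Cfv : Ckmx 2 Z fv.
  move=> i j; rewrite (ord1 i); case: (split_ordP j) => k ->.
    apply: (Ck_eq (f := fun x => q x * xi (l x) 0 k)) => //.
      by move=> x _; rewrite /fv row_mxEl [RHS]mxE.
    apply: Ck_mul => //; first exact: Ccoord.
    by apply: (Ccomp 2%N (fun u => xi u 0 k)) => m; exact: smooth_xi.
  apply: (Ck_eq (f := fun x => - friction (l x) * (q x * q x))) => //.
    by move=> x _; rewrite /fv row_mxEr [RHS]mxE expr2.
  apply: Ck_mul => //; last by apply: Ck_mul => //; exact: Ccoord.
  by apply: Ck_opp => //; apply: (Ccomp 2%N friction); exact: smooth_friction.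
pose x0 : 'rV[R]_(n + 1) := row_mx o (const_mx 1).
have Zx0 : Z x0 by rewrite /Z /l /= row_mxKl.
have [d0 d00 [y [y0 Hy]]] := C2_flow oZ Zx0 Cfv.
pose z t := l (y t); pose f t := q (y t).
have z0 : z 0 = o by rewrite /z y0 /l row_mxKl.
have f0 : f 0 = 1 by rewrite /f y0 /q row_mxEr mxE.
have dz t : `|t| < d0 -> differentiable z t.
  by move=> td; have [_ dy _] := Hy t td; exact: (differentiable_comp dy).
have zE (t : R) : `|t| < d0 -> 'D_1 z t = f t *: xi (z t).
  move=> td; have [_ dy yE] := Hy t td.
  apply/rowP => j; rewrite derive_entry; last exact: dz.
  rewrite (_ : (fun s => z s 0 j) = fun s => y s 0 (lshift 1 j)); last first.
    by apply/funext => s; rewrite mxE.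
  by rewrite -derive_entry// yE row_mxEl.
have fE (t : R) : `|t| < d0 -> is_derive t 1 f (- friction (z t) * f t ^+ 2).
  move=> td; have [_ dy yE] := Hy t td.
  have df : differentiable f t by exact: (differentiable_comp dy).
  apply: DeriveDef; first exact: diff_derivable.
  by rewrite /f /q -derive_entry// yE row_mxEr mxE.
have d0' : `|0 : R| < d0 by rewrite normr0.
have cz : {for 0, continuous z} by apply: differentiable_continuous; exact: dz.
have cf : {for 0, continuous f}.
  by apply: differentiable_continuous; apply/derivable1_diffP; have [] := fE 0 d0'.
pose D := `|defect o| + 1.
have near_o : \forall u \near o, `|defect u| <= D /\
    `|mean_trace u| <= C * `|beta u|.
  apply: filterI => //; apply: near_bounded; apply: differentiable_continuous.
  exact: smooth_fun_diff smooth_defect Wo.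
have near_t : \forall t \near (0 : R), (`|defect (z t)| <= D /\
    `|mean_trace (z t)| <= C * `|beta (z t)|) /\ `|1 - f t| <= 1 / 2.
  apply: filterI; first by move: near_o; rewrite -z0 => /cz.
  by move/cvgr_dist_le: cf; rewrite f0; apply; lra.
have [r r0 [rd0 rP]] : exists2 r, 0 < r & r <= d0 /\ forall t, `|t| < r ->
    (`|defect (z t)| <= D /\ `|mean_trace (z t)| <= C * `|beta (z t)|) /\
    `|1 - f t| <= 1 / 2.
  move: near_t => /nbhs_ballP[r /= r0 rP]; exists (Num.min r d0).
    by rewrite lt_min r0.
  split=> [|t]; first by rewrite ge_min lexx orbT.
  by rewrite lt_min => /andP[tr _]; apply: rP; rewrite /ball/= sub0r normrN.
have fle t : `|t| < r -> 1 / 2 <= f t <= 2.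
  by move=> /rP[_]; rewrite ler_norml => /andP[? ?]; apply/andP; split; lra.
have db (t : R) : `|t| < r -> is_derive t 1 (fun s => beta (z s))
    (f t * (2 * mean_trace (z t) - beta (z t) * defect (z t))).
  move=> tr; have td := lt_le_trans tr rd0; have [Wz _ _] := Hy t td.
  have dbz := smooth_fun_diff smooth_beta Wz.
  have -> : (fun s => beta (z s)) = beta \o z by [].
  have dcomp : differentiable (beta \o z) t by exact: differentiable_comp (dz t td) dbz.
  apply: DeriveDef; first exact: diff_derivable.
  rewrite (derive_comp _ (dz t td) dbz) zE// -derive_beta_xi//.
  by rewrite !deriveE// linearZ.
have [||d dd0 bd] := gronwall r0 db (C := 2 * (2 * `|C| + D)).
- move=> t tr; have td := lt_le_trans tr rd0; have [Wz _ _] := Hy t td.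
  have /andP[f1 f2] := fle t tr; have [[dD mC] _] := rP t tr.
  rewrite normrM -mulrA; apply: ler_pM => //; first by rewrite ler_norml; apply/andP; split; lra.
  rewrite [leRHS]mulrDl; apply: (le_trans (ler_normB _ _)); apply: lerD.
    rewrite normrM ger0_norm// -mulrA ler_wpM2l// (le_trans mC)//.
    by rewrite ler_wpM2r// ler_norm.
  by rewrite normrM mulrC ler_wpM2r.
- by rewrite z0.
exists (Num.min d r); first by rewrite lt_min dd0.
exists z, f; split=> // t; rewrite lt_min => /andP[td tr].
have td0 := lt_le_trans tr rd0; have [Wz _ _] := Hy t td0.
split; [by split=> //; apply/bd/ltW|exact: dz|exact: zE| |exact: fE].
by have /andP[? _] := fle t tr; apply: lt0r_neq0; lra.
Qed.

Theorem null_geodesic : exists2 d, 0 < d & exists z : R -> 'rV[R]_n, z 0 = o /\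
  let Y (t : R) := 'D_1 z t *m V (z t) in
  forall t : R, `|t| < d -> [/\ W (z t) /\ differentiable z t, differentiable Y t,
    'D_1 Y t + Y t *m Th ('D_1 z t) (z t) = 0, Y t != 0 &
    (Y t *m G (z t) *m (Y t)^T) 0 0 = 0].
Proof.
have [d d0 [z [f [z0 H]]]] := null_flow; exists d => //; exists z; split=> // Y t td.
have [[Wz bz] dz zE fn0 fE] := H t td.
pose T u := xi u *m V u.
pose Y' (s : R) := f s *: T (z s).
have YY' : \forall s \near t, Y' s = Y s.
  have oB : nbhs t [set s : R | `|s| < d].
    apply/nbhs_ballP; exists (d - `|t|); first by rewrite /= subr_gt0.
    move=> s /= ts; have := ler_normD t (s - t); rewrite subrKC => h.
    apply: (le_lt_trans h); rewrite -ltrBrDl -normrN opprB; exact: ts.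
  apply: filterS oB => s sd; have [_ _ zEs _ _] := H s sd.
  by rewrite /Y zEs -scalemxAl.
have dT : differentiable T (z t) by exact: smooth_diff smooth_xiV Wz.
have dTz : differentiable (T \o z) t by exact: differentiable_comp dz dT.
have df : differentiable f t by apply/derivable1_diffP; case: fE.
have dY' : differentiable Y' t by exact: differentiable_scalemx.
have [dY _] := near_eq_diff YY' dY'.
have YE : Y t = f t *: nu (z t).
  by rewrite -(nbhs_singleton YY') /Y' /nu /conormal -/(beta _) bz scale0r subr0.
have TE : T (z t) = nu (z t).
  by rewrite /T /nu /conormal -/(beta _) bz scale0r subr0.
have nu0 : nu (z t) != 0.
  apply/eqP => h; have := conormal_dual (Gunit Wz) (Punit Wz).
  by rewrite -/(nu _) h !mul0mx mxE => /esym/eqP; rewrite oner_eq0.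
have acc := accel_nu Wz bz (fun v => dbeta0 v Wz bz).
split=> //; last 2 first.
- by rewrite YE scaler_eq0 negb_or fn0.
- rewrite YE linearZ/= -scalemxAr -!scalemxAl mxE [X in _ * X]mxE.
  rewrite conormal_norm//; [|exact: Gunit|exact: Punit].
  by rewrite -/(beta _) bz oppr0 !mulr0.
rewrite -(near_eq_derive _ YY') /Y' derive_scalemx//.
have -> : 'D_1 (fun s => T (z s)) t = f t *: 'D_(xi (z t)) T (z t).
  by rewrite (derive_comp _ dz dT) zE !deriveE// linearZ.
have -> : 'D_1 f t = - friction (z t) * f t ^+ 2 by case: fE.
have -> : Th ('D_1 z t) (z t) = f t *: Th (xi (z t)) (z t).
  rewrite zE ThE [Th (xi _) _]ThE scaler_sumr; apply: eq_bigr => i _.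
  by rewrite mxE scalerA.
rewrite -scalemxAr YE -TE -!scalemxAl !scalerA -expr2 -addrA -scalerDr.
have -> : 'D_(xi (z t)) T (z t) + T (z t) *m Th (xi (z t)) (z t) = accel (z t) by [].
by rewrite acc TE scalerA -scalerDl mulNr mulrC addNr scale0r.
Qed.

End NullFlow.

End LocalHypersurface.
(** * Christoffel symbols and changes of charts *)

Lemma analytic_mx_Ck {R : realType} {n p q : nat} (A : 'rV[R]_n -> 'M[R]_(p, q)) x :
  (forall i j, analytic_at (fun y => A y i j) x) ->
  exists2 e, 0 < e & forall k, Ckmx k (ball x e) A.
Proof.
move=> anA.
pose P (ij : 'I_p * 'I_q) (e : R) := forall k, Ck k (ball x e) (fun y => A y ij.1 ij.2).
have h : \forall e \near (0 : R)^'+, forall ij, P ij e.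
  apply: (@filter_forall R _ P (0^'+) _) => -[i j].
  have [e e0 He] := analytic_Ck (anA i j).
  have : \forall e' \near (0 : R)^'+, e' <= e by exact: nbhs_right_le.
  apply: filterS => e' e'e k; apply: Ck_subset (He k).
  by move=> y; apply: le_ball.
have h0 : \forall e \near (0 : R)^'+, 0 < e by exact: nbhs_right_gt.
have [e [He e0]] : exists e, (forall ij, P ij e) /\ 0 < e.
  exact: (@filter_ex _ (0^'+) _ _ (filterI h h0)).
by exists e => // k i j; exact: (He (i, j)).
Qed.

Section Jacobian.
Context {R : realType} {m q : nat}.
Variables (f : 'rV[R]_m -> 'rV[R]_q).
Implicit Types (x y v w : 'rV[R]_m).

Lemma delta_mulE (A : 'M[R]_(m, q)) i k : ((delta_mx 0 i : 'rV_m) *m A) 0 k = A i k.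
Proof. by rewrite -rowE mxE. Qed.

Lemma jacobianE y i j : differentiable f y ->
  jacobian f y i j = partial i (fun u => f u 0 j) y.
Proof.
move=> df; rewrite /partial -derive_entry// deriveEjacobian//.
by rewrite -rowE [RHS]mxE.
Qed.

Lemma mul_jacobian y v : differentiable f y -> v *m jacobian f y = 'D_v f y.
Proof. by move=> df; rewrite deriveEjacobian. Qed.

Lemma vec_analytic_Ck x : vec_analytic_at f x ->
  exists2 e, 0 < e & forall k, Ckmx k (ball x e) f.
Proof. by move=> af; apply: analytic_mx_Ck => i j; rewrite (ord1 i). Qed.

Lemma jacobian_Ck (W : set 'rV[R]_m) k : open W -> Ckmx k.+1 W f ->
  Ckmx k W (jacobian f).
Proof.
move=> oW Cf i j; apply: (Ck_eq oW _ (Ck_partial i (Cf 0 j))) => x xe.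
by rewrite jacobianE//; exact: Ckmx_diff Cf xe.
Qed.

Lemma jacobian_diff x : vec_analytic_at f x -> differentiable (jacobian f) x.
Proof.
move=> /vec_analytic_Ck[e e0 He].
have oB : open (ball x e) by exact: ball_open.
exact: Ckmx_diff (jacobian_Ck oB (He 2%N)) (ballxx _ e0).
Qed.

Lemma vec_analytic_near_diff x : vec_analytic_at f x ->
  \forall y \near x, differentiable f y.
Proof.
move=> /vec_analytic_Ck[e e0 He].
have : \forall y \near x, ball x e y by exact: nbhsx_ballx.
by apply: filterS => y ye; exact: (Ckmx_diff (He 1%N)).
Qed.

(** Symmetry of the second derivatives of f. *)
Lemma derive_jacobian_sym v w x : vec_analytic_at f x ->
  w *m 'D_v (jacobian f) x = v *m 'D_w (jacobian f) x.
Proof.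
move=> af; have dJ := jacobian_diff af.
have near_diff := vec_analytic_near_diff af.
have E i j : (delta_mx 0 i : 'rV_m) *m 'D_(delta_mx 0 j) (jacobian f) x =
    (delta_mx 0 j : 'rV_m) *m 'D_(delta_mx 0 i) (jacobian f) x.
  apply/rowP => k.
  have h a b : ((delta_mx 0 b : 'rV_m) *m 'D_(delta_mx 0 a) (jacobian f) x) 0 k =
      partial a (partial b (fun u => f u 0 k)) x.
    rewrite delta_mulE (derive_entry (delta_mx 0 a) b k dJ).
    apply: near_eq_derive; apply: filterS near_diff => y dy.
    by rewrite jacobianE.
  apply: (etrans (h j i)); apply: (etrans _ (esym (h i j))).
  exact: nbhs_singleton (analytic_partialC j i (af k)).
rewrite !(derive_dirE _ dJ) !mulmx_sumr.
rewrite (eq_bigr (fun i => \sum_j (v 0 i * w 0 j) *: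
    ((delta_mx 0 j : 'rV_m) *m 'D_(delta_mx 0 i) (jacobian f) x))); last first.
  move=> i _; rewrite -scalemxAr {1}(row_sum_delta w) mulmx_suml scaler_sumr.
  by apply: eq_bigr => j _; rewrite -scalemxAl scalerA.
rewrite exchange_big; apply: eq_bigr => j _.
rewrite -scalemxAr {2}(row_sum_delta v) mulmx_suml scaler_sumr.
by apply: eq_bigr => i _; rewrite -scalemxAl scalerA [v 0 i * _]mulrC E.
Qed.

End Jacobian.

Section Transition.
Context {R : realType} {n : nat} {M : orientedManifold R n.+1}.
Variable g : lorentzMetric M.
Implicit Types (c d : chart R M n.+1) (x v w z : 'rV[R]_n.+1).

Lemma lorentzian_sym (A : 'M[R]_n.+1) : lorentzian A -> A^T = A.
Proof. by case. Qed.

Lemma lorentzian_unit (A : 'M[R]_n.+1) : lorentzian A -> A \in unitmx.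
Proof.
move=> [_ [P Pu PA]].
have : P *m A *m P^T \in unitmx.
  rewrite PA unitmxE det_diag unitfE; apply/prodf_neq0 => i _; rewrite mxE.
  by case: ifP; rewrite ?oppr_eq0 oner_eq0.
by rewrite !unitmx_mul => /andP[/andP[]].
Qed.

Lemma row_ext (A : 'M[R]_n.+1) x y : A \in unitmx ->
  (forall z, (x *m A *m z^T) 0 0 = (y *m A *m z^T) 0 0) -> x = y.
Proof.
move=> Au h; have : x *m A = y *m A.
  apply/rowP => j; have := h (delta_mx 0 j); rewrite trmx_delta -!colE !mxE.
  by [].
by move=> /(congr1 (mulmx^~ (invmx A))); rewrite !mulmxK.
Qed.

(** Locked, since comparing two different values by conversion would unfold the
    limits that define the derivatives. *)
Definition dgram := locked (fun c x v w z => (w *m 'D_v (g c) x *m z^T) 0 0).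

Lemma dgramE c x v w z : dgram c x v w z = (w *m 'D_v (g c) x *m z^T) 0 0.
Proof. by rewrite /dgram -lock. Qed.

(** Twice the Christoffel symbol of the first kind. *)
Definition koszul c x v w z : R := dgram c x v w z + dgram c x w v z - dgram c x z v w.

Section OneChart.
Variables (c : chart R M n.+1) (p : M).
Hypotheses (ac : atlas c) (cp : chart_dom c p).

Lemma chart_image_near : \forall x \near c p, (c @` chart_dom c) x.
Proof. by apply: open_nbhs_nbhs; split; [exact: chart_cod_open|exists p]. Qed.

Lemma chart_near (A : set M) : open A -> A p -> \forall x \near c p,
  [/\ chart_dom c (chart_inv c x), c (chart_inv c x) = x & A (chart_inv c x)].
Proof.
move=> oA Ap.
have h1 : \forall x \near c p, A (chart_inv c x).
  have := @chart_inv_continuous _ _ _ c (c p) _; apply; first by exists p.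
  by rewrite chart_mapK//; exact: open_nbhs_nbhs.
apply: filterS2 chart_image_near h1 => x [q dq <-] Aq.
by split=> //; rewrite chart_mapK.
Qed.

Lemma gram_Ck : exists2 e, 0 < e & forall k, Ckmx k (ball (c p) e) (g c).
Proof.
apply: analytic_mx_Ck => i j; apply: gram_analytic => //; by exists p.
Qed.

Lemma gram_diff : differentiable (g c) (c p).
Proof.
have [e e0 He] := gram_Ck; exact: (Ckmx_diff (He 1%N)) (ballxx _ e0).
Qed.

Lemma gram_sym : (g c (c p))^T = g c (c p).
Proof. exact/lorentzian_sym/gram_lorentzian. Qed.

Lemma gram_unit : g c (c p) \in unitmx.
Proof. exact/lorentzian_unit/gram_lorentzian. Qed.

Lemma derive_gram_sym v : ('D_v (g c) (c p))^T = 'D_v (g c) (c p).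
Proof.
rewrite -derive_trmx; last exact: gram_diff.
apply: near_eq_derive; apply: filterS chart_image_near => x [q dq <-].
exact/lorentzian_sym/gram_lorentzian.
Qed.

Lemma dgram_sum v w z : dgram c (c p) v w z =
  \sum_i \sum_j \sum_l v 0 i * w 0 j * z 0 l * partial i (fun y => g c y j l) (c p).
Proof.
rewrite dgramE derive_dirE; last exact: gram_diff.
rewrite mulmx_sumr mulmx_suml summxE; apply: eq_bigr => i _.
rewrite -scalemxAr -scalemxAl mxE mxE mulr_sumr exchange_big/=; apply: eq_bigr => l _.
rewrite mxE mulr_suml mulr_sumr; apply: eq_bigr => j _.
rewrite [z^T _ _]mxE derive_entry; last exact: gram_diff.
by rewrite /partial; ring.
Qed.

Lemma christoffel_mul_gram i j : christoffel g c (c p) i j *m g c (c p) =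
  2^-1 *: \row_l (partial i (fun y => g c y j l) (c p)
     + partial j (fun y => g c y i l) (c p) - partial l (fun y => g c y i j) (c p)).
Proof.
set T := \row_l _.
have -> : christoffel g c (c p) i j = 2^-1 *: (T *m invmx (g c (c p))).
  apply/rowP => k; rewrite !mxE; congr (_ * _); apply: eq_bigr => l _.
  rewrite mulrC mxE; congr (_ * _).
  have := congr1 (fun A : 'M[R]_n.+1 => A k l) (trmx_inv (g c (c p))).
  by rewrite gram_sym mxE.
by rewrite -scalemxAl mulmxKV// gram_unit.
Qed.

Lemma christoffel_form_dot v w z :
  (christoffel_form g c (c p) v w *m g c (c p) *m z^T) 0 0 =
  2^-1 * koszul c (c p) v w z.
Proof.
have -> : koszul c (c p) v w z = \sum_i \sum_j \sum_l v 0 i * w 0 j * z 0 l *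
      partial i (fun y => g c y j l) (c p) +
    \sum_i \sum_j \sum_l w 0 i * v 0 j * z 0 l * partial i (fun y => g c y j l) (c p) -
    \sum_i \sum_j \sum_l z 0 i * v 0 j * w 0 l * partial i (fun y => g c y j l) (c p).
  by rewrite /koszul !dgram_sum.
rewrite /christoffel_form !mulmx_suml summxE.
have -> : \sum_i \sum_j \sum_l w 0 i * v 0 j * z 0 l * partial i (fun y => g c y j l) (c p)
  = \sum_i \sum_j \sum_l v 0 i * w 0 j * z 0 l * partial j (fun y => g c y i l) (c p).
  rewrite exchange_big; apply: eq_bigr => i _; apply: eq_bigr => j _.
  by apply: eq_bigr => l _; rewrite [w 0 j * _]mulrC.
have -> : \sum_i \sum_j \sum_l z 0 i * v 0 j * w 0 l * partial i (fun y => g c y j l) (c p)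
  = \sum_i \sum_j \sum_l v 0 i * w 0 j * z 0 l * partial l (fun y => g c y i j) (c p).
  rewrite exchange_big; apply: eq_bigr => i _.
  rewrite exchange_big; apply: eq_bigr => j _.
  by apply: eq_bigr => l _; ring.
rewrite -big_split/= -sumrB mulr_sumr; apply: eq_bigr => i _.
rewrite !mulmx_suml summxE -big_split/= -sumrB mulr_sumr; apply: eq_bigr => j _.
rewrite -big_split/= -sumrB mulr_sumr.
rewrite -!scalemxAl christoffel_mul_gram -scalemxAl mxE mxE mxE.
rewrite !mulr_sumr; apply: eq_bigr => l _; rewrite !mxE.
by ring.
Qed.

Lemma dgram_tr v w z : dgram c (c p) v w z = dgram c (c p) v z w.
Proof.
rewrite !dgramE.
have -> : w *m 'D_v (g c) (c p) *m z^T = (z *m 'D_v (g c) (c p) *m w^T)^T.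
  by rewrite trmx_mul trmxK trmx_mul derive_gram_sym mulmxA.
by rewrite mxE.
Qed.

Lemma christoffel_form_sym v w :
  christoffel_form g c (c p) v w = christoffel_form g c (c p) w v.
Proof.
apply: (row_ext gram_unit) => z.
rewrite (christoffel_form_dot v w z) (christoffel_form_dot w v z) /koszul.
by rewrite (dgram_tr z w v) [X in _ * (X - _)]addrC.
Qed.

Lemma christoffel_form_metric v w z :
  (christoffel_form g c (c p) v w *m g c (c p) *m z^T) 0 0 +
  (christoffel_form g c (c p) v z *m g c (c p) *m w^T) 0 0 =
  dgram c (c p) v w z.
Proof.
rewrite (christoffel_form_dot v w z) (christoffel_form_dot v z w) /koszul.
rewrite (dgram_tr v z w) (dgram_tr w v z) (dgram_tr z v w).
by field.
Qed.

End OneChart.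

Lemma christoffel_formDl c x a v v' w : christoffel_form g c x (a *: v + v') w =
  a *: christoffel_form g c x v w + christoffel_form g c x v' w.
Proof.
rewrite /christoffel_form scaler_sumr -big_split/=; apply: eq_bigr => i _.
rewrite scaler_sumr -big_split/=; apply: eq_bigr => j _.
by rewrite !mxE scalerA -scalerDl; congr (_ *: _); ring.
Qed.

Lemma christoffel_formDr c x a v w w' : christoffel_form g c x v (a *: w + w') =
  a *: christoffel_form g c x v w + christoffel_form g c x v w'.
Proof.
rewrite /christoffel_form scaler_sumr -big_split/=; apply: eq_bigr => i _.
rewrite scaler_sumr -big_split/=; apply: eq_bigr => j _.
by rewrite !mxE scalerA -scalerDl; congr (_ *: _); ring.
Qed.

Section TwoCharts.
Variables (c d : chart R M n.+1) (p : M).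
Hypotheses (ac : atlas c) (ad : atlas d) (cp : chart_dom c p) (dp : chart_dom d p).

Let tau := transition c d.
Let J x := jacobian tau x.

Lemma transition_image : tau (c p) = d p.
Proof. by rewrite /tau /transition /= chart_mapK. Qed.

Lemma transition_analytic : vec_analytic_at tau (c p).
Proof. exact: atlas_analytic. Qed.

Lemma jacobian_unit : J (c p) \in unitmx.
Proof. by rewrite unitmxE unitfE gt_eqF// atlas_oriented. Qed.

Lemma transition_near : \forall x \near c p, differentiable tau x /\
  g c x = J x *m g d (tau x) *m (J x)^T.
Proof.
have [e e0 He] := vec_analytic_Ck transition_analytic.
have h1 : \forall x \near c p, ball (c p) e x by exact: nbhsx_ballx.
apply: filterS2 h1 (chart_near cp (chart_dom_open d) dp) => x xe [cq qE dq].
split; first exact: (Ckmx_diff (He 1%N)).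
have := gram_transition g ac ad cq dq.
by rewrite /= qE.
Qed.

(** The transformation law of the Christoffel symbols, obtained by
    differentiating that of the metric. *)
Lemma christoffel_transition v w :
  christoffel_form g c (c p) v w *m J (c p) =
  christoffel_form g d (d p) (v *m J (c p)) (w *m J (c p)) + w *m 'D_v J (c p).
Proof.
have dJ := jacobian_diff transition_analytic; have Ju := jacobian_unit.
have dtau : differentiable tau (c p) by have [] := nbhs_singleton transition_near.
have dgd : differentiable (g d) (tau (c p)).
  by rewrite transition_image; exact: gram_diff.
have dg : differentiable (fun x => g d (tau x)) (c p).
  exact: (differentiable_comp dtau dgd).
have gcE : g c (c p) = J (c p) *m g d (d p) *m (J (c p))^T.
  by have [_] := nbhs_singleton transition_near; rewrite transition_image.
have DG u : 'D_u (g c) (c p) = 'D_u J (c p) *m g d (d p) *m (J (c p))^T +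
   J (c p) *m 'D_(u *m J (c p)) (g d) (d p) *m (J (c p))^T +
   J (c p) *m g d (d p) *m ('D_u J (c p))^T.
  transitivity ('D_u (fun x => J x *m g d (tau x) *m (J x)^T) (c p)).
    by apply: near_eq_derive; apply: filterS transition_near => x [].
  rewrite derive_mulmx; [|exact: differentiable_mulmx|exact: differentiable_trmx].
  rewrite derive_mulmx// derive_trmx// mulmxDl transition_image.
  have -> : 'D_u (fun x => g d (tau x)) (c p) = 'D_(u *m J (c p)) (g d) (d p).
    by rewrite (derive_comp u dtau dgd) /J (mul_jacobian u dtau) transition_image.
  by [].
apply: (row_ext (gram_unit ad dp)) => z'.
pose z := z' *m invmx (J (c p)).
have -> : z' = z *m J (c p) by rewrite /z mulmxKV.
have [B BE] : exists B : 'rV[R]_n.+1 -> 'rV[R]_n.+1 -> R,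
    forall a b, (a *m g d (d p) *m b^T) 0 0 = B a b.
  by exists (fun a b => (a *m g d (d p) *m b^T) 0 0).
have [K KE] : exists K : 'rV[R]_n.+1 -> 'rV[R]_n.+1 -> 'rV[R]_n.+1 -> R,
    forall a u b, (a *m 'D_u (g d) (d p) *m b^T) 0 0 = K a u b.
  by exists (fun a u b => (a *m 'D_u (g d) (d p) *m b^T) 0 0).
have KK a u b : dgram d (d p) u a b = K a u b by rewrite dgramE.
have Bsym a b : B a b = B b a.
  rewrite -!BE; have -> : a *m g d (d p) *m b^T = (b *m g d (d p) *m a^T)^T.
    by rewrite trmx_mul trmxK trmx_mul (gram_sym ad dp) mulmxA.
  by rewrite mxE.
have -> : (christoffel_form g c (c p) v w *m J (c p) *m g d (d p) *m (z *m J (c p))^T) 0 0 =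
    2^-1 * koszul c (c p) v w z.
  by rewrite -christoffel_form_dot// gcE trmx_mul !mulmxA.
have [Q QE] : exists Q : 'rV[R]_n.+1 -> 'rV[R]_n.+1 -> 'rV[R]_n.+1,
    forall u a, Q u a = a *m 'D_u J (c p).
  by exists (fun u a => a *m 'D_u J (c p)).
have Qsym u a : Q u a = Q a u by rewrite !QE (derive_jacobian_sym u a transition_analytic).
have [j jE] : exists j : 'rV[R]_n.+1 -> 'rV[R]_n.+1, forall a, j a = a *m J (c p).
  by exists (fun a => a *m J (c p)).
have term u a b : dgram c (c p) u a b =
   B (Q u a) (j b) + B (j a) (Q u b) + K (j a) (j u) (j b).
  rewrite -!BE -KE !QE !jE dgramE DG !mulmxDr !mulmxDl [LHS]mxE [X in X + _]mxE.
  by rewrite !trmx_mul !mulmxA addrAC.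
rewrite mulmxDl mulmxDl [RHS]mxE christoffel_form_dot// BE -QE -!jE /koszul !term !KK.
rewrite (Qsym w v) (Qsym z v) (Qsym z w) (Bsym (j w) (Q v z)).
move: (B _ _) (B _ _) (B _ _) (K _ _ _) (K _ _ _) (K _ _ _) => x1 x2 x3 x4 x5 x6.
by field.
Qed.

End TwoCharts.
End Transition.
(** * Hypersurfaces in a chart *)

Section LinearMaps.
Context {R : realType} {m q : nat}.
Variables (f : 'rV[R]_m -> 'rV[R]_q).
Hypothesis fL : forall a v w, f (a *: v + w) = a *: f v + f w.

Lemma mul_lin1 v : v *m lin1_mx f = f v.
Proof.
pose L : {linear 'rV[R]_m -> 'rV[R]_q} :=
  HB.pack f (GRing.isLinear.Build _ _ _ _ f fL).
exact: (mul_rV_lin1 L).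
Qed.

Lemma linear_expand v : f v = \sum_i v 0 i *: f (delta_mx 0 i).
Proof.
rewrite -mul_lin1 {1}(row_sum_delta v) mulmx_suml; apply: eq_bigr => i _.
by rewrite -scalemxAl mul_lin1.
Qed.

End LinearMaps.

Section FrameDeterminant.
Context {F : fieldType} {n : nat}.
Variables (V : 'M[F]_(n, n.+1)) (e : 'rV[F]_n.+1) (G : 'M[F]_n.+1).
Hypotheses (Gunit : G \in unitmx) (Punit : frame V e \in unitmx).

(** Replacing e by w multiplies the frame by a triangular matrix whose only
    diagonal entry other than 1 is the e-component of w, which the conormal
    reads off. *)
Lemma det_frame w : \det (frame V w) =
  (conormal V e G *m G *m w^T) 0 0 * \det (frame V e).
Proof.
pose v := w *m invmx (frame V e).
have wE : w = v *m frame V e by rewrite /v mulmxKV.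
pose L : 'M[F]_n.+1 := \matrix_k (if unlift ord_max k is Some i then delta_mx 0 k else v).
have LE : frame V w = L *m frame V e.
  apply/row_matrixP => k; rewrite row_mul; case: (unliftP ord_max k) => [i ->|->].
    by rewrite frame_lift rowK liftK -rowE frame_lift.
  by rewrite frame_max rowK unlift_none -wE.
rewrite LE det_mulmx; congr (_ * _).
have tL : is_trig_mx L.
  apply/is_trig_mxP => i j ij; rewrite mxE; case: (unliftP ord_max i) => [k ik|im].
    by rewrite mxE eqxx/= -val_eqE gtn_eqF.
  by move: ij; rewrite im ltnNge -ltnS ltn_ord.
rewrite det_trig// (bigD1_ord ord_max)//= big1 => [|i _]; last first.
  by rewrite mxE liftK mxE !eqxx.
rewrite mulr1 mxE unlift_none wE mul_frame.
have := conormal_orth Gunit Punit; have := conormal_dual Gunit Punit.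
set N := conormal V e G => Ne NV.
rewrite raddfD/= mulmxDr !trmx_mul !mulmxA NV mul0mx add0r.
by rewrite [RHS]mxE big_ord1 Ne mul1r [RHS]mxE [RHS]mxE.
Qed.

End FrameDeterminant.

Lemma dot_rows {F : pzRingType} {m p q : nat} (A : 'M[F]_(m, q)) (G : 'M[F]_q)
    (B : 'M[F]_(p, q)) i j :
  (row i A *m G *m (row j B)^T) 0 0 = (A *m G *m B^T) i j.
Proof.
rewrite -row_mul [LHS]mxE [RHS]mxE; apply: eq_bigr => k _.
by rewrite [row _ _ _ _]mxE [(row _ _)^T _ _]mxE [row _ _ _ _]mxE [B^T _ _]mxE.
Qed.

Section Hypersurface.
Context {R : realType} {n : nat} {M : orientedManifold R n.+1}.
Variables (g : lorentzMetric M) (F : 'rV[R]_n -> M).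
Implicit Types (c d : chart R M n.+1) (u : 'rV[R]_n).

Definition jac c u : 'M[R]_(n, n.+1) := jacobian (c \o F) u.

Lemma tangentE c i u : tangent F c i u = row i (jac c u).
Proof. by rewrite rowE /jac /jacobian mul_rV_lin1. Qed.

Lemma first_formE c u :
  first_form g F c u = jac c u *m g c (c (F u)) *m (jac c u)^T.
Proof.
apply/matrixP => i j; rewrite mxE /gdot !tangentE.
exact: dot_rows.
Qed.

Lemma tangent_frameE c u w :
  \matrix_k tangent_frame F c u w k = frame (jac c u) w.
Proof.
apply/row_matrixP => k; rewrite rowK rowK /tangent_frame.
by case: (unlift ord_max k) => // i; rewrite tangentE.
Qed.

Section AtPoint.
Variables (c : chart R M n.+1) (u : 'rV[R]_n).
Hypotheses (ac : atlas c) (cu : chart_dom c (F u)).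

Let G := g c (c (F u)).

Lemma normal_unique v : (forall w, gdot g c (c (F u)) v w =
    volume_form g c (c (F u)) (tangent_frame F c u w)) -> normal g F c u = v.
Proof.
move=> Hv.
pose P := [set v' | forall w, gdot g c (c (F u)) v' w =
    volume_form g c (c (F u)) (tangent_frame F c u w)].
have Hn : P (normal g F c u) by exact: (@getPex _ P (ex_intro P v Hv)).
apply: (row_ext (gram_unit g ac cu)) => z.
by rewrite -/(gdot _ _ _ _ _) Hn -Hv.
Qed.

Lemma normalE e : frame (jac c u) e \in unitmx -> normal g F c u =
  (Num.sqrt `|\det G| * \det (frame (jac c u) e)) *: conormal (jac c u) e G.
Proof.
move=> Pu; apply: normal_unique => w; rewrite /gdot /volume_form tangent_frameE.
rewrite (det_frame (gram_unit g ac cu) Pu w) -!scalemxAl mxE -/G.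
by rewrite -mulrA [\det _ * _]mulrC.
Qed.

Lemma normal_volume e w : frame (jac c u) e \in unitmx ->
  gdot g c (c (F u)) (normal g F c u) w =
  volume_form g c (c (F u)) (tangent_frame F c u w).
Proof.
move=> Pu; rewrite (normalE Pu) /gdot /volume_form tangent_frameE.
rewrite (det_frame (gram_unit g ac cu) Pu w) -!scalemxAl mxE -/G.
by rewrite -mulrA [\det _ * _]mulrC.
Qed.

End AtPoint.

(** A nonzero vector orthogonal to the rows of V, for the Euclidean product of
    components, is not a combination of them. *)
Lemma transversal_exists (V : 'M[R]_(n, n.+1)) : \rank V = n ->
  exists e, frame V e \in unitmx.
Proof.
move=> rV.
have [z z0 zV] : exists2 z : 'rV[R]_n.+1, z != 0 & z *m V^T = 0.
  have : kermx V^T != 0.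
    by rewrite -mxrank_eq0 mxrank_ker mxrank_tr rV subSnn.
  case/rowV0Pn => z /sub_kermxP zV z0; by exists z.
exists z; rewrite -row_free_unit -kermx_eq0; apply/eqP/row_matrixP => i.
rewrite row0; set v := row i _.
have vP : v *m frame V z = 0 by rewrite /v -row_mul mulmx_ker row0.
move: vP; rewrite mul_frame.
set a := colsub _ v; set b := col _ v => vP.
have zz : (z *m z^T) 0 0 != 0.
  apply/eqP => zz; move/eqP: z0; apply; apply/rowP => j; rewrite mxE.
  have nn k : true -> 0 <= z 0 k * z^T k 0 by move=> _; rewrite mxE -expr2 sqr_ge0.
  move: zz; rewrite mxE => /(psumr_eq0P nn) /(_ j isT) /eqP.
  by rewrite mxE mulf_eq0 orbb => /eqP.
have b0 : b 0 0 = 0.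
  have := congr1 (mulmx^~ z^T) vP; rewrite mulmxDl mul0mx -mulmxA.
  have -> : V *m z^T = 0 by apply: trmx_inj; rewrite trmx_mul trmxK zV trmx0.
  rewrite mulmx0 add0r -mulmxA => /(congr1 (fun A : 'M[R]_1 => A 0 0)).
  rewrite [LHS]mxE big_ord1 [RHS]mxE => /eqP.
  by rewrite mulf_eq0 (negPf zz) orbF => /eqP.
have a0 : a = 0.
  have bz : b = 0 by apply/matrixP => x y; rewrite !ord1 b0 mxE.
  move: vP; rewrite bz mul0mx addr0 => aV.
  have Vf : row_free V by rewrite /row_free rV.
  by apply/eqP; rewrite -(mulmx_free_eq0 _ Vf) aV.
apply/rowP => k; rewrite [RHS]mxE; case: (unliftP ord_max k) => [j ->|->].
  by have := congr1 (fun r : 'rV[R]_n => r 0 j) a0; rewrite !mxE.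
by move: b0; rewrite mxE.
Qed.

Section ChangeOfChart.
Variables (c d : chart R M n.+1) (u : 'rV[R]_n).
Hypotheses (ac : atlas c) (ad : atlas d) (cu : chart_dom c (F u))
  (du : chart_dom d (F u)) (cF : {for u, continuous F})
  (anX : vec_analytic_at (c \o F) u) (rX : \rank (jac c u) = n).

Let tau := transition c d.
Let J := jacobian tau (c (F u)).

Lemma chart_dom_near (c' : chart R M n.+1) : chart_dom c' (F u) ->
  \forall y \near u, chart_dom c' (F y).
Proof.
move=> cu'; have h : nbhs (F u) (chart_dom c').
  by apply: open_nbhs_nbhs; split=> //; exact: chart_dom_open.
exact: (cF h).
Qed.

Lemma change_near : \forall y \near u, (d \o F) y = tau ((c \o F) y) /\
  jac d y = jac c y *m jacobian tau (c (F y)).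
Proof.
have h0 : \forall y \near u, (d \o F) y = tau ((c \o F) y).
  by apply: filterS (chart_dom_near cu) => y cy; rewrite /tau /transition/= chart_mapK.
have hd : \forall y \near u, differentiable tau (c (F y)).
  have cX : {for u, continuous (c \o F)}.
    apply: differentiable_continuous; exact: nbhs_singleton (vec_analytic_near_diff anX).
  exact: (cX _ (vec_analytic_near_diff (transition_analytic ac ad cu du))).
have hX := vec_analytic_near_diff anX.
have h0' : \forall y \near u, \forall x \near y, (d \o F) x = tau ((c \o F) x).
  exact: nbhs_interior h0.
apply: filterS3 (filterI h0 h0') hd hX => y [yE nyE] dt dX; split=> //.
apply/row_matrixP => i; rewrite !rowE mulmxA.
have dcomp : differentiable (tau \o (c \o F)) y by exact: differentiable_comp dX dt.
have [dY _] := near_eq_diff (filterS (fun x => @esym _ _ _) nyE) dcomp.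
apply: (etrans (mul_jacobian (delta_mx 0 i) dY)).
apply: (etrans _ (congr1 (mulmx^~ (jacobian tau (c (F y))))
  (esym (mul_jacobian (delta_mx 0 i) dX)))).
apply: (etrans _ (esym (mul_jacobian _ dt))).
apply: (etrans _ (derive_comp (delta_mx 0 i) dX dt)).
exact: near_eq_derive nyE.
Qed.

Lemma jac_change : jac d u = jac c u *m J.
Proof. by have [] := nbhs_singleton change_near. Qed.

Lemma first_form_change : first_form g F d u = first_form g F c u.
Proof.
rewrite !first_formE jac_change (gram_transition g ac ad cu du) trmx_mul.
by rewrite -/J !mulmxA.
Qed.

Lemma cov_derivative_change i j :
  cov_derivative g F d i j u = cov_derivative g F c i j u *m J.
Proof.
have dX : differentiable (c \o F) u by exact: nbhs_singleton (vec_analytic_near_diff anX).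
have dJX := jacobian_diff anX.
have atau := transition_analytic ac ad cu du.
have dJt := jacobian_diff atau.
have dTc : differentiable (tangent F c j) u.
  rewrite (_ : tangent F c j = fun y => delta_mx 0 j *m jac c y); last first.
    by apply/funext => y; rewrite tangentE rowE.
  by apply: differentiable_mulmx => //; exact: differentiable_cst.
have dJy : differentiable (fun y => jacobian tau (c (F y))) u.
  exact: (differentiable_comp dX dJt).
have T k : tangent F d k u = tangent F c k u *m J.
  by rewrite !tangentE jac_change row_mul.
have D1 : 'D_(delta_mx 0 i) (fun y => jacobian tau (c (F y))) u =
    'D_(tangent F c i u) (jacobian tau) (c (F u)).
  apply: (etrans (derive_comp (delta_mx 0 i) dX dJt)).
  congr ('D_ _ _ _); apply: (etrans (esym (mul_jacobian (delta_mx 0 i) dX))).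
  by rewrite -rowE -tangentE.
have E1 : 'D_(delta_mx 0 i) (tangent F d j) u =
    'D_(delta_mx 0 i) (tangent F c j) u *m J +
    tangent F c j u *m 'D_(tangent F c i u) (jacobian tau) (c (F u)).
  transitivity ('D_(delta_mx 0 i) (fun y => tangent F c j y *m jacobian tau (c (F y))) u).
    apply: near_eq_derive; apply: filterS change_near => y [_ yE].
    by rewrite !tangentE yE row_mul.
  apply: (etrans (derive_mulmx (delta_mx 0 i) dTc dJy)).
  exact: (congr2 (fun x y => x + tangent F c j u *m y) (erefl _) D1).
have E2 := christoffel_transition g ac ad cu du (tangent F c i u) (tangent F c j u).
apply: (etrans (congr2 +%R E1 (congr2 (christoffel_form g d (d (F u))) (T i) (T j)))).
apply: (etrans _ (esym (mulmxDl _ _ _))).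
apply: (etrans _ (congr1 (fun x =>
  'D_(delta_mx 0 i) (tangent F c j) u *m J + x) (esym E2))).
by rewrite -addrA; congr (_ + _); exact: addrC.
Qed.

(** The defining equation of the normal is invariant: the determinants of the two
    Gram matrices differ by the square of the determinant of J, which is positive
    because the charts are positively oriented. *)
Lemma normal_change : normal g F d u = normal g F c u *m J.
Proof.
have [e eP] := transversal_exists rX.
have Ju : J \in unitmx by exact: jacobian_unit.
apply: (normal_unique ad du) => w'.
have [w ->] : exists w, w' = w *m J by exists (w' *m invmx J); rewrite mulmxKV.
have := normal_volume ac cu w eP; rewrite /gdot /volume_form !tangent_frameE.
rewrite (gram_transition g ac ad cu du) -/tau -/J trmx_mul !mulmxA => ->.
have fE : frame (jac d u) (w *m J) = frame (jac c u) w *m J.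
  apply/row_matrixP => k; rewrite row_mul; case: (unliftP ord_max k) => [a ->|->].
    by rewrite !frame_lift jac_change row_mul.
  by rewrite !frame_max.
apply: (etrans _ (congr1 (fun A => _ * \det A) (esym fE))).
rewrite !det_mulmx det_tr.
have J0 : 0 < \det J by exact: atlas_oriented.
have -> : \det J * \det (g d (d (F u))) * \det J =
    (\det J) ^+ 2 * \det (g d (d (F u))) by ring.
rewrite normrM sqrtrM ?normr_ge0// (ger0_norm (sqr_ge0 (\det J))) sqrtr_sqr (gtr0_norm J0).
by ring.
Qed.

Lemma second_form_change : second_form g F d u = second_form g F c u.
Proof.
apply/matrixP => i j; rewrite [LHS]mxE [RHS]mxE.
apply: (etrans (congr2 (gdot g d (d (F u))) (cov_derivative_change i j) normal_change)).
rewrite /gdot (gram_transition g ac ad cu du) -/tau -/J trmx_mul.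
by rewrite !mulmxA.
Qed.

End ChangeOfChart.
End Hypersurface.
(** * The light-like geodesic *)

Section Assembly.
Context {R : realType} {n : nat} {M : orientedManifold R n.+1}.
Variables (g : lorentzMetric M) (U : set 'rV[R]_n) (F : 'rV[R]_n -> M).
Hypotheses (U_open : open U) (F_immersion : analytic_immersion F U).

Lemma chart_atP (p : M) : atlas (chart_at p) /\ chart_dom (chart_at p) p.
Proof. by rewrite /chart_at; case: cid2. Qed.

Lemma christoffel_Ck (c : chart R M n.+1) (p : M) : atlas c -> chart_dom c p ->
  exists Z, [/\ open Z, Z (c p), forall k, Ckmx k Z (g c)
    & forall k i j, Ckmx k Z (fun x => christoffel g c x i j)].
Proof.
move=> ac cp; have [e e0 He] := gram_Ck g ac cp.
have [e1 e10 He1] := near_closed_ball (chart_image_near cp).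
pose r := Num.min e e1; have r0 : 0 < r by rewrite lt_min e0.
pose Z : set 'rV[R]_n.+1 := ball (c p) r.
have oZ : open Z by exact: ball_open.
have sG k : Ckmx k Z (g c).
  by apply: Ckmx_subset (He k) => y; apply: le_ball; rewrite /r ge_min lexx.
have uG x : Z x -> g c x \in unitmx.
  move=> Zx; have [q dq <-] : (c @` chart_dom c) x.
    apply: He1; move: Zx; rewrite /Z -ball_normE/= distrC => /ltW /le_trans; apply.
    by rewrite /r ge_min lexx orbT.
  exact: gram_unit.
exists Z; split=> // [|k i j]; first exact: ballxx.
have sI l : Ckmx l Z (fun x => invmx (g c x)) by apply: Ckmx_inv.
have sP a b l : Ck k Z (partial a (fun y => g c y b l)).
  exact: Ck_partial (sG k.+1 b l).
move=> a b.
apply: (Ck_eq (f := fun x => 2^-1 * \sum_l invmx (g c x) b l *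
    (partial i (fun y => g c y j l) x + partial j (fun y => g c y i l) x
     + - partial l (fun y => g c y i j) x))) => //.
  by move=> x _; rewrite [RHS]mxE.
apply: Ck_mul => //; first exact: Ck_cst.
apply: Ck_sum => // l _; apply: Ck_mul => //; first exact: sI.
apply: Ck_add => //; first exact: Ck_add.
exact: Ck_opp.
Qed.

(** The Christoffel symbols contracted with the tangent vector of components v. *)
Definition connection (c : chart R M n.+1) (v u : 'rV[R]_n) : 'M[R]_n.+1 :=
  lin1_mx (christoffel_form g c (c (F u)) (v *m jac F c u)).

Lemma mul_connection c v u y :
  y *m connection c v u = christoffel_form g c (c (F u)) (v *m jac F c u) y.
Proof. by rewrite mul_lin1// => a w w'; exact: christoffel_formDr. Qed.

Lemma connection_sum c v u :
  connection c v u = \sum_i v 0 i *: connection c (delta_mx 0 i) u.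
Proof.
apply/row_matrixP => b; rewrite !rowE mul_connection mulmx_sumr.
set y := delta_mx 0 b.
pose f (v : 'rV[R]_n) := christoffel_form g c (c (F u)) (v *m jac F c u) y.
have fL a w w' : f (a *: w + w') = a *: f w + f w'.
  by rewrite /f mulmxDl -scalemxAl christoffel_formDl.
rewrite -/(f v) (linear_expand fL v); apply: eq_bigr => i _.
by rewrite -scalemxAr mul_connection.
Qed.

Section InChart.
Variables (c : chart R M n.+1) (o : 'rV[R]_n).
Hypotheses (ac : atlas c) (co : chart_dom c (F o)) (Uo : U o).

Lemma local_setup : exists W e,
  [/\ [/\ open W, W o, W `<=` U & forall u, W u -> chart_dom c (F u)],
     smooth W (jac F c), smooth W (fun u => g c (c (F u))),
     forall i, smooth W (connection c (delta_mx 0 i)) &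
     forall u, W u -> frame (jac F c u) e \in unitmx].
Proof.
have [cF imm] := F_immersion Uo; have [anX rX] := imm c ac co.
have [Z [oZ Zo sG sC]] := christoffel_Ck ac co.
have [e eP] := transversal_exists rX.
have [r r0 sX] := vec_analytic_Ck anX.
have cX : {for o, continuous (c \o F)}.
  by apply: differentiable_continuous; exact: nbhs_singleton (vec_analytic_near_diff anX).
have oB : open (ball o r) by exact: ball_open.
have sJ k : Ckmx k (ball o r) (jac F c) by exact: jacobian_Ck (sX k.+1).
have sP : smooth (ball o r) (fun u => frame (jac F c u) e) by exact: smooth_frame.
have cdet : {for o, continuous (fun u => \det (frame (jac F c u) e))}.
  apply: differentiable_continuous.
  by apply: (Ck_diff (Ck_det oB (sP 1%N))); exact: ballxx.
have h1 : \forall u \near o, U u by exact: open_nbhs_nbhs.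
have h2 : \forall u \near o, chart_dom c (F u) by exact: chart_dom_near.
have h3 : \forall u \near o, Z (c (F u)).
  have hZ : nbhs (c (F o)) Z by exact: open_nbhs_nbhs.
  exact: (cX _ hZ).
have h4 : \forall u \near o, \det (frame (jac F c u) e) != 0.
  have d0 : \det (frame (jac F c o) e) != 0 by rewrite -unitfE -unitmxE.
  have hd : nbhs (\det (frame (jac F c o) e)) [set x : R | x != 0].
    by apply: open_nbhs_nbhs; split=> //; exact: open_neq.
  exact: (cdet _ hd).
have h5 : \forall u \near o, ball o r u by exact: nbhsx_ballx.
have [r' r'0 Hr'] := near_closed_ball (filterI h1 (filterI h2 (filterI h3 (filterI h4 h5)))).
pose W := ball o r'.
have W' u : W u -> U u /\ chart_dom c (F u) /\ Z (c (F u)) /\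
    \det (frame (jac F c u) e) != 0 /\ ball o r u.
  move=> Wu; suff /Hr' : `|u - o| <= r' by [].
  by move: Wu; rewrite /W -ball_normE/= distrC => /ltW.
have oW : open W by exact: ball_open.
have WB : W `<=` ball o r by move=> u /W'[_ [_ [_ []]]].
have sJW k : Ckmx k W (jac F c) by exact: Ckmx_subset WB (sJ k).
have sXW k : Ckmx k W (c \o F) by exact: Ckmx_subset WB (sX k).
have WZ u : W u -> Z ((c \o F) u) by move=> /W'[_ [_ []]].
exists W, e; split.
- split; [exact: oW|exact: ballxx|by move=> u /W'[]|by move=> u /W'[_ []]].
- exact: sJW.
- by move=> k i j; exact: (Ck_comp oW WZ (sG k i j) (sXW k)).
- move=> i k a b.
  apply: (Ck_eq (f := fun u => \sum_i' \sum_j'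
    ((jac F c u i i' * (delta_mx 0 a : 'rV[R]_n.+1) 0 j') *
      christoffel g c ((c \o F) u) i' j' 0 b))) => //.
    move=> u _; rewrite -[RHS](delta_mulE (connection c _ u)) mul_connection.
    rewrite /christoffel_form summxE; apply: eq_bigr => i' _.
    rewrite summxE; apply: eq_bigr => j' _; rewrite [RHS]mxE; congr (_ * _ * _).
    by rewrite delta_mulE.
  apply: Ck_sum => // i' _; apply: Ck_sum => // j' _; apply: Ck_mul => //.
    apply: Ck_mul => //; first exact: sJW.
    exact: Ck_cst.
  exact: (Ck_comp oW WZ (sC k i' j' 0 b) (sXW k)).
- by move=> u /W'[_ [_ [_ [d0 _]]]]; rewrite unitmxE unitfE.
Qed.

Section Local.
Variables (W : set 'rV[R]_n) (e : 'rV[R]_n.+1).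
Hypotheses (oW : open W) (WU : W `<=` U)
  (Wc : forall u, W u -> chart_dom c (F u))
  (sV : smooth W (jac F c)) (sG : smooth W (fun u => g c (c (F u))))
  (sTh : forall i, smooth W (connection c (delta_mx 0 i)))
  (Punit : forall u, W u -> frame (jac F c u) e \in unitmx).

Let V := jac F c.
Let G u := g c (c (F u)).
Let Th := connection c.

Lemma local_analytic u : W u -> vec_analytic_at (c \o F) u.
Proof. by move=> Wu; have [_ /(_ c ac (Wc Wu))[]] := F_immersion (WU Wu). Qed.

Lemma local_diff u : W u -> differentiable (c \o F) u.
Proof. by move=> Wu; exact: nbhs_singleton (vec_analytic_near_diff (local_analytic Wu)). Qed.

Lemma local_sym u : W u -> (G u)^T = G u.
Proof. by move=> Wu; exact: gram_sym ac (Wc Wu). Qed.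

Lemma local_unit u : W u -> G u \in unitmx.
Proof. by move=> Wu; exact: gram_unit ac (Wc Wu). Qed.

Lemma local_compat v u : W u ->
  'D_v G u = Th v u *m G u + (Th v u *m G u)^T.
Proof.
move=> Wu; have cu := Wc Wu; have dX := local_diff Wu.
have dg := gram_diff g ac cu.
have E : 'D_v G u = 'D_(v *m V u) (g c) (c (F u)).
  apply: (etrans (derive_comp v dX dg)).
  by rewrite /V /jac (mul_jacobian v dX).
have ent (A : 'M[R]_n.+1) a b : A a b = ((delta_mx 0 a : 'rV_n.+1) *m A *m
    (delta_mx 0 b : 'rV_n.+1)^T) 0 0.
  by rewrite -rowE trmx_delta -colE !mxE.
rewrite E; apply/matrixP => a b; rewrite [LHS]ent -dgramE.
rewrite -(christoffel_form_metric g ac cu) -!mul_connection -/Th -/(G u).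
rewrite [RHS]mxE [X in _ = _ + X]mxE [X in _ = X + _]ent [X in _ = _ + X]ent.
by rewrite !mulmxA.
Qed.

Lemma local_torsion_free v w u : W u -> w *m cov Th v V u = v *m cov Th w V u.
Proof.
move=> Wu; apply: (etrans (mulmxDr _ _ _)); apply: (etrans _ (esym (mulmxDr _ _ _))).
apply: (congr2 +%R (derive_jacobian_sym v w (local_analytic Wu))).
rewrite mulmxA [RHS]mulmxA !mul_connection.
exact: christoffel_form_sym ac (Wc Wu) _ _.
Qed.

Let Bt := beta V G e.
Let Mt := mean_trace V G Th e.
Let gram_det u := \det (frame (V u) e *m G u *m (frame (V u) e)^T).

Lemma gram_detE u : gram_det u = \det (frame (V u) e) ^+ 2 * \det (G u).
Proof. by rewrite /gram_det !det_mulmx det_tr; ring. Qed.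

Lemma BF_local u : W u -> BF g F u = - Bt u * gram_det u.
Proof.
move=> Wu; have [cF imm] := F_immersion (WU Wu).
have [ad du] := chart_atP (F u); have [anX rX] := imm c ac (Wc Wu).
rewrite /BF (first_form_change g ac ad (Wc Wu) du cF anX) first_formE.
exact: det_first_form (local_unit Wu) (Punit Wu).
Qed.

Lemma second_form_local u i j : W u -> second_form g F c u i j =
  (Num.sqrt `|\det (G u)| * \det (frame (V u) e)) *
  sff V G Th e (delta_mx 0 i) (delta_mx 0 j) u.
Proof.
move=> Wu; rewrite mxE /gdot (normalE g ac (Wc Wu) (Punit Wu)).
rewrite linearZ/= -scalemxAr mxE; congr (_ * _).
rewrite /sff; congr ((_ *m _ *m _) 0 0).
apply: (etrans _ (esym (mulmxDr _ _ _))); congr (_ + _).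
  have dV := smooth_diff sV Wu.
  have -> : tangent F c j = fun y => (delta_mx 0 j : 'rV_n) *m V y.
    by apply/funext => y; rewrite tangentE rowE.
  rewrite (derive_mulmx (delta_mx 0 i) (differentiable_cst _ _) dV).
  rewrite (_ : 'D_(delta_mx 0 i) (fun=> delta_mx 0 j) u = 0) ?mul0mx ?add0r//.
  exact: derive_cst.
by rewrite mulmxA mul_connection !tangentE -!rowE.
Qed.

(** Up to factors that do not vanish, [Mt] is A: this is where the cofactor matrix
    is replaced by [adjugate_like], which is smooth through the light-like points. *)
Lemma AF_local u : W u -> Bt u != 0 -> AF g F u =
  - (Num.sqrt `|\det (G u)| * \det (frame (V u) e)) * gram_det u * Mt u.
Proof.
move=> Wu b0; have [cF imm] := F_immersion (WU Wu).
have [ad du] := chart_atP (F u); have [anX rX] := imm c ac (Wc Wu).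
have Gu := local_unit Wu; have Pu := Punit Wu.
rewrite /AF (first_form_change g ac ad (Wc Wu) du cF anX).
rewrite (second_form_change g ac ad (Wc Wu) du cF anX rX).
have S0 : \det (first_form g F c u) != 0.
  rewrite first_formE (det_first_form Gu Pu); apply: mulf_neq0.
    by rewrite oppr_eq0; exact: b0.
  by rewrite -unitfE -unitmxE gram_frame_unit.
have adjE i j : cofactor (first_form g F c u) i j =
    - gram_det u * adjugate_like (V u) e (G u) i j.
  have -> : cofactor (first_form g F c u) i j = (\adj (first_form g F c u)) j i.
    by rewrite [RHS]mxE.
  move: S0; rewrite first_formE => S0.
  rewrite (adjugate_first_form (local_sym Wu) Gu Pu S0) mxE; congr (_ * _).
  by rewrite -[in LHS](adjugate_like_sym (V u) e (local_sym Wu)) mxE.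
rewrite /Mt /mean_trace mulr_sumr; apply: eq_bigr => i _.
rewrite mulr_sumr; apply: eq_bigr => j _.
rewrite adjE second_form_local//; by ring.
Qed.

Section MeanCurvature.
Variable H : 'rV[R]_n -> R.
Hypotheses (n_gt0 : (0 < n)%N)
  (H_extends : forall u, (U `\` light_like_points g F U) u -> H u = HF g F u).

(** The defining relation A = n H |B| ^ (3 / 2), squared and freed of the
    factors that do not vanish. *)
Lemma mean_trace_sqr u : W u -> Bt u != 0 ->
  Mt u ^+ 2 = (n%:R * H u) ^+ 2 * `|Bt u| ^+ 3.
Proof.
move=> Wu b0; have Gu := local_unit Wu; have Pu := Punit Wu.
have d0 : \det (G u) != 0 by rewrite -unitfE -unitmxE.
have w0 : \det (frame (V u) e) != 0 by rewrite -unitfE -unitmxE.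
have BE := BF_local Wu.
have gd0 : gram_det u != 0 by rewrite gram_detE mulf_neq0// expf_neq0.
have B0 : BF g F u != 0 by rewrite BE mulf_neq0// oppr_eq0.
have HE : H u = HF g F u.
  apply: H_extends; split; first exact: WU.
  by move=> [_ /eqP]; rewrite (negPf B0).
have Bp : 0 < `|BF g F u| by rewrite normr_gt0.
have p2 : (`|BF g F u| `^ (3 / 2)) ^+ 2 = `|BF g F u| ^+ 3.
  rewrite -powR_mulrn ?powR_ge0// -powRrM (_ : 3 / 2 * 2%:R = 3%:R); last by field.
  by rewrite powR_mulrn.
have p0 : `|BF g F u| `^ (3 / 2) != 0 by rewrite gt_eqF// powR_gt0.
have n0 : n%:R != 0 :> R by rewrite pnatr_eq0 -lt0n.
have AE : AF g F u = n%:R * H u * `|BF g F u| `^ (3 / 2).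
  by rewrite HE /HF; field; rewrite p0.
have E : AF g F u ^+ 2 = (n%:R * H u) ^+ 2 * (`|Bt u| ^+ 3 * `|gram_det u| ^+ 3).
  by rewrite AE exprMn p2 BE normrM normrN [in LHS](exprMn _ `|Bt u|).
have sq : (- (Num.sqrt `|\det (G u)| * \det (frame (V u) e)) * gram_det u) ^+ 2 =
    `|gram_det u| ^+ 3.
  rewrite exprMn sqrrN exprMn sqr_sqrtr// gram_detE.
  have -> : `|\det (frame (V u) e) ^+ 2 * \det (G u)| =
     \det (frame (V u) e) ^+ 2 * `|\det (G u)|.
    by rewrite normrM ger0_norm// sqr_ge0.
  have -> : (\det (frame (V u) e) ^+ 2 * \det (G u)) ^+ 2 =
     \det (frame (V u) e) ^+ 2 ^+ 2 * `|\det (G u)| ^+ 2.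
    by rewrite exprMn real_normK// num_real.
  by ring.
have gd3 : `|gram_det u| ^+ 3 != 0 by rewrite expf_neq0// normr_eq0.
apply: (mulfI gd3); rewrite -[in LHS]sq -exprMn -(AF_local Wu b0) E.
by rewrite mulrA mulrC.
Qed.

Hypothesis H_bounded : log_abs_bounded U H.

Lemma H_bounds : exists m L, 0 < m /\ forall u, U u -> m <= H u ^+ 2 <= L.
Proof.
have [K HK] := H_bounded.
exists (expR (- K) ^+ 2), (expR K ^+ 2); split; first by rewrite exprn_gt0// expR_gt0.
move=> u Uu; have := HK u Uu.
have [h0|h0] := leP `|H u| 0; first by rewrite le0_lneNy ?lee_fin.
rewrite lne_EFin// lee_fin ler_norml => /andP[h1 h2].
rewrite -[H u ^+ 2]real_normK ?num_real//.
have e1 : expR (- K) <= `|H u| by rewrite -[leRHS]lnK ?posrE// ler_expR.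
have e2 : `|H u| <= expR K by rewrite -[leLHS]lnK ?posrE// ler_expR.
by apply/andP; split; apply: lerXn2r; rewrite ?nnegrE ?expR_ge0.
Qed.

Let sB : smooth_fun W Bt := smooth_beta oW sV sG local_unit Punit.
Let sM : smooth_fun W Mt :=
  smooth_mean_trace oW sV sG sTh local_unit Punit.

(** At a light-like point the conormal length vanishes to second order:
    otherwise, along a transversal line, [Mt] would vanish to order 3/2. *)
Lemma dbeta0 u v : W u -> Bt u = 0 -> 'D_v Bt u = 0.
Proof.
move=> Wu b0; have [m [L [m0 HL]]] := H_bounds.
pose l (t : R) := u + t *: v.
have near_l : \forall t \near (0 : R), W (l t).
  have cl : {for (0 : R), continuous l}.
    apply: differentiable_continuous; apply: differentiableD; first exact: differentiable_cst.
    by apply: differentiableZl.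
  have nW : nbhs (l 0) W by rewrite /l scale0r addr0; exact: open_nbhs_nbhs.
  exact: (cl _ nW).
have l0 : l 0 = u by rewrite /l scale0r addr0.
have dM1 : differentiable (fun y => 'D_v Mt y) u.
  apply: (near_eq_diff (f := fun y => \sum_i v 0 i *: partial i Mt y) _ _).1.
    apply: near_open oW _ Wu => y Wy; rewrite derive_dirE//.
    exact: smooth_fun_diff sM Wy.
  apply: differentiable_sumf => i _; apply: differentiableZ.
  by apply: Ck_diff Wu; exact: Ck_partial (sM 2%N).
have n0 : 0 < n%:R ^+ 2 :> R by rewrite exprn_gt0// ltr0n.
apply: (@no_order_three_halves _ (fun t => Mt (l t)) (fun t => 'D_v Mt (l t))
  (fun t => Bt (l t)) ('D_v (fun y => 'D_v Mt y) u) _ (n%:R ^+ 2 * m) (n%:R ^+ 2 * L)).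
- by rewrite mulr_gt0.
- apply: filterS near_l => t Wt; apply: segment_derive.
  exact: smooth_fun_diff sM Wt.
- have := @segment_derive _ _ (fun y => 'D_v Mt y) u v 0.
  by rewrite -/(l 0) l0; apply.
- have := @segment_derive _ _ Bt u v 0.
  by rewrite -/(l 0) l0; apply; exact: smooth_fun_diff sB Wu.
- by rewrite l0.
- apply: filterS near_l => t Wt bt; rewrite (mean_trace_sqr Wt bt) exprMn.
  have /andP[h1 h2] := HL _ (WU Wt).
  by apply/andP; split; rewrite ler_wpM2r ?exprn_ge0// ler_wpM2l// ltW.
Qed.

(** Where [Bt] vanishes so does its derivative, and with it [Mt], by the
    differential equation for [Bt]; elsewhere [Mt] is of order 3/2 in [Bt]. *)
Lemma mean_trace_bound : W o ->
  exists C, \forall u \near o, `|Mt u| <= C * `|Bt u|.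
Proof.
move=> Wo; have [m [L [m0 HL]]] := H_bounds.
pose D := `|Bt o| + 1.
have nB : \forall u \near o, `|Bt u| <= D.
  apply: near_bounded; apply: differentiable_continuous.
  exact: smooth_fun_diff sB Wo.
have nW : \forall u \near o, W u by exact: open_nbhs_nbhs.
pose E := n%:R ^+ 2 * `|L| * D.
have E0 : 0 <= E by rewrite /E !mulr_ge0 ?exprn_ge0// addr_ge0.
exists (E + 1); apply: filterS2 nB nW => u bD Wu.
have [b0|b0] := eqVneq (Bt u) 0.
  have := derive_beta_xi oW sV sG (connection_sum c) local_sym local_unit Punit
    local_compat Wu.
  rewrite (dbeta0 _ Wu b0) -/Bt -/Mt b0 mul0r subr0 => /esym/eqP.
  by rewrite mulf_eq0 pnatr_eq0/= => /eqP ->; rewrite normr0 mulr0.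
have E1 : 0 <= E + 1 by rewrite addr_ge0.
rewrite -ler_sqr ?nnegrE ?mulr_ge0// real_normK ?num_real//.
rewrite (mean_trace_sqr Wu b0) !exprMn.
have /andP[_ h2] := HL _ (WU Wu).
apply: (@le_trans _ _ (E * `|Bt u| ^+ 2)).
  rewrite [`|Bt u| ^+ 3]exprSr mulrA mulrAC ler_wpM2r ?exprn_ge0//.
  rewrite /E; apply: ler_pM => //; first by rewrite mulr_ge0 ?sqr_ge0.
  by rewrite ler_wpM2l ?exprn_ge0// (le_trans h2)// ler_norm.
rewrite ler_wpM2r ?exprn_ge0// sqrrD1.
have : 0 <= E ^+ 2 by rewrite exprn_ge0.
by lra.
Qed.

End MeanCurvature.
End Local.
End InChart.

(** In any other chart the curve satisfies the geodesic equation because the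
    Christoffel symbols transform as they do. *)
Lemma null_curve_geodesic (c : chart R M n.+1) (z : R -> 'rV[R]_n) (d : R) :
  atlas c ->
  let Y (t : R) := 'D_1 z t *m jac F c (z t) in
  (forall t : R, `|t| < d ->
    [/\ [/\ U (z t), chart_dom c (F (z t)) & differentiable z t], differentiable Y t,
      'D_1 Y t + Y t *m connection c ('D_1 z t) (z t) = 0, Y t != 0 &
      (Y t *m g c (c (F (z t))) *m (Y t)^T) 0 0 = 0]) ->
  0 < d -> light_like_geodesic_segment g ((F \o z) @` [set t | `|t| < d]) (F (z 0)).
Proof.
move=> ac Y HY d0; pose I := [set t : R | `|t| < d].
have IE : I = [set t | t \in `]- d, d[].
  by apply/seteqP; split=> t; rewrite /I/= in_itv/= ltr_norml.
have oI : open I by rewrite IE; exact: interval_open.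
have near_I t : I t -> \forall s \near t, I s by move=> It; exact: open_nbhs_nbhs.
have vel t h : I t -> atlas h -> chart_dom h (F (z t)) ->
    let J y := jacobian (transition c h) (c (F y)) in
    \forall s \near t, derivable (h \o (F \o z)) s 1 /\
      velocity h (F \o z) s = Y s *m J (z s).
  move=> It ah ht J; have [[Ut ct dz] _ _ _ _] := HY t It.
  have [cF imm] := F_immersion Ut; have [anX _] := imm c ac ct.
  have [anh _] := imm h ah ht.
  have nz := differentiable_continuous dz.
  have n1 : \forall s \near t, jac F h (z s) = jac F c (z s) *m J (z s).
    have n0 : \forall y \near z t, jac F h y = jac F c y *m J y.
      by apply: filterS (change_near ac ah ct ht cF anX) => y [].
    exact: (nz _ n0).
  have n2 : \forall s \near t, differentiable (h \o F) (z s).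
    exact: (nz _ (vec_analytic_near_diff anh)).
  apply: filterS3 n1 n2 (near_I t It) => s hJ dh Is.
  have [[_ _ dzs] _ _ _ _] := HY s Is.
  have dc : differentiable ((h \o F) \o z) s by exact: differentiable_comp dzs dh.
  split; first exact: diff_derivable dc.
  rewrite /velocity derive1E; apply: (etrans (derive_comp (1 : R) dzs dh)).
  apply: (etrans (esym (mul_jacobian _ dh))).
  apply: (etrans (congr1 (mulmx ('D_1 z s)) hJ)).
  by rewrite mulmxA.
exists I, (F \o z); split.
  split=> //; last by rewrite /I/= normr0.
  by rewrite IE; exact: interval_is_interval.
split=> //.
- move=> t It; have [[Ut ct dz] dY geo _ _] := HY t It.
  have [cF imm] := F_immersion Ut; split.
    by apply: continuous_comp cF; exact: differentiable_continuous.
  move=> h ah ht; have := vel t h It ah ht.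
  set J := (fun y => jacobian (transition c h) (c (F y))) => nv.
  have [anX _] := imm c ac ct.
  have atau := transition_analytic ac ah ct ht.
  have dX : differentiable (c \o F) (z t) by exact: nbhs_singleton (vec_analytic_near_diff anX).
  have dJ := jacobian_diff atau.
  have dXz : differentiable ((c \o F) \o z) t by exact: differentiable_comp dz dX.
  have dJz : differentiable (fun s => J (z s)) t by exact: (differentiable_comp dXz dJ).
  have dv : differentiable (fun s => Y s *m J (z s)) t by exact: differentiable_mulmx.
  have nv' : \forall s \near t, Y s *m J (z s) = velocity h (F \o z) s.
    by apply: filterS nv => s [_ ->].
  have vt : velocity h (F \o z) t = Y t *m J (z t) by have [] := nbhs_singleton nv.
  split.
  + by apply: filterS nv => s [].
  + have [dv' _] := near_eq_diff nv' dv; exact: diff_derivable.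
  + have DJ : 'D_1 (fun s => J (z s)) t =
        'D_(Y t) (jacobian (transition c h)) (c (F (z t))).
      apply: (etrans (derive_comp (1 : R) dXz dJ)); congr ('D_ _ _ _).
      apply: (etrans (derive_comp (1 : R) dz dX)).
      exact: esym (mul_jacobian _ dX).
    have E1 : derive1 (velocity h (F \o z)) t =
        'D_1 Y t *m J (z t) + Y t *m 'D_(Y t) (jacobian (transition c h)) (c (F (z t))).
      rewrite derive1E; apply: (etrans (esym (near_eq_derive _ nv'))).
      apply: (etrans (derive_mulmx (1 : R) dY dJz)).
      exact: (congr1 (fun x => 'D_1 Y t *m J (z t) + Y t *m x) DJ).
    have E2 := christoffel_transition g ac ah ct ht (Y t) (Y t).
    apply: (etrans (congr2 +%R E1 (congr2 (christoffel_form g h (h (F (z t)))) vt vt))).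
    rewrite -addrA [X in _ + X]addrC -E2 -mulmxDl.
    have := geo; rewrite mul_connection -/(Y t) => ->.
    by rewrite mul0mx.
- move=> t It h ah ht; have [[Ut ct dz] dY _ Y0 YY] := HY t It.
  have [_ vt] := nbhs_singleton (vel t h It ah ht).
  have Ju := jacobian_unit ac ah ct ht.
  rewrite vt; split.
    apply: contra Y0 => /eqP h0; apply/eqP.
    by rewrite -[Y t](mulmxK Ju) h0 mul0mx.
  rewrite /gdot -[RHS]YY (gram_transition g ac ah ct ht) trmx_mul.
  by rewrite !mulmxA.
Qed.

End Assembly.

Theorem theoremD (R : realType) (n : nat) (n_ge2 : (2 <= n)%N)
  (M : orientedManifold R n.+1) (g : lorentzMetric M)
  (U : set 'rV[R]_n) (U_open : open U) (U_connected : connected U)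
  (F : 'rV[R]_n -> M) (F_immersion : analytic_immersion F U)
  (o : 'rV[R]_n) (o_light_like : light_like_points g F U o)
  (H : 'rV[R]_n -> R) (H_analytic : analytic_on U H)
  (H_extends : forall u, (U `\` light_like_points g F U) u -> H u = HF g F u)
  (H_bounded : log_abs_bounded U H) :
  exists2 P : set M, light_like_geodesic_segment g P (F o) & P `<=` F @` U.
Proof.
have [Uo Bo] := o_light_like; have [ac co] := chart_atP (F o).
move: ac co; set c := chart_at (F o) => ac co.
have [W [e [[oW Wo WU Wc] sV sG sTh Punit]]] :=
  local_setup g U_open F_immersion ac co Uo.
have lsym := local_sym g ac Wc; have lunit := local_unit g ac Wc.
have n0 : (0 < n)%N by exact: leq_trans n_ge2.
have beta_o : beta (jac F c) (fun u => g c (c (F u))) e o = 0.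
  have := BF_local g F_immersion ac WU Wc Punit Wo; rewrite Bo => /esym/eqP.
  rewrite mulf_eq0 oppr_eq0 => /orP[/eqP//|].
  have := gram_frame_unit (lunit o Wo) (Punit o Wo).
  by rewrite unitmxE unitfE => /negPf ->.
have db0 := dbeta0 F_immersion ac oW WU Wc sV sG sTh Punit n0 H_extends H_bounded.
have [C HC] := mean_trace_bound F_immersion ac oW WU Wc sV sG sTh Punit n0
  H_extends H_bounded Wo.
have [d d0 [z [z0 Hz]]] := null_geodesic oW sV sG sTh (connection_sum g F c)
  lsym lunit Punit (local_compat g F_immersion ac WU Wc)
  (local_torsion_free g F_immersion ac WU Wc) Wo beta_o db0 HC.
exists ((F \o z) @` [set t | `|t| < d]).
  rewrite -z0; apply: (null_curve_geodesic F_immersion ac _ d0) => t td.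
  have [[Wz dz] h1 h2 h3 h4] := Hz t td.
  by split=> //; split=> //; [exact: WU|exact: Wc].
by move=> _ [t td <-]; exists (z t) => //; have [[Wz _] _ _ _ _] := Hz t td; exact: WU.
Qed.
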